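(* Let $B=(b_1,\ldots,b_n) \in \mathcal S(\mathbb C^n, \mathbb C)$ be such that $\log(1-BB^* ) \in L^1(\mathbb T)$. Let $A: \mathbb D \rightarrow \mathcal L(\mathbb C^n, \mathbb C^n)$ be an outer function satisfying $B(\zeta)^*B(\zeta) + A(\zeta)^*A(\zeta) = I$ for a.e. $\zeta \in \mathbb T$, and let $\varphi = BA^{-1}: \mathbb D \rightarrow \mathcal L(\mathbb C^n, \mathbb C)$. Then $T_{\varphi}$ is a densely defined operator in $H^2_{\mathbb C^n}$, and the domain of $T_\varphi^*$ is $H(B)$. Moreover, $T_\varphi^*f = -f^+$ for $f \in H(B)$, and consequently, $$\|f\|_{H(B)}^2 = \|f\|_{H^2}^2 + \|T_\varphi^*f\|_{H^2_{\mathbb C^n}}^2, \quad f \in H(B).$$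
   Context: $\mathbb D$ is the open unit disc and $\mathbb T$ the unit circle. The Schur class $\mathcal S(\mathbb C^n,\mathbb C)$ consists of holomorphic $B:\mathbb D\to\mathcal L(\mathbb C^n,\mathbb C)$ with $\sup_{z\in\mathbb D}\|B(z)\|\le 1$. $H(B)$ is the de Branges–Rovnyak space, i.e. the reproducing kernel Hilbert space with kernel $K_B(z,\lambda)=\frac{1-B(z)B(\lambda)^*}{1-z\overline{\lambda}}$, $z,\lambda\in\mathbb D$. $H^2_{\mathcal Y}$ is the $\mathcal Y$-valued Hardy space (and $H^2=H^2_{\mathbb C}$), viewed as a closed subspace of $L^2(\mathbb T,\mathcal Y)$ via boundary values, with orthogonal projection $P$. For a measurable $\psi:\mathbb T\to\mathcal L(\mathcal X,\mathcal Y)$, the (possibly unbounded) Toeplitz operator is $T_\psi f=P(\psi f)$ with domain $\mathcal D(T_\psi)=\{f\in H^2_{\mathcal X}:\psi f\in L^2(\mathbb T,\mathcal Y)\}$. Under the hypothesis $\log(1-BB^* )\in L^1(\mathbb T)$, a function $f\in H^2$ belongs to $H(B)$ if and only if there exists $f^+\in H^2_{\mathbb C^n}$ with $T_B^*f+T_A^*f^+=0$; this $f^+$ is unique and $\|f\|_{H(B)}^2=\|f\|_{H^2}^2+\|f^+\|_{H^2_{\mathbb C^n}}^2$ (known result, Aleman–Malman). Since $A$ is outer, $A(z)$ is invertible for $z\in\mathbb D$. *)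

(* Defs.v *)
From HB Require Import structures.
From mathcomp Require Import all_boot all_order all_algebra.
From mathcomp Require Import all_classical all_reals all_analysis.
From mathcomp Require Import complex.

Set Implicit Arguments.
Unset Strict Implicit.
Unset Printing Implicit Defensive.

Import Order.TTheory GRing.Theory Num.Theory.
Import numFieldTopology.Exports numFieldNormedType.Exports.
Local Open Scope classical_set_scope.
Local Open Scope ring_scope.

Definition cre {R : realType} (z : R[i]) : R := @complex.Re R z.
Definition cim {R : realType} (z : R[i]) : R := @complex.Im R z.

Definition csq {R : realType} (z : R[i]) : R := cre z ^+ 2 + cim z ^+ 2.

Definition inD {R : realType} (z : R[i]) : bool := csq z < 1.

Definition cexpi {R : realType} (t : R) : R[i] := Complex (cos t) (sin t).

Definition adjmx {R : realType} {p q : nat} (M : 'M[R[i]]_(p, q)) : 'M[R[i]]_(q, p) :=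
  (map_mx (@conjc R) M)^T.

Definition msq {R : realType} {p q : nat} (M : 'M[R[i]]_(p, q)) : R :=
  \sum_i \sum_j csq (M i j).

(* The circle T is parametrized by t in [0, 2 pi], zeta = e^{it}, with
   normalized Lebesgue measure dt / (2 pi). *)
Definition Tset {R : realType} : set R := `[0%R, (2 * pi)%R].

Definition aeT {R : realType} (P : R -> Prop) : Prop :=
  (@lebesgue_measure R).-negligible (Tset `&` [set t | ~ P t]).

Definition cmeas {R : realType} (g : R -> R[i]) : Prop :=
  measurable_fun (@Tset R) (fun t => cre (g t)) /\
  measurable_fun (@Tset R) (fun t => cim (g t)).

Definition cint {R : realType} (g : R -> R[i]) : R[i] :=
  Complex (Rintegral (@lebesgue_measure R) Tset (fun t => cre (g t)) / (2 * pi))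
          (Rintegral (@lebesgue_measure R) Tset (fun t => cim (g t)) / (2 * pi)).

Definition L2 {R : realType} (k : nat) (F : R -> 'cV[R[i]]_k) : Prop :=
  (forall i, cmeas (fun t => F t i 0)) /\
  (\int[@lebesgue_measure R]_(t in Tset) (msq (F t))%:E < +oo)%E.

Definition L2norm2 {R : realType} (k : nat) (F : R -> 'cV[R[i]]_k) : R :=
  Rintegral (@lebesgue_measure R) Tset (fun t => msq (F t)) / (2 * pi).

Definition inner {R : realType} (k : nat) (F G : R -> 'cV[R[i]]_k) : R[i] :=
  cint (fun t => \sum_i F t i 0 * conjc (G t i 0)).

Definition fourier {R : realType} (k : nat) (F : R -> 'cV[R[i]]_k) (m : int)
  : 'cV[R[i]]_k :=
  \col_i cint (fun t => F t i 0 * cexpi (- (m%:~R) * t)).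

(* H^2_{C^k} as the closed subspace of L^2 of boundary functions *)
Definition H2 {R : realType} (k : nat) (F : R -> 'cV[R[i]]_k) : Prop :=
  L2 F /\ forall m : int, (m < 0)%R -> fourier F m = 0.

(* Y = P G, P the orthogonal projection L^2 -> H^2 (G in L^2) *)
Definition isP {R : realType} (k : nat) (G Y : R -> 'cV[R[i]]_k) : Prop :=
  H2 Y /\ forall m : int, (0 <= m)%R -> fourier Y m = fourier G m.

Definition Tdom {R : realType} (m k : nat) (psi : R -> 'M[R[i]]_(m, k))
  (X : R -> 'cV[R[i]]_k) : Prop :=
  H2 X /\ L2 (fun t => psi t *m X t).

Definition Toep {R : realType} (m k : nat) (psi : R -> 'M[R[i]]_(m, k))
  (X : R -> 'cV[R[i]]_k) (Y : R -> 'cV[R[i]]_m) : Prop :=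
  Tdom psi X /\ isP (fun t => psi t *m X t) Y.

Definition densely_defined {R : realType} (m k : nat)
  (psi : R -> 'M[R[i]]_(m, k)) : Prop :=
  forall G : R -> 'cV[R[i]]_k, H2 G ->
  forall e : R, 0 < e -> exists X, Tdom psi X /\ L2norm2 (fun t => G t - X t) < e.

Definition adj_rel {R : realType} (m k : nat) (psi : R -> 'M[R[i]]_(m, k))
  (F : R -> 'cV[R[i]]_m) (h : R -> 'cV[R[i]]_k) : Prop :=
  H2 F /\ H2 h /\
  forall X Y, Toep psi X Y -> inner Y F = inner X h.

Definition holo {R : realType} (f : R[i] -> R[i]) : Prop :=
  forall z, inD z -> exists d : R[i], forall e : R, 0 < e ->
    exists2 del : R, 0 < del & forall w, inD w ->
      0 < csq (w - z) < del -> csq ((f w - f z) / (w - z) - d) < e.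

Definition holomx {R : realType} (p q : nat) (M : R[i] -> 'M[R[i]]_(p, q)) : Prop :=
  forall i j, holo (fun z => M z i j).

Definition schur {R : realType} (n : nat) (B : R[i] -> 'M[R[i]]_(1, n)) : Prop :=
  holomx B /\ forall z, inD z -> forall v : 'cV[R[i]]_n, msq (B z *m v) <= msq v.

Definition Hinf {R : realType} (p q : nat) (M : R[i] -> 'M[R[i]]_(p, q)) : Prop :=
  holomx M /\ exists c : R, forall z, inD z -> forall v : 'cV[R[i]]_q,
    msq (M z *m v) <= c * msq v.

Definition radlim {R : realType} (f : R[i] -> R[i]) (t : R) (l : R[i]) : Prop :=
  forall e : R, 0 < e -> exists2 d : R, 0 < d & forall r : R,
    1 - d < r -> r < 1 -> csq (f (Complex r 0 * cexpi t) - l) < e.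

Definition bdry {R : realType} (p q : nat) (M : R[i] -> 'M[R[i]]_(p, q))
  (Mb : R -> 'M[R[i]]_(p, q)) : Prop :=
  aeT (fun t => forall i j, radlim (fun z => M z i j) t (Mb t i j)).

Definition outer {R : realType} (n : nat) (A : R[i] -> 'M[R[i]]_n)
  (Ab : R -> 'M[R[i]]_n) : Prop :=
  Hinf A /\ bdry A Ab /\
  forall G : R -> 'cV[R[i]]_n, H2 G -> forall e : R, 0 < e ->
    exists X, H2 X /\ L2norm2 (fun t => G t - Ab t *m X t) < e.

(* log(1 - B B^* ) in L^1(T) (in particular 1 - B B^* > 0 a.e.) *)
Definition log_integrable {R : realType} (n : nat) (Bb : R -> 'M[R[i]]_(1, n)) : Prop :=
  aeT (fun t => 0 < 1 - cre ((Bb t *m adjmx (Bb t)) 0 0)) /\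
  (@lebesgue_measure R).-integrable Tset
     (fun t => (ln (1 - cre ((Bb t *m adjmx (Bb t)) 0 0)))%:E).

(* extension of a boundary function F in H^2 to D (Cauchy integral) *)
Definition ext {R : realType} (F : R -> 'cV[R[i]]_1) (z : R[i]) : R[i] :=
  cint (fun t => F t 0 0 / (1 - z * conjc (cexpi t))).

Definition kerB {R : realType} (n : nat) (B : R[i] -> 'M[R[i]]_(1, n)) (z w : R[i])
  : R[i] := (1 - (B z *m adjmx (B w)) 0 0) / (1 - z * conjc w).

(* finite combinations sum_j c_j K_B(., lambda_j), as lists of (c_j, lambda_j) *)
Definition keval {R : realType} (n : nat) (B : R[i] -> 'M[R[i]]_(1, n))
  (s : seq (R[i] * R[i])) (z : R[i]) : R[i] :=
  \sum_(p <- s) p.1 * kerB B z p.2.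

(* || sum_j c_j K_{lambda_j} ||^2 = sum_{j,k} c_j conj(c_k) K(lambda_k, lambda_j) *)
Definition knorm2 {R : realType} (n : nat) (B : R[i] -> 'M[R[i]]_(1, n))
  (s : seq (R[i] * R[i])) : R :=
  cre (\sum_(p <- s) \sum_(q <- s) p.1 * conjc q.1 * kerB B q.2 p.2).

Definition kdiff {R : realType} (s s' : seq (R[i] * R[i])) : seq (R[i] * R[i]) :=
  s ++ map (fun p => (- p.1, p.2)) s'.

Definition HB_approx {R : realType} (n : nat) (B : R[i] -> 'M[R[i]]_(1, n))
  (g : nat -> seq (R[i] * R[i])) (f : R[i] -> R[i]) : Prop :=
  (forall m, all (fun p => inD p.2) (g m)) /\
  (forall e : R, 0 < e -> exists N, forall p q, (N <= p)%N -> (N <= q)%N ->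
     knorm2 B (kdiff (g p) (g q)) < e) /\
  (forall z, inD z -> forall e : R, 0 < e -> exists N, forall m, (N <= m)%N ->
     csq (keval B (g m) z - f z) < e).

(* f belongs to H(B) (completion of the span of the kernel functions) *)
Definition inHB {R : realType} (n : nat) (B : R[i] -> 'M[R[i]]_(1, n))
  (f : R[i] -> R[i]) : Prop :=
  exists g, HB_approx B g f.

Definition HBnorm2 {R : realType} (n : nat) (B : R[i] -> 'M[R[i]]_(1, n))
  (f : R[i] -> R[i]) (v : R) : Prop :=
  inHB B f /\ forall g, HB_approx B g f -> (fun m => knorm2 B (g m)) @ \oo --> v.

(* Main.v *)
Require Import Defs.
From HB Require Import structures.
From mathcomp Require Import all_boot all_order all_algebra.
From mathcomp Require Import all_classical all_reals all_analysis.
From mathcomp Require Import measurable_realfun complex ring lra.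

Set Implicit Arguments.
Unset Strict Implicit.
Unset Printing Implicit Defensive.

Import Order.TTheory GRing.Theory Num.Theory.
Import numFieldTopology.Exports numFieldNormedType.Exports.
Local Open Scope classical_set_scope.
Local Open Scope ring_scope.

(* Put L = B^* phi + A^* on the circle.  From phi A = B and B^* B + A^* A = I we
   get L A = I, hence A L = I and B L = phi.  If X is in the domain of T_phi, then
   u = L X is in L^2, A u = X is in H^2 and B u = phi X; since A is outer, u is in
   H^2.  So the domain of T_phi is A H^2, which is dense, and T_phi (A u) = B u.

   Consequently T_phi^* F = h if and only if (F, - h) belongs to the orthogonal
   complement M of the range of the isometry u |-> (B u, A u) from H^2 to
   H^2 + H^2_{C^n}; the pairs (f, f^+) of the Aleman-Malman theorem are exactly
   the elements of M.  The vectors (k_la, 0) - (B, A) B(la)^* k_la, with k_la the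
   Szego kernel, belong to M, have Gram matrix K_B, and represent the evaluation
   of the first component at la.  They span a dense subspace: an element (0, G)
   of M has G orthogonal to A H^2, so that G = 0.  Hence (F, G) |-> F is a unitary
   map from M onto H(B).

   That A u in H^2 and u in L^2 imply u in H^2 is reduced to scalars: det A u is
   in H^2, and 1 is in the L^2-closure of det A * H^infty.  The Cauchy formula for
   boundary values comes from Goursat's bisection, applied to the homotopy
   la + s (e^{it} - la); the uniqueness of Fourier coefficients comes from
   trigonometric polynomials converging boundedly to indicators of arcs. *)

(** * Complex numbers and integrals *)

(** T_B^* f + T_A^* f^+ = 0 says that P(B^* f + A^* f^+) vanishes, that is, that (f, f^+) is
    orthogonal to every (B u, A u) with u in H^2; this is why the Aleman-Malman pairs are the
    elements of M. H(B) is given by Cauchy sequences of kernel combinations, so its norm is known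
    once these combinations are realized isometrically in M. Outerness gives polynomials p_j with A
    p_j close to the basis vectors, an approximate right inverse of A. Recovering u from A u calls
    for a left one; the adjugate supplies it once the scalar det A can be inverted approximately,
    hence the detour through determinants. Elements of L^2 are functions, not classes: two of them
    are identified when [L2norm2 (F - G) = 0], and the data on the circle are constrained only
    almost everywhere. The argument is run for data that satisfy the identities at every real t; the
    general case follows by overriding the data on one null set. Moduli occur squared, as [csq].
    Many numerical constants below come from |x + y|^2 <= 2 (|x|^2 + |y|^2), used in place of the
    triangle inequality. *)

Section ComplexArithmetic.
Context {R : realType}.
Implicit Types (x y z : R[i]) (a b : R).

Lemma complex_eqP x y : cre x = cre y -> cim x = cim y -> x = y.
Proof. by case: x => a b; case: y => c d; rewrite /cre /cim /= => -> ->. Qed.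

Lemma creD x y : cre (x + y) = cre x + cre y.
Proof. by case: x; case: y. Qed.
Lemma cimD x y : cim (x + y) = cim x + cim y.
Proof. by case: x; case: y. Qed.
Lemma creN x : cre (- x) = - cre x.
Proof. by case: x. Qed.
Lemma cimN x : cim (- x) = - cim x.
Proof. by case: x. Qed.
Lemma creM x y : cre (x * y) = cre x * cre y - cim x * cim y.
Proof. by case: x; case: y. Qed.
Lemma cimM x y : cim (x * y) = cre x * cim y + cim x * cre y.
Proof. by case: x; case: y => /= *; rewrite addrC. Qed.
Lemma cre_conj x : cre (conjc x) = cre x.
Proof. by case: x. Qed.
Lemma cim_conj x : cim (conjc x) = - cim x.
Proof. by case: x. Qed.
Lemma cre0 : cre (0 : R[i]) = 0. Proof. by []. Qed.
Lemma cim0 : cim (0 : R[i]) = 0. Proof. by []. Qed.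
Lemma cre1 : cre (1 : R[i]) = 1. Proof. by []. Qed.
Lemma cim1 : cim (1 : R[i]) = 0. Proof. by []. Qed.

Definition creE := (creD, creN, creM, cre_conj, cre0, cre1).
Definition cimE := (cimD, cimN, cimM, cim_conj, cim0, cim1).

Lemma cre_sum (I : Type) (r : seq I) (P : pred I) (F : I -> R[i]) :
  cre (\sum_(i <- r | P i) F i) = \sum_(i <- r | P i) cre (F i).
Proof. by apply: (big_morph (@cre R) creD cre0). Qed.
Lemma cim_sum (I : Type) (r : seq I) (P : pred I) (F : I -> R[i]) :
  cim (\sum_(i <- r | P i) F i) = \sum_(i <- r | P i) cim (F i).
Proof. by apply: (big_morph (@cim R) cimD cim0). Qed.

Lemma csq_ge0 z : 0 <= csq z.
Proof. by rewrite addr_ge0 ?sqr_ge0. Qed.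
Lemma csqM x y : csq (x * y) = csq x * csq y.
Proof. by rewrite /csq creM cimM; ring. Qed.
Lemma csqN x : csq (- x) = csq x.
Proof. by rewrite /csq creN cimN; ring. Qed.
Lemma csq_conj x : csq (conjc x) = csq x.
Proof. by rewrite /csq cre_conj cim_conj; ring. Qed.
Lemma csq0 : csq (0 : R[i]) = 0.
Proof. by rewrite /csq cre0 cim0; ring. Qed.
Lemma csq1 : csq (1 : R[i]) = 1.
Proof. by rewrite /csq cre1 cim1; ring. Qed.
Lemma csq_real a : csq (Complex a 0) = a ^+ 2.
Proof. by rewrite /csq /cre /cim /= expr0n addr0. Qed.
Lemma csqD_le x y : csq (x + y) <= 2 * (csq x + csq y).
Proof.
rewrite /csq creD cimD -subr_ge0.
have -> : 2 * (cre x ^+ 2 + cim x ^+ 2 + (cre y ^+ 2 + cim y ^+ 2)) -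
  ((cre x + cre y) ^+ 2 + (cim x + cim y) ^+ 2) =
  (cre x - cre y) ^+ 2 + (cim x - cim y) ^+ 2 by ring.
by rewrite addr_ge0 ?sqr_ge0.
Qed.
Lemma csqB_le x y : csq (x - y) <= 2 * (csq x + csq y).
Proof. by have := csqD_le x (- y); rewrite csqN. Qed.
Lemma csq_eq0 z : (csq z == 0) = (z == 0).
Proof.
apply/idP/idP => [|/eqP->]; last by rewrite csq0.
rewrite paddr_eq0 ?sqr_ge0// !sqrf_eq0 => /andP[/eqP h1 /eqP h2].
by apply/eqP/complex_eqP.
Qed.
Lemma csq_gt0 z : (0 < csq z) = (z != 0).
Proof. by rewrite lt_neqAle csq_ge0 andbT eq_sym csq_eq0. Qed.
Lemma csqV z : csq z^-1 = (csq z)^-1.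
Proof.
have [->|z0] := eqVneq z 0; first by rewrite invr0 csq0 invr0.
have z1 : csq z != 0 by rewrite csq_eq0.
by apply: (mulfI z1); rewrite -csqM !divff// csq1.
Qed.
Lemma csqX z n : csq (z ^+ n) = csq z ^+ n.
Proof. by elim: n => [|n ih]; rewrite ?expr0 ?csq1// !exprS csqM ih. Qed.
Lemma mul_conjE z : z * conjc z = Complex (csq z) 0.
Proof. by case: z => a b; apply: complex_eqP; rewrite /csq /cre /cim /=; ring. Qed.
Lemma cre_sq_le z : cre z ^+ 2 <= csq z.
Proof. by rewrite lerDl sqr_ge0. Qed.
Lemma cim_sq_le z : cim z ^+ 2 <= csq z.
Proof. by rewrite lerDr sqr_ge0. Qed.
Lemma conjcB x y : conjc (x - y) = conjc x - conjc y.
Proof. exact: rmorphB. Qed.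
Lemma conjcD x y : conjc (x + y) = conjc x + conjc y.
Proof. exact: rmorphD. Qed.
Lemma conjcM x y : conjc (x * y) = conjc x * conjc y.
Proof. exact: rmorphM. Qed.
Lemma conjcN x : conjc (- x) = - conjc x.
Proof. exact: rmorphN. Qed.
Lemma conjc_sum (I : Type) (r : seq I) (P : pred I) (F : I -> R[i]) :
  conjc (\sum_(i <- r | P i) F i) = \sum_(i <- r | P i) conjc (F i).
Proof. exact: rmorph_sum. Qed.

Lemma csq_sum_le (I : finType) (F : I -> R[i]) :
  csq (\sum_i F i) <= #|I|%:R * \sum_i csq (F i).
Proof.
have cs (G : I -> R) : (\sum_i G i) ^+ 2 <= #|I|%:R * \sum_i G i ^+ 2.
  set S := \sum_i G i; set Q := \sum_i G i ^+ 2.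
  (* Lagrange's identity: by [h], the double sum of the (G i - G j)^2 equals 2 (#|I| Q - S^2), so
     its nonnegativity is the claim. *)
  have h a : \sum_j (a - G j) ^+ 2 = #|I|%:R * a ^+ 2 - 2 * a * S + Q.
    rewrite /S /Q mulr_sumr -sumrN mulr_natl -[X in X + _ + _]sumr_const -!big_split /=.
    by apply: eq_bigr => j _; ring.
  have : 0 <= \sum_i \sum_j (G i - G j) ^+ 2.
    by apply: sumr_ge0 => i _; apply: sumr_ge0 => j _; rewrite sqr_ge0.
  under eq_bigr => i _ do rewrite h.
  rewrite !big_split /= sumrN -mulr_suml -!mulr_sumr -/S -/Q sumr_const -mulr_natl.
  lra.
by rewrite /csq cre_sum cim_sum big_split /= mulrDr lerD.
Qed.

Lemma csq_cexpi a : csq (cexpi a) = 1.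
Proof. by rewrite /csq /cexpi /cre /cim /= cos2Dsin2. Qed.
Lemma cexpiD a b : cexpi (a + b) = cexpi a * cexpi b.
Proof.
by apply: complex_eqP; rewrite ?creE ?cimE /cexpi /cre /cim /= ?cosD ?sinD; ring.
Qed.
Lemma cexpi0 : cexpi (0 : R) = 1.
Proof. by rewrite /cexpi cos0 sin0. Qed.
Lemma cexpiN a : cexpi (- a) = conjc (cexpi a).
Proof. by rewrite /cexpi cosN sinN. Qed.
Lemma cexpiVJ a : cexpi a * conjc (cexpi a) = 1.
Proof. by rewrite mul_conjE csq_cexpi. Qed.
Lemma cexpi_nat (m : nat) a : cexpi (m%:R * a) = cexpi a ^+ m.
Proof.
elim: m => [|m ih]; first by rewrite mul0r cexpi0 expr0.
by rewrite -[m.+1%:R](natr1 m) mulrDl mul1r cexpiD ih exprSr.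
Qed.

End ComplexArithmetic.

Section ComplexLimits.
Context {R : realType} {I : Type} (F : set_system I) {FF : ProperFilter F}.
Implicit Types (u v : I -> R[i]) (x y : R[i]).

Definition ccvg u x :=
  (fun t => cre (u t)) @ F --> cre x /\ (fun t => cim (u t)) @ F --> cim x.

Lemma ccvg_small u x : (forall e : R, 0 < e -> \forall t \near F, csq (u t - x) < e) -> ccvg u x.
Proof.
move=> h; have key (pr : R[i] -> R) : (forall a b, pr (a - b) = pr a - pr b) ->
    (forall a, pr a ^+ 2 <= csq a) -> (fun t => pr (u t)) @ F --> pr x.
  move=> prB pr_le; apply/cvgrPdist_lt => e e0.
  apply: filterS (h _ (exprn_gt0 2 e0)) => t ht.
  rewrite distrC -prB -(ltr_pXn2r (n := 2)) ?nnegrE//; last exact: ltW.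
  by rewrite real_normK ?num_real//; apply: le_lt_trans (pr_le _) ht.
split; apply: key => [a b|a]; rewrite ?creD ?creN ?cimD ?cimN//.
- exact: cre_sq_le.
- exact: cim_sq_le.
Qed.

Lemma ccvg_unique u x y : ccvg u x -> ccvg u y -> x = y.
Proof.
move=> [rx ix] [ry iy].
by apply: complex_eqP; [exact: (cvg_unique _ rx ry)|exact: (cvg_unique _ ix iy)].
Qed.

Lemma ccvg_cst x : ccvg (fun=> x) x.
Proof. by split; exact: cvg_cst. Qed.

Lemma ccvg_real (u : I -> R) (x : R) : u @ F --> x -> ccvg (fun t => Complex (u t) 0) (Complex x 0).
Proof. by move=> ux; split => //; exact: cvg_cst. Qed.

Lemma ccvgD u v x y : ccvg u x -> ccvg v y -> ccvg (fun t => u t + v t) (x + y).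
Proof.
move=> [ru iu] [rv iv]; split.
  by rewrite creD; under eq_fun do rewrite creD; exact: cvgD.
by rewrite cimD; under eq_fun do rewrite cimD; exact: cvgD.
Qed.

Lemma ccvgM u v x y : ccvg u x -> ccvg v y -> ccvg (fun t => u t * v t) (x * y).
Proof.
move=> [ru iu] [rv iv]; split.
  by rewrite creM; under eq_fun do rewrite creM; apply: cvgB; exact: cvgM.
by rewrite cimM; under eq_fun do rewrite cimM; apply: cvgD; exact: cvgM.
Qed.

Lemma ccvg_conj u x : ccvg u x -> ccvg (fun t => conjc (u t)) (conjc x).
Proof.
move=> [ru iu]; split.
  by rewrite cre_conj; under eq_fun do rewrite cre_conj.
by rewrite cim_conj; under eq_fun do rewrite cim_conj; exact: cvgN.
Qed.

Lemma ccvg_csq u x : ccvg u x -> (fun t => csq (u t)) @ F --> csq x.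
Proof.
move=> [ru iu]; rewrite /csq; apply: cvgD.
  by rewrite expr2; under eq_fun do rewrite expr2; exact: cvgM.
by rewrite expr2; under eq_fun do rewrite expr2; exact: cvgM.
Qed.

End ComplexLimits.

Section ComplexIntegral.
Context {R : realType}.
Local Notation mu := (@lebesgue_measure R).
Variables (D : set R) (mD : measurable D).
Implicit Types (f g : R -> R[i]) (a : R[i]).

Definition cmeasurable f :=
  measurable_fun D (fun t => cre (f t)) /\ measurable_fun D (fun t => cim (f t)).

Definition cintegrable f :=
  mu.-integrable D (EFin \o (fun t => cre (f t))) /\
  mu.-integrable D (EFin \o (fun t => cim (f t))).

Definition cintegral f : R[i] :=
  Complex (Rintegral mu D (fun t => cre (f t))) (Rintegral mu D (fun t => cim (f t))).

Lemma cmeasurable_cst a : cmeasurable (fun=> a).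
Proof. by split; exact: measurable_cst. Qed.

Lemma cmeasurableD f g : cmeasurable f -> cmeasurable g ->
  cmeasurable (fun t => f t + g t).
Proof.
move=> [f1 f2] [g1 g2]; split.
  by under eq_fun do rewrite creD; exact: measurable_funD.
by under eq_fun do rewrite cimD; exact: measurable_funD.
Qed.

Lemma cmeasurableM f g : cmeasurable f -> cmeasurable g ->
  cmeasurable (fun t => f t * g t).
Proof.
move=> [f1 f2] [g1 g2]; split.
  under eq_fun do rewrite creM.
  by apply: measurable_funB; exact: measurable_funM.
under eq_fun do rewrite cimM.
by apply: measurable_funD; exact: measurable_funM.
Qed.

Lemma cmeasurableN f : cmeasurable f -> cmeasurable (fun t => - f t).
Proof.
move=> [f1 f2]; split.
  by under eq_fun do rewrite creN; exact: measurable_funN.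
by under eq_fun do rewrite cimN; exact: measurable_funN.
Qed.

Lemma cmeasurable_conj f : cmeasurable f -> cmeasurable (fun t => conjc (f t)).
Proof.
move=> [f1 f2]; split; first by under eq_fun do rewrite cre_conj.
by under eq_fun do rewrite cim_conj; exact: measurable_funN.
Qed.

Lemma measurable_csq f : cmeasurable f -> measurable_fun D (fun t => csq (f t)).
Proof.
move=> [f1 f2]; rewrite /csq.
by apply: measurable_funD; apply: measurable_funX.
Qed.

Lemma cmeasurable_cvg (f_ : nat -> R -> R[i]) f : (forall p, cmeasurable (f_ p)) ->
  (forall t, D t -> ccvg \oo (f_ ^~ t) (f t)) -> cmeasurable f.
Proof.
move=> mf cv; split.
  by apply: (measurable_fun_cvg (fun p => (mf p).1)) => t /cv[].
by apply: (measurable_fun_cvg (fun p => (mf p).2)) => t /cv[].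
Qed.

Lemma eq_cintegral f g : {in D, f =1 g} -> cintegral f = cintegral g.
Proof.
move=> fg; rewrite /cintegral; congr Complex; apply: eq_Rintegral => t tD;
  by rewrite fg.
Qed.

Lemma cintegrable_meas f : cintegrable f -> cmeasurable f.
Proof.
by move=> [f1 f2]; split; apply/measurable_EFinP; exact: (measurable_int mu).
Qed.

Lemma integrable_sublin (u v : R -> R) (a b : R) :
  mu.-integrable D (EFin \o u) -> mu.-integrable D (EFin \o v) ->
  mu.-integrable D (EFin \o (fun t => a * u t + b * v t)).
Proof.
move=> iu iv.
have -> : EFin \o (fun t => a * u t + b * v t) =
  (fun t => a%:E * (EFin \o u) t)%E \+ (fun t => b%:E * (EFin \o v) t)%E by [].
by apply: integrableD => //; exact: integrableZl.
Qed.

Lemma Rintegral_lin (u v : R -> R) (a b : R) :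
  mu.-integrable D (EFin \o u) -> mu.-integrable D (EFin \o v) ->
  Rintegral mu D (fun t => a * u t + b * v t) =
  a * Rintegral mu D u + b * Rintegral mu D v.
Proof.
move=> iu iv.
have iz c (w : R -> R) : mu.-integrable D (EFin \o w) ->
    mu.-integrable D (EFin \o (fun t => c * w t)).
  move=> iw.
  have -> : EFin \o (fun t => c * w t) = (fun t => c%:E * (EFin \o w) t)%E by [].
  exact: integrableZl.
rewrite RintegralD//; [|exact: iz..].
by rewrite !RintegralZl.
Qed.

Let cre_lin f g a : (fun t => cre (a * f t + g t)) =
  (fun t => 1 * (cre a * cre (f t) + (- cim a) * cim (f t)) + 1 * cre (g t)).
Proof. by apply/funext => t; rewrite !creE; ring. Qed.

Let cim_lin f g a : (fun t => cim (a * f t + g t)) =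
  (fun t => 1 * (cim a * cre (f t) + cre a * cim (f t)) + 1 * cim (g t)).
Proof. by apply/funext => t; rewrite !cimE; ring. Qed.

Lemma cintegrable_lin f g a : cintegrable f -> cintegrable g ->
  cintegrable (fun t => a * f t + g t).
Proof.
move=> [f1 f2] [g1 g2]; split; rewrite ?cre_lin ?cim_lin;
  by apply: integrable_sublin => //; exact: integrable_sublin.
Qed.

Lemma cintegral_lin f g a : cintegrable f -> cintegrable g ->
  cintegral (fun t => a * f t + g t) = a * cintegral f + cintegral g.
Proof.
move=> [f1 f2] [g1 g2]; rewrite {1}/cintegral cre_lin cim_lin.
rewrite !Rintegral_lin//; [|exact: integrable_sublin..].
by apply: complex_eqP; rewrite !(creE, cimE) /cintegral /cre /cim /=; ring.
Qed.

Lemma cintegrable0 : cintegrable (fun=> 0).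
Proof. by split; exact: integrable0. Qed.

Lemma cintegral0 : cintegral (fun=> 0) = 0.
Proof.
by apply: complex_eqP; rewrite /cintegral /cre /cim /= /Rintegral integral0.
Qed.

Lemma cintegrableZ f a : cintegrable f -> cintegrable (fun t => a * f t).
Proof.
move=> fi; have := cintegrable_lin a fi cintegrable0.
by under eq_fun do rewrite addr0.
Qed.

Lemma cintegralZ f a : cintegrable f ->
  cintegral (fun t => a * f t) = a * cintegral f.
Proof.
move=> fi; have := cintegral_lin a fi cintegrable0.
by rewrite cintegral0 addr0; under eq_fun do rewrite addr0.
Qed.

Lemma cintegrableD f g : cintegrable f -> cintegrable g ->
  cintegrable (fun t => f t + g t).
Proof.
move=> fi gi; have := cintegrable_lin 1 fi gi.
by under eq_fun do rewrite mul1r.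
Qed.

Lemma cintegralD f g : cintegrable f -> cintegrable g ->
  cintegral (fun t => f t + g t) = cintegral f + cintegral g.
Proof.
move=> fi gi; have := cintegral_lin 1 fi gi.
by rewrite mul1r; under eq_fun do rewrite mul1r.
Qed.

Lemma cintegrableN f : cintegrable f -> cintegrable (fun t => - f t).
Proof.
move=> fi; have := cintegrableZ (-1) fi.
by under eq_fun do rewrite mulN1r.
Qed.

Lemma cintegralN f : cintegrable f -> cintegral (fun t => - f t) = - cintegral f.
Proof.
move=> fi; have := cintegralZ (-1) fi.
by rewrite mulN1r; under eq_fun do rewrite mulN1r.
Qed.

Lemma cintegralB f g : cintegrable f -> cintegrable g ->
  cintegral (fun t => f t - g t) = cintegral f - cintegral g.
Proof.
by move=> fi gi; rewrite cintegralD ?cintegralN//; exact: cintegrableN.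
Qed.

Lemma cintegrable_sum (I : Type) (r : seq I) (F : I -> R -> R[i]) :
  (forall i, cintegrable (F i)) -> cintegrable (fun t => \sum_(i <- r) F i t).
Proof.
move=> mF; elim: r => [|i r ih].
  by under eq_fun do rewrite big_nil; exact: cintegrable0.
by under eq_fun do rewrite big_cons; exact: cintegrableD.
Qed.

Lemma cintegral_sum (I : Type) (r : seq I) (F : I -> R -> R[i]) :
  (forall i, cintegrable (F i)) ->
  cintegral (fun t => \sum_(i <- r) F i t) = \sum_(i <- r) cintegral (F i).
Proof.
move=> mF; elim: r => [|i r ih].
  by under eq_fun do rewrite big_nil; rewrite big_nil cintegral0.
under eq_fun do rewrite big_cons; rewrite big_cons cintegralD ?ih//.
exact: cintegrable_sum.
Qed.

Lemma cintegral_conj f : cintegrable f ->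
  cintegral (fun t => conjc (f t)) = conjc (cintegral f).
Proof.
move=> [f1 f2]; apply: complex_eqP; rewrite ?cre_conj ?cim_conj /cintegral /cre /cim /=.
  by apply: eq_Rintegral => t _; rewrite -/(cre _) cre_conj.
rewrite -mulN1r -RintegralZl//; apply: eq_Rintegral => t _.
by rewrite -/(cim _) cim_conj mulN1r.
Qed.

Lemma cintegrable_dom f (h : R -> R) : cmeasurable f ->
  mu.-integrable D (EFin \o h) ->
  (forall t, D t -> `|cre (f t)| <= h t /\ `|cim (f t)| <= h t) ->
  cintegrable f.
Proof.
move=> [m1 m2] ih fh; split; apply: (le_integrable _ _ _ ih) => //.
- exact/measurable_EFinP.
- move=> t Dt /=; rewrite lee_fin; apply: le_trans (fh t Dt).1 _.
  exact: ler_norm.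
- exact/measurable_EFinP.
- move=> t Dt /=; rewrite lee_fin; apply: le_trans (fh t Dt).2 _.
  exact: ler_norm.
Qed.

Hypothesis finD : (mu D < +oo)%E.

Lemma integrable_cst (k : R) : mu.-integrable D (EFin \o (fun=> k)).
Proof.
apply: measurable_bounded_integrable => //; exists `|k|; split => // x kx y Dy /=.
exact: ltW.
Qed.

Lemma normr_le_sq (a k : R) : 0 <= k -> a ^+ 2 <= k ^+ 2 -> `|a| <= k.
Proof.
by move=> k0 ak; rewrite -(ger0_norm k0) -(ler_pXn2r (n:=2)) ?nnegrE// !real_normK ?num_real.
Qed.

(** The square root of [k] is at most [k + 1]; this cruder bound keeps the majorants free of square
    roots. *)
Lemma csq_le_normre (z : R[i]) (k : R) : csq z <= k ->
  `|cre z| <= k + 1 /\ `|cim z| <= k + 1.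
Proof.
move=> zk; have k0 := le_trans (csq_ge0 z) zk.
have k1 : 0 <= k + 1 by rewrite addr_ge0.
split; apply: normr_le_sq => //.
  by have := cre_sq_le z; nra.
by have := cim_sq_le z; nra.
Qed.

Lemma cintegrable_bounded f (k : R) : cmeasurable f ->
  (forall t, D t -> csq (f t) <= k) -> cintegrable f.
Proof.
move=> mf fk; apply: (@cintegrable_dom _ (fun=> k + 1)) => //.
  exact: integrable_cst.
by move=> t Dt; apply: csq_le_normre; exact: fk.
Qed.

End ComplexIntegral.

(** * The space L^2 *)

Section NullSets.
Context d (T : measurableType d) {R : realType} (mu : {measure set T -> \bar R}).
Import HBNNSimple.

(* The integral of a non-measurable function is a junk value (a difference of
   lower integrals), but even that value does not see null sets. *)
Lemma integral_eq_off_null (D N : set T) (f g : T -> \bar R) :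
  measurable N -> mu N = 0%E ->
  (forall t, D t -> ~ N t -> f t = g t) ->
  (\int[mu]_(t in D) f t = \int[mu]_(t in D) g t)%E.
Proof.
move=> mN N0 fg.
have le_lower (F G : T -> \bar R) : (forall t, ~ N t -> F t = G t) ->
    (forall t, 0 <= G t)%E ->
    (ereal_sup [set sintegral mu h |
       h in [set h : {nnsfun _ >-> R} | forall x, (h x)%:E <= F x]] <=
     ereal_sup [set sintegral mu h |
       h in [set h : {nnsfun _ >-> R} | forall x, (h x)%:E <= G x]])%E.
  move=> FG G0; apply: ge_ereal_sup => _ [h hF <-].
  (* [h] may exceed [G] on [N]. Multiplying it by the indicator of the complement of [N] brings it
     below [G] everywhere and leaves its integral unchanged. *)
  apply: ereal_sup_ubound; exists (proj_nnsfun h (measurableC mN)).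
    move=> t /=; rewrite mindicE.
    have [|] := boolP (t \in ~` N) => /=.
      by rewrite inE => Nt; rewrite mulr1 -FG.
    by rewrite mulr0 G0.
  rewrite -(integralT_nnsfun mu h) -(integralT_nnsfun mu (proj_nnsfun h (measurableC mN))).
  apply: ge0_ae_eq_integral => //=.
  - apply: (measurableT_comp (f := EFin)) => //.
    exact: (measurable_funPT (proj_nnsfun h (measurableC mN))).
  - by apply: (measurableT_comp (f := EFin)).
  - by move=> t _; rewrite lee_fin mulr_ge0.
  - by move=> t _; rewrite lee_fin.
  exists N; split => // t /= /not_implyP[_ ne]; apply: contrapT => Nt; apply: ne.
  by rewrite mindicE mem_set//= mulr1.
rewrite /integral.
have FG t : ~ N t -> (f \_ D) t = (g \_ D) t.
  move=> Nt; rewrite !patchE; case: ifPn => // tD; apply: fg => //; exact: set_mem.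
congr (_ - _)%E; apply/eqP; rewrite eq_le; apply/andP; split; apply: le_lower => //.
- by move=> t Nt; rewrite unlock FG.
- by move=> t Nt; rewrite unlock FG.
- by move=> t Nt; rewrite unlock FG.
- by move=> t Nt; rewrite unlock FG.
Qed.

Lemma Rintegral_eq_off_null (D N : set T) (f g : T -> R) :
  measurable N -> mu N = 0%E ->
  (forall t, D t -> ~ N t -> f t = g t) ->
  Rintegral mu D f = Rintegral mu D g.
Proof.
move=> mN N0 fg; congr fine; apply: (integral_eq_off_null mN N0) => t Dt Nt.
by rewrite fg.
Qed.

End NullSets.

(** * Completeness of L^2 over an arbitrary measure *)

Section RieszFischer.
Context d (T : measurableType d) {R : realType} (mu : {measure set T -> \bar R}).
Variables (D : set T) (mD : measurable D).

Lemma measurable_sqrB (f g : T -> R) : measurable_fun D f -> measurable_fun D g ->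
  measurable_fun D (fun t => ((f t - g t) ^+ 2)%:E).
Proof.
move=> mf mg; apply/measurable_EFinP; apply: measurable_funX.
exact: measurable_funB.
Qed.

(** A subsequence with increments g_j (squared) of integral at most 8^-j is extracted. The series of
    the 4^j g_j is still integrable, hence finite almost everywhere, and its value G(t) bounds the
    j-th increment by sqrt(G(t)) 2^-j: the subsequence converges pointwise. Fatou's lemma then
    transfers the Cauchy estimate to the limit. *)
Lemma Riesz_Fischer (f_ : nat -> T -> R) :
  (forall p, measurable_fun D (f_ p)) ->
  (forall e : R, 0 < e -> exists N, forall p q, (N <= p)%N -> (N <= q)%N ->
    (\int[mu]_(t in D) ((f_ p t - f_ q t) ^+ 2)%:E < e%:E)%E) ->
  exists2 u : T -> R, measurable_fun D u &
    forall e : R, 0 < e -> exists N, forall p, (N <= p)%N ->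
    (\int[mu]_(t in D) ((f_ p t - u t) ^+ 2)%:E <= e%:E)%E.
Proof.
move=> mf cauchy.
(* The bound (2^-j)^3 leaves 2^-j after multiplication by the weight 4^j. *)
have e0 j : (0 : R) < (2^-1 ^+ j) ^+ 3 by rewrite !exprn_gt0.
pose phi j := sval (cid (cauchy _ (e0 j))).
have phiP j := svalP (cid (cauchy _ (e0 j))).
(* Summing the thresholds puts [psi j] and [psi j.+1] both beyond [phi j]; the extra [j] makes [psi]
   unbounded. *)
pose psi j := (\sum_(i < j.+1) phi i + j)%N.
have phi_psi j : (phi j <= psi j)%N.
  by rewrite /psi big_ord_recr /= -addnA addnC -addnA leq_addr.
have psi_ge j : (j <= psi j)%N by rewrite leq_addl.
have phi_psiS j : (phi j <= psi j.+1)%N.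
  by rewrite /psi !big_ord_recr /= -!addnA addnCA leq_addr.
pose g j t := (f_ (psi j.+1) t - f_ (psi j) t) ^+ 2.
have g0 j t : 0 <= g j t by exact: sqr_ge0.
have mg j : measurable_fun D (fun t => (g j t)%:E) by exact: measurable_sqrB.
have intg j : (\int[mu]_(t in D) (g j t)%:E <= ((2^-1 ^+ j) ^+ 3)%:E)%E.
  exact: ltW (phiP j _ _ (phi_psiS j) (phi_psi j)).
pose G t := (\sum_(j <oo) (4 ^+ j * g j t)%:E)%E.
have t0 j t : (0 <= (4 ^+ j * g j t)%:E)%E by rewrite lee_fin mulr_ge0.
have mt j : measurable_fun D (fun t => (4 ^+ j * g j t)%:E).
  under eq_fun do rewrite EFinM.
  exact: emeasurable_funM.
have G0 t : (0 <= G t)%E by exact: nneseries_ge0.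
have mG : measurable_fun D G by exact: ge0_emeasurable_sum.
have iG : mu.-integrable D G.
  apply/integrableP; split => //.
  under eq_integral do rewrite gee0_abs//.
  rewrite integral_nneseries//.
  apply: (@le_lt_trans _ _ (\sum_(j <oo) (2^-1 ^+ j)%:E)%E).
    apply: lee_nneseries => j _.
      by move=> _; exact: integral_ge0.
    under eq_integral do rewrite EFinM.
    rewrite ge0_integralZl//; [|by move=> t _; rewrite lee_fin].
    apply: (@le_trans _ _ ((4 ^+ j)%:E * ((2^-1 ^+ j) ^+ 3)%:E)%E).
      by rewrite lee_pmul2l// lte_fin exprn_gt0.
    rewrite -EFinM lee_fin exprAC -exprMn.
    by rewrite (_ : 4 * 2^-1 ^+ 3 = 2^-1 :> R)//; field.
  have := @cvg_geometric_eseries_half R 2 0.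
  rewrite (_ : (fun k => _) = (fun j => (2^-1 ^+ j)%:E)); last first.
    apply/funext => k; congr EFin.
    rewrite addn1 natrX exprS exprVn invfM mulrA divff ?mul1r// pnatr_eq0//.
  by move=> /cvg_lim ->//; rewrite ltry.
have [N [mN N0 Nfin]] := integrable_ae mD iG.
(* Setting the subsequence to 0 on the exceptional set makes it converge at every point of [D], so
   that its limit is measurable. *)
pose h j := f_ (psi j) \_ (~` N).
have hcvg t : D t -> cvgn (h^~ t).
  move=> Dt; have [Nt|Nt] := pselect (N t).
    rewrite (_ : h^~ t = fun=> 0); first exact: is_cvg_cst.
    by apply/funext => j; rewrite /h patchE memNset//; apply.
  rewrite (_ : h^~ t = fun j => f_ (psi j) t); last first.
    by apply/funext => j; rewrite /h patchE mem_set.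
  have Gt : G t \is a fin_num.
    by apply: contrapT => Gt; apply: Nt; apply: Nfin => /= /(_ Dt).
  have gG j : 4 ^+ j * g j t <= fine (G t).
    rewrite -lee_fin fineK//; apply: (@le_trans _ _ (\sum_(0 <= i < j.+1) (4 ^+ i * g i t)%:E)%E).
      by rewrite big_nat_recr//= leeDr// sume_ge0.
    by apply: nneseries_lim_ge.
  have Gt0 : 0 <= fine (G t) by rewrite fine_ge0.
  pose a := (fun j => f_ (psi j) t) : R^nat.
  have step j : `|telescope a j| <= geometric (Num.sqrt (fine (G t))) 2^-1 j.
    apply: normr_le_sq; first by rewrite mulr_ge0 ?sqrtr_ge0// exprn_ge0.
    rewrite /telescope /a -/(g j t) exprMn sqr_sqrtr// exprAC.
    have -> : 2^-1 ^+ 2 = 4^-1 :> R by field.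
    by rewrite exprVn ler_pdivlMr ?exprn_gt0// mulrC.
  have ac : cvgn (series (telescope a)).
    apply: normed_cvg; apply: (@series_le_cvg _ _ _ _ _ step) => //.
    - by move=> j; rewrite mulr_ge0 ?sqrtr_ge0// exprn_ge0.
    - by apply: is_cvg_geometric_series; rewrite ger0_norm ?invf_lt1 ?ltr1n.
  rewrite (_ : (fun j => _) = (fun j => a 0 + series (telescope a) j)).
    by apply: is_cvgD => //; exact: is_cvg_cst.
  by apply/funext => j; rewrite telescopeK addrC subrK.
have mh j : measurable_fun D (h j).
  apply/(measurable_restrict _ _ _) => //; first exact: measurableC.
  apply: measurable_funS (mf (psi j)) => //; exact: subIsetr.
have mu_ : measurable_fun D (fun t => limn (h^~ t)).
  by apply: (measurable_fun_cvg mh) => t Dt; exact: hcvg.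
exists (fun t => limn (h^~ t)) => // e egt0.
have [N1 N1P] := cauchy _ egt0.
exists N1 => p N1p.
(* Fatou in j, with p fixed: (f_p - u)^2 is the limit of the (f_p - h_j)^2, whose integrals are
   small for large j. *)
pose w j t := ((f_ p t - h j t) ^+ 2)%:E.
have -> : (\int[mu]_(t in D) ((f_ p t - limn (h^~ t)) ^+ 2)%:E =
    \int[mu]_(t in D) limn_einf (w^~ t))%E.
  apply: eq_integral => t /set_mem Dt; apply/esym.
  rewrite limn_einf_lim; apply/cvg_lim => //; apply: cvg_einfs.
  apply: cvg_EFin; first exact: nearW.
  apply: (@cvg_comp _ _ _ (fun j => f_ p t - h j t) (fun x => x ^+ 2)).
    by apply: cvgB; [exact: cvg_cst|exact: hcvg].
  exact: exprn_continuous.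
apply: le_trans (fatou mu mD _ _) _.
- by move=> j; exact: measurable_sqrB.
- by move=> j t _; rewrite lee_fin sqr_ge0.
rewrite limn_einf_lim; apply: lime_le; first exact: is_cvg_einfs.
near=> j; apply: (@le_trans _ _ (\int[mu]_(t in D) w j t)%E).
  by apply: ereal_inf_lbound; exists j => /=.
apply/ltW; rewrite (_ : (\int[mu]_(t in D) w j t)%E =
    (\int[mu]_(t in D) ((f_ p t - f_ (psi j) t) ^+ 2)%:E)%E); last first.
  apply: (integral_eq_off_null mN N0) => t Dt Nt.
  by rewrite /w /h patchE mem_set.
apply: N1P => //; apply: leq_trans (psi_ge j); near: j.
exact: nbhs_infty_ge.
Unshelve. all: by end_near. Qed.

End RieszFischer.

Section SquareIntegrable.
Context {R : realType}.
Local Notation mu := (@lebesgue_measure R).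
Local Notation T := (@Tset R).
Implicit Types (f g : R -> R[i]) (a : R[i]).

Lemma twopi_gt0 : 0 < 2 * pi :> R.
Proof. by rewrite mulr_gt0// pi_gt0. Qed.

Lemma measurable_Tset : measurable T.
Proof. exact: measurable_itv. Qed.
Local Notation mT := measurable_Tset.

Lemma lebesgue_Tset : mu T = (2 * pi)%:E.
Proof.
by rewrite /Tset lebesgue_measure_itv /= lte_fin twopi_gt0 -EFinB subr0.
Qed.

Lemma lebesgue_Tset_fin : (mu T < +oo)%E.
Proof. by rewrite lebesgue_Tset ltry. Qed.

Lemma cintE f : cint f = Complex (2 * pi)^-1 0 * cintegral T f.
Proof.
apply: complex_eqP; rewrite ?creE ?cimE /cint /cintegral /cre /cim /=; ring.
Qed.

Lemma cint0 : cint (fun=> 0 : R[i]) = 0.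
Proof. by rewrite cintE cintegral0 mulr0. Qed.

Lemma cintD f g : cintegrable T f -> cintegrable T g ->
  cint (fun t => f t + g t) = cint f + cint g.
Proof. by move=> fi gi; rewrite !cintE (cintegralD mT fi gi) mulrDr. Qed.

Lemma cintB f g : cintegrable T f -> cintegrable T g ->
  cint (fun t => f t - g t) = cint f - cint g.
Proof. by move=> fi gi; rewrite !cintE (cintegralB mT fi gi) mulrBr. Qed.

Lemma cintZ f a : cintegrable T f -> cint (fun t => a * f t) = a * cint f.
Proof. by move=> fi; rewrite !cintE (cintegralZ mT a fi) mulrCA. Qed.

Lemma cint_conj f : cintegrable T f -> cint (fun t => conjc (f t)) = conjc (cint f).
Proof.
move=> fi; rewrite !cintE (cintegral_conj mT fi) conjcM; congr (_ * _).
by apply: complex_eqP; rewrite /cre /cim /= ?oppr0.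
Qed.

Lemma cint_sum (I : Type) (r : seq I) (F : I -> R -> R[i]) :
  (forall i, cintegrable T (F i)) ->
  cint (fun t => \sum_(i <- r) F i t) = \sum_(i <- r) cint (F i).
Proof.
move=> Fi; rewrite cintE (cintegral_sum mT r Fi) mulr_sumr.
by apply: eq_bigr => i _; rewrite cintE.
Qed.

Definition sqi f :=
  cmeasurable T f /\ mu.-integrable T (EFin \o (fun t => csq (f t))).

Lemma sqi_dom f (h : R -> R) : cmeasurable T f -> mu.-integrable T (EFin \o h) ->
  (forall t, T t -> csq (f t) <= h t) -> sqi f.
Proof.
move=> mf ih fh; split=> //; apply: (le_integrable _ _ _ ih) => //.
- exact: mT.
- by apply/measurable_EFinP; exact: measurable_csq.
- move=> t Tt /=; rewrite lee_fin ger0_norm ?csq_ge0//.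
  by apply: le_trans (fh t Tt) _; exact: ler_norm.
Qed.

Lemma sqi_bounded f (K : R) : cmeasurable T f -> (forall t, T t -> csq (f t) <= K) ->
  sqi f.
Proof.
move=> mf; apply: sqi_dom => //; apply: integrable_cst; first exact: mT.
exact: lebesgue_Tset_fin.
Qed.

Lemma sqi_lin f g a : sqi f -> sqi g -> sqi (fun t => a * f t + g t).
Proof.
move=> [mf f2] [mg g2].
apply: (@sqi_dom _ (fun t => (2 * csq a) * csq (f t) + 2 * csq (g t))).
- by apply: cmeasurableD => //; apply: cmeasurableM => //; exact: cmeasurable_cst.
- by apply: integrable_sublin => //; exact: mT.
- move=> t _; apply: le_trans (csqD_le _ _) _; rewrite csqM; lra.
Qed.

Lemma sqi0 : sqi (fun=> 0).
Proof.
apply: (@sqi_bounded _ 0); first exact: cmeasurable_cst.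
by move=> t _; rewrite csq0.
Qed.

Lemma sqiD f g : sqi f -> sqi g -> sqi (fun t => f t + g t).
Proof.
by move=> sf sg; have := sqi_lin 1 sf sg; under eq_fun do rewrite mul1r.
Qed.

Lemma sqi_mulb b f (K : R) : cmeasurable T b -> (forall t, T t -> csq (b t) <= K) ->
  sqi f -> sqi (fun t => b t * f t).
Proof.
move=> mb bK [mf f2].
apply: (@sqi_dom _ (fun t => K * csq (f t) + 0 * csq (f t))).
- exact: cmeasurableM.
- by apply: integrable_sublin => //; exact: mT.
- by move=> t Tt; rewrite mul0r addr0 csqM ler_wpM2r ?csq_ge0// bK.
Qed.

Lemma sqi_conj f : sqi f -> sqi (fun t => conjc (f t)).
Proof.
move=> [mf f2]; split; first exact: cmeasurable_conj.
by under eq_fun do rewrite csq_conj.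
Qed.

Lemma sqi_sum (I : Type) (r : seq I) (F : I -> R -> R[i]) :
  (forall i, sqi (F i)) -> sqi (fun t => \sum_(i <- r) F i t).
Proof.
move=> mF; elim: r => [|i r ih].
  by under eq_fun do rewrite big_nil; exact: sqi0.
by under eq_fun do rewrite big_cons; exact: sqiD.
Qed.

Lemma cintegrable_sqiM f g : sqi f -> sqi g -> cintegrable T (fun t => f t * g t).
Proof.
move=> [mf f2] [mg g2].
apply: (@cintegrable_dom _ _ mT _ (fun t => 1 * csq (f t) + 1 * csq (g t))).
- exact: cmeasurableM.
- by apply: integrable_sublin => //; exact: mT.
have key (z : R[i]) (a b : R) : 0 <= a -> 0 <= b -> csq z <= a * b ->
    `|cre z| <= 1 * a + 1 * b /\ `|cim z| <= 1 * a + 1 * b.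
  move=> a0 b0 zab; split; apply: normr_le_sq; rewrite ?addr_ge0 ?mulr_ge0//.
    by have := cre_sq_le z; nra.
  by have := cim_sq_le z; nra.
by move=> t _; apply: key; rewrite ?csq_ge0// csqM.
Qed.

Lemma cintegrable_sqi f : sqi f -> cintegrable T f.
Proof.
move=> sf; have s1 : sqi (fun=> 1).
  apply: (@sqi_bounded _ 1); first exact: cmeasurable_cst.
  by move=> t _; rewrite csq1.
by have := cintegrable_sqiM sf s1; under eq_fun do rewrite mulr1.
Qed.

End SquareIntegrable.

Section L2Space.
Context {R : realType} (k : nat).
Local Notation mu := (@lebesgue_measure R).
Local Notation T := (@Tset R).
Local Notation mT := (@measurable_Tset R).
Local Notation V := (R -> 'cV[R[i]]_k).
Implicit Types (F G H : V) (a : R[i]).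

Lemma msqE (v : 'cV[R[i]]_k) : msq v = \sum_i csq (v i 0).
Proof. by apply: eq_bigr => i _; rewrite big_ord1. Qed.

Lemma msq_ge0 p q (v : 'M[R[i]]_(p, q)) : 0 <= msq v.
Proof. by apply: sumr_ge0 => i _; apply: sumr_ge0 => j _; exact: csq_ge0. Qed.

Lemma csq_le_msq (v : 'cV[R[i]]_k) i : csq (v i 0) <= msq v.
Proof.
rewrite msqE (bigD1 i)//= lerDl; apply: sumr_ge0 => j _; exact: csq_ge0.
Qed.

Lemma measurable_msq F : (forall i, cmeasurable T (fun t => F t i 0)) ->
  measurable_fun T (fun t => msq (F t)).
Proof.
move=> mF; under eq_fun do rewrite msqE.
elim: (index_enum _) => [|i r ih].
  by under eq_fun do rewrite big_nil; exact: measurable_cst.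
under eq_fun do rewrite big_cons.
by apply: measurable_funD => //; exact: measurable_csq.
Qed.

Lemma integrable_msqP F : (forall i, cmeasurable T (fun t => F t i 0)) ->
  (\int[mu]_(t in T) (msq (F t))%:E < +oo)%E <->
  mu.-integrable T (EFin \o (fun t => msq (F t))).
Proof.
move=> mF; split=> [foo|/integrableP[_]].
  apply/integrableP; split; first by apply/measurable_EFinP; exact: measurable_msq.
  by under eq_integral do rewrite /= ger0_norm ?msq_ge0//.
by under eq_integral do rewrite /= ger0_norm ?msq_ge0//.
Qed.

Lemma L2P F : L2 F <-> forall i, sqi (fun t => F t i 0).
Proof.
split=> [[mF /(integrable_msqP mF) iF] i|sF].
  by apply: (sqi_dom _ iF) => [|t _]; [exact: mF|exact: csq_le_msq].
have mF i : cmeasurable T (fun t => F t i 0) by have [] := sF i.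
split=> //; apply/(integrable_msqP mF).
rewrite (_ : EFin \o _ = (fun t => (\sum_i (csq (F t i 0))%:E)%E)); last first.
  by apply/funext => t /=; rewrite sumEFin msqE.
by apply: integrable_sum => //; [exact: mT|move=> i _; have [] := sF i].
Qed.

Lemma L2_lin F G a : L2 F -> L2 G -> L2 (a *: F + G).
Proof.
move=> /L2P f2 /L2P g2; apply/L2P => i.
have := sqi_lin a (f2 i) (g2 i); congr sqi; apply/funext => t.
by rewrite !fctE !mxE.
Qed.

Lemma L2_0 : L2 (0 : V).
Proof. by apply/L2P => i; under eq_fun do rewrite mxE; exact: sqi0. Qed.

Lemma L2D F G : L2 F -> L2 G -> L2 (F + G).
Proof. by move=> f g; have := L2_lin 1 f g; rewrite scale1r. Qed.
Lemma L2Z F a : L2 F -> L2 (a *: F).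
Proof. by move=> f; have := L2_lin a f L2_0; rewrite addr0. Qed.
Lemma L2N F : L2 F -> L2 (- F).
Proof. by move=> f; rewrite -scaleN1r; exact: L2Z. Qed.
Lemma L2B F G : L2 F -> L2 G -> L2 (F - G).
Proof. by move=> f g; apply: L2D => //; exact: L2N. Qed.
Lemma L2_sum (I : Type) (r : seq I) (F : I -> V) :
  (forall i, L2 (F i)) -> L2 (\sum_(i <- r) F i).
Proof.
by move=> hF; elim/big_ind: _ => //; [exact: L2_0|exact: L2D].
Qed.

Lemma inner_integrable F G : L2 F -> L2 G ->
  cintegrable T (fun t => \sum_i F t i 0 * conjc (G t i 0)).
Proof.
move=> /L2P f2 /L2P g2; apply: cintegrable_sum => [|i]; first exact: mT.
by apply: cintegrable_sqiM => //; exact: sqi_conj.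
Qed.

Lemma innerE F G : L2 F -> L2 G ->
  inner F G = \sum_i cint (fun t => F t i 0 * conjc (G t i 0)).
Proof.
move=> /L2P f2 /L2P g2; apply: cint_sum => i.
by apply: cintegrable_sqiM => //; exact: sqi_conj.
Qed.

Lemma inner_linl F G H a : L2 F -> L2 G -> L2 H ->
  inner (a *: F + G) H = a * inner F H + inner G H.
Proof.
move=> f2 g2 h2; have i1 := inner_integrable f2 h2; have i2 := inner_integrable g2 h2.
rewrite /inner -cintZ// -cintD//; last by apply: cintegrableZ => //; exact: mT.
congr cint; apply/funext => t; rewrite mulr_sumr -big_split /=.
by apply: eq_bigr => i _; rewrite !fctE !mxE; ring.
Qed.

Lemma inner_conj F G : L2 F -> L2 G -> inner G F = conjc (inner F G).
Proof.
move=> f2 g2; rewrite /inner -cint_conj; last exact: inner_integrable.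
congr cint; apply/funext => t; rewrite conjc_sum; apply: eq_bigr => i _.
by rewrite conjcM conjcK mulrC.
Qed.

Lemma inner_linr F G H a : L2 F -> L2 G -> L2 H ->
  inner H (a *: F + G) = conjc a * inner H F + inner H G.
Proof.
move=> f2 g2 h2; rewrite (inner_conj (L2_lin a f2 g2) h2) inner_linl//.
by rewrite conjcD conjcM -!inner_conj.
Qed.

Lemma inner0l F : inner 0 F = 0.
Proof.
rewrite -cint0; congr cint; apply/funext => t.
by apply: big1 => i _; rewrite mxE mul0r.
Qed.
Lemma innerZl F G a : L2 F -> L2 G -> inner (a *: F) G = a * inner F G.
Proof.
by move=> f2 g2; have := inner_linl a f2 L2_0 g2; rewrite inner0l !addr0.
Qed.
Lemma innerDl F G H : L2 F -> L2 G -> L2 H ->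
  inner (F + G) H = inner F H + inner G H.
Proof.
by move=> f2 g2 h2; have := inner_linl 1 f2 g2 h2; rewrite scale1r mul1r.
Qed.
Lemma innerNl F G : L2 F -> L2 G -> inner (- F) G = - inner F G.
Proof. by move=> f2 g2; rewrite -scaleN1r innerZl// mulN1r. Qed.
Lemma innerBl F G H : L2 F -> L2 G -> L2 H ->
  inner (F - G) H = inner F H - inner G H.
Proof.
by move=> f2 g2 h2; rewrite innerDl// ?innerNl//; exact: L2N.
Qed.
Lemma inner0r F : inner F 0 = 0.
Proof.
rewrite -cint0; congr cint; apply/funext => t.
by apply: big1 => i _; rewrite mxE conjc0 mulr0.
Qed.
Lemma innerZr F G a : L2 F -> L2 G -> inner G (a *: F) = conjc a * inner G F.
Proof.
by move=> f2 g2; have := inner_linr a f2 L2_0 g2; rewrite inner0r !addr0.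
Qed.
Lemma innerDr F G H : L2 F -> L2 G -> L2 H ->
  inner H (F + G) = inner H F + inner H G.
Proof.
move=> f2 g2 h2; have := inner_linr 1 f2 g2 h2.
by rewrite scale1r conjc1 mul1r.
Qed.
Lemma innerNr F G : L2 F -> L2 G -> inner G (- F) = - inner G F.
Proof. by move=> f2 g2; rewrite -scaleN1r innerZr// conjcN conjc1 mulN1r. Qed.
Lemma innerBr F G H : L2 F -> L2 G -> L2 H ->
  inner H (F - G) = inner H F - inner H G.
Proof.
by move=> f2 g2 h2; rewrite innerDr// ?innerNr//; exact: L2N.
Qed.
Lemma inner_suml (I : Type) (r : seq I) (F : I -> V) G :
  (forall i, L2 (F i)) -> L2 G ->
  inner (\sum_(i <- r) F i) G = \sum_(i <- r) inner (F i) G.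
Proof.
move=> hF hG; elim: r => [|i r ih]; first by rewrite !big_nil inner0l.
by rewrite !big_cons innerDl// ?ih//; exact: L2_sum.
Qed.
Lemma inner_sumr (I : Type) (r : seq I) (F : I -> V) G :
  (forall i, L2 (F i)) -> L2 G ->
  inner G (\sum_(i <- r) F i) = \sum_(i <- r) inner G (F i).
Proof.
move=> hF hG; elim: r => [|i r ih]; first by rewrite !big_nil inner0r.
by rewrite !big_cons innerDr// ?ih//; exact: L2_sum.
Qed.

Lemma inner_self F : inner F F = Complex (L2norm2 F) 0.
Proof.
have e t : \sum_i F t i 0 * conjc (F t i 0) = Complex (msq (F t)) 0.
  apply: complex_eqP; rewrite ?cre_sum ?cim_sum.
    by rewrite msqE; apply: eq_bigr => i _; rewrite mul_conjE.
  by apply: big1 => i _; rewrite mul_conjE.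
rewrite /inner /cint /L2norm2; congr Complex.
  by congr (_ / _); apply: eq_Rintegral => t _; rewrite e.
rewrite (@eq_Rintegral _ _ _ _ _ (fun=> 0)) => [|t _]; last by rewrite e.
by rewrite /Rintegral integral0 mul0r.
Qed.

Lemma L2norm2E F : L2norm2 F = cre (inner F F).
Proof. by rewrite inner_self. Qed.

Lemma L2norm2_ge0 F : 0 <= L2norm2 F.
Proof.
apply: divr_ge0; last exact/ltW/twopi_gt0.
by apply: Rintegral_ge0 => t _; exact: msq_ge0.
Qed.

Lemma L2norm2D F G a : L2 F -> L2 G ->
  L2norm2 (F + a *: G) =
  L2norm2 F + 2 * cre (conjc a * inner F G) + csq a * L2norm2 G.
Proof.
move=> f2 g2; have ag := L2Z a g2; rewrite !L2norm2E.
rewrite innerDl ?innerDr ?innerZl ?innerZr//; [|exact: L2D..].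
rewrite (inner_conj f2 g2) !inner_self !creE !cimE /csq.
rewrite /cre /cim /=; ring.
Qed.

Lemma Cauchy_Schwarz F G : L2 F -> L2 G ->
  csq (inner F G) <= L2norm2 F * L2norm2 G.
Proof.
move=> f2 g2; set z := inner F G; set b := L2norm2 G.
(* This is the squared norm of F - s z G; the factor [z] makes the cross term the real number - 2 s
   |z|^2. *)
have q (s : R) : 0 <= L2norm2 F - 2 * s * csq z + s ^+ 2 * csq z * b.
  have := L2norm2_ge0 (F + (Complex (- s) 0 * z) *: G).
  rewrite L2norm2D// -/z -/b csqM csq_real conjcM -mulrA [conjc z * _]mulrC mul_conjE.
  rewrite !creE /cre /cim /=.
  by congr (0 <= _); ring.
have b0 : 0 <= b := L2norm2_ge0 G.
have [b_eq0|b_neq0] := eqVneq b 0; last first.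
  have := q b^-1.
  have -> : L2norm2 F - 2 * b^-1 * csq z + b^-1 ^+ 2 * csq z * b = L2norm2 F - csq z / b.
    by field.
  by rewrite subr_ge0 ler_pdivrMr// lt_neqAle eq_sym b_neq0.
rewrite b_eq0 mulr0 leNgt; apply/negP => z0.
(* For b = 0 the expression [q] is affine in s, and this s gives it the negative value - L2norm2 F -
   2. *)
have := q ((L2norm2 F + 1) / csq z); rewrite b_eq0 mulr0 addr0.
have -> : 2 * ((L2norm2 F + 1) / csq z) * csq z = 2 * (L2norm2 F + 1).
  by field; exact: lt0r_neq0.
have := L2norm2_ge0 F; lra.
Qed.

Lemma L2norm2N F : L2norm2 (- F) = L2norm2 F.
Proof.
congr (_ / _); apply: eq_Rintegral => t _; rewrite !msqE; apply: eq_bigr => i _.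
by rewrite !mxE csqN.
Qed.
Lemma L2norm2BC F G : L2norm2 (F - G) = L2norm2 (G - F).
Proof. by rewrite -L2norm2N opprB. Qed.

Lemma L2norm2_0 : L2norm2 (0 : V) = 0.
Proof. by rewrite L2norm2E inner0l. Qed.

Lemma L2norm2Z F a : L2 F -> L2norm2 (a *: F) = csq a * L2norm2 F.
Proof.
move=> f2; have := L2norm2D a L2_0 f2.
by rewrite add0r inner0l mulr0 L2norm2_0 cre0 mulr0 !add0r.
Qed.

Lemma parallelogram F G : L2 F -> L2 G ->
  L2norm2 (F + G) + L2norm2 (F - G) = 2 * (L2norm2 F + L2norm2 G).
Proof.
move=> f2 g2; have := L2norm2D 1 f2 g2; have := L2norm2D (-1) f2 g2.
rewrite scaleN1r scale1r conjc1 conjcN conjc1 csqN csq1 => -> ->.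
rewrite mulN1r !mul1r creN; ring.
Qed.

Lemma L2norm2D_le F G : L2 F -> L2 G ->
  L2norm2 (F + G) <= 2 * (L2norm2 F + L2norm2 G).
Proof. by move=> f2 g2; rewrite -parallelogram// lerDl L2norm2_ge0. Qed.

Lemma L2norm2_tri F G H : L2 F -> L2 G -> L2 H ->
  L2norm2 (F - H) <= 2 * (L2norm2 (F - G) + L2norm2 (G - H)).
Proof.
move=> f2 g2 h2; have -> : F - H = (F - G) + (G - H) by rewrite addrA subrK.
by apply: L2norm2D_le; exact: L2B.
Qed.

(** Replaces a passage to the limit in many vanishing proofs below. [K] may be zero or negative,
    hence the denominator built from its absolute value. *)
Lemma csq_small_eq0 (z : R[i]) (K : R) :
  (forall e, 0 < e -> csq z <= e * K) -> z = 0.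
Proof.
move=> h; apply/eqP; rewrite -csq_eq0 eq_le csq_ge0 andbT leNgt; apply/negP => z0.
have K0 : 0 < 2 * `|K| + 1 by have := normr_ge0 K; lra.
have e0 : 0 < csq z / (2 * `|K| + 1) by exact: divr_gt0.
have := h _ e0; rewrite mulrAC ler_pdivlMr// ler_pM2l//.
have := normr_ge0 K; have := ler_norm K; lra.
Qed.

Lemma inner_norm0 F G : L2 F -> L2 G -> L2norm2 F = 0 -> inner F G = 0.
Proof.
move=> f2 g2 F0; apply: (@csq_small_eq0 _ 0) => e _; rewrite mulr0.
by have := Cauchy_Schwarz f2 g2; rewrite F0 mul0r.
Qed.

Lemma inner_norm0B F G H : L2 F -> L2 G -> L2 H -> L2norm2 (F - G) = 0 ->
  inner F H = inner G H.
Proof.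
move=> f2 g2 h2 FG0; apply/eqP; rewrite -subr_eq0 -innerBl//.
by rewrite inner_norm0//; exact: L2B.
Qed.

Lemma inner_approx0 F G : L2 F -> L2 G ->
  (forall e, 0 < e -> exists F', [/\ L2 F', L2norm2 (F - F') < e & inner F' G = 0]) ->
  inner F G = 0.
Proof.
move=> f2 g2 h; apply: (@csq_small_eq0 _ (L2norm2 G)) => e e0.
have [F' [f'2 le_e F'0]] := h e e0.
have -> : inner F G = inner (F - F') G by rewrite innerBl// F'0 subr0.
apply: le_trans (Cauchy_Schwarz _ g2) _; first exact: L2B.
by rewrite ler_wpM2r ?L2norm2_ge0// ltW.
Qed.

Definition cvg2 (F_ : nat -> V) U :=
  forall e : R, 0 < e -> exists N, forall p, (N <= p)%N -> L2norm2 (F_ p - U) < e.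

Lemma integral_msq F : L2 F ->
  (\int[mu]_(t in T) (msq (F t))%:E = (2 * pi * L2norm2 F)%:E)%E.
Proof.
move=> [mF /(integrable_msqP mF) iF].
rewrite /L2norm2 mulrC divfK ?lt0r_neq0 ?twopi_gt0// /Rintegral fineK//.
by apply: integrable_fin_num => //; exact: mT.
Qed.

Lemma L2norm2_lt F (e : R) : (\int[mu]_(t in T) (msq (F t))%:E <= e%:E)%E ->
  L2norm2 F <= e / (2 * pi).
Proof.
move=> he; rewrite ler_pM2r ?invr_gt0 ?twopi_gt0// /Rintegral -lee_fin fineK//.
rewrite ge0_fin_numE; first by apply: le_lt_trans he _; rewrite ltry.
by apply: integral_ge0 => t _; rewrite lee_fin msq_ge0.
Qed.

Lemma L2_complete (F_ : nat -> V) : (forall p, L2 (F_ p)) ->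
  (forall e : R, 0 < e -> exists N, forall p q, (N <= p)%N -> (N <= q)%N ->
    L2norm2 (F_ p - F_ q) < e) ->
  exists2 U, L2 U & cvg2 F_ U.
Proof.
move=> l2 cauchy.
(* [J] indexes the 2k real coordinates; [Riesz_Fischer] is applied to each of them separately. *)
pose J := ('I_k * bool)%type; pose pr (b : bool) (z : R[i]) := if b then cre z else cim z.
have prB b x y : pr b (x - y) = pr b x - pr b y by case: b; rewrite /= !(creE, cimE).
have pr_le b x : pr b x ^+ 2 <= csq x by case: b; [exact: cre_sq_le|exact: cim_sq_le].
have mpr (F : V) : L2 F -> forall x : J, measurable_fun T (fun t => pr x.2 (F t x.1 0)).
  by move=> [mF _] [i []]; have [] := mF i.
have /choice[u_ uP] : forall x : J, exists u : R -> R, measurable_fun T u /\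
    forall e : R, 0 < e -> exists N, forall p, (N <= p)%N ->
    (\int[mu]_(t in T) ((pr x.2 (F_ p t x.1 0) - u t) ^+ 2)%:E <= e%:E)%E.
  move=> x; have [|e e0|u mu_ hu] :=
    @Riesz_Fischer _ _ _ mu _ mT (fun p t => pr x.2 (F_ p t x.1 0)).
  - by move=> p; exact: mpr.
  - have [N hN] := cauchy _ (divr_gt0 e0 twopi_gt0).
    exists N => p q Np Nq; have l2pq := L2B (l2 p) (l2 q).
    apply: (@le_lt_trans _ _ (\int[mu]_(t in T) (msq ((F_ p - F_ q) t))%:E)%E).
      apply: ge0_le_integral => //.
      - exact: mT.
      - by move=> t _; rewrite lee_fin sqr_ge0.
      - by apply: measurable_sqrB; exact: mpr.
      - by apply/measurable_EFinP; apply: measurable_msq; case: l2pq.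
      move=> t _; rewrite lee_fin; apply: le_trans (csq_le_msq _ x.1).
      by rewrite -prB !fctE !mxE pr_le.
    rewrite integral_msq// lte_fin mulrC.
    by have := hN p q Np Nq; rewrite ltr_pdivlMr ?twopi_gt0//.
  - by exists u.
pose U t : 'cV[R[i]]_k := \col_i Complex (u_ (i, true) t) (u_ (i, false) t).
have mFU p i : cmeasurable T (fun t => (F_ p - U) t i 0).
  under eq_fun do rewrite !fctE !mxE.
  apply: cmeasurableD; first by have [m _] := l2 p; exact: m.
  by apply: cmeasurableN; split; [exact: (uP (i, true)).1|exact: (uP (i, false)).1].
have FUE p : (\int[mu]_(t in T) (msq ((F_ p - U) t))%:E =
    \sum_(x : J) \int[mu]_(t in T) ((pr x.2 (F_ p t x.1 0) - u_ x t) ^+ 2)%:E)%E.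
  rewrite -ge0_integral_sum; last first.
  - by move=> x t _; rewrite lee_fin sqr_ge0.
  - by move=> x; apply: measurable_sqrB; [exact: mpr|have [] := uP x].
  - exact: mT.
  apply: eq_integral => t _; rewrite sumEFin msqE; congr EFin.
  transitivity (\sum_i \sum_b (pr b (F_ p t i 0) - u_ (i, b) t) ^+ 2).
    by apply: eq_bigr => i _; rewrite big_bool /csq !fctE !mxE !creE !cimE.
  by rewrite pair_bigA; apply: eq_bigr => -[i b] _.
pose c : R := #|{: J}|%:R; have c1 : 0 < c + 1 by rewrite ltr_wpDl.
have key (e : R) : 0 < e -> exists N, forall p, (N <= p)%N ->
    (\int[mu]_(t in T) (msq ((F_ p - U) t))%:E <= (c * e)%:E)%E.
  move=> e0; have [N hN] := choice (fun x => (uP x).2 e e0).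
  exists (\sum_x N x)%N => p Np; rewrite FUE.
  apply: (@le_trans _ _ (\sum_(x : J) e%:E)%E); last first.
    by rewrite sumEFin sumr_const -[_ *+ _]mulr_natl.
  apply: lee_sum => x _; apply: hN; apply: leq_trans Np.
  by rewrite (bigD1 x)//= leq_addr.
exists U => [|e e0].
  have [N hN] := key 1 ltr01.
  have : L2 (F_ N - U) by split; [exact: mFU|apply: le_lt_trans (hN N (leqnn N)) _; rewrite ltry].
  by move=> /(L2B (l2 N)); rewrite opprB addrC subrK.
have [N hN] := key _ (divr_gt0 (mulr_gt0 e0 twopi_gt0) c1); exists N => p Np.
apply: le_lt_trans (L2norm2_lt (hN p Np)) _; have e2 := mulr_gt0 e0 (@twopi_gt0 R).
by rewrite ltr_pdivrMr ?twopi_gt0// mulrA ltr_pdivrMr// mulrC ltr_pM2l// ltrDl.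
Qed.

Lemma inner_cvg0 (F_ : nat -> V) U G : (forall p, L2 (F_ p)) -> L2 U -> L2 G ->
  cvg2 F_ U -> (forall p, inner (F_ p) G = 0) -> inner U G = 0.
Proof.
move=> f2 u2 g2 cv h; apply: inner_approx0 => // e e0.
have [N hN] := cv e e0; exists (F_ N); split=> //.
by rewrite L2norm2BC; exact: hN.
Qed.

(** [S] is a subspace that need not be closed, so the projection [U] is only a limit of elements of
    [S]. The minimizing sequence is returned too: it lets each application show that [U] inherits
    the closed conditions satisfied on [S]. *)
Lemma orthogonal_projection (S : V -> Prop) F :
  (forall s, S s -> L2 s) -> S 0 ->
  (forall a s s', S s -> S s' -> S (a *: s + s')) -> L2 F ->
  exists s_ : nat -> V, exists U, [/\ (forall p, S (s_ p)), L2 U, cvg2 s_ U &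
    forall s, S s -> inner (F - U) s = 0].
Proof.
move=> S2 S0 Slin f2.
pose A := [set x : R | exists2 s, S s & x = L2norm2 (F - s)].
have A0 : has_inf A.
  split; first by exists (L2norm2 (F - 0)); exists 0.
  by exists 0 => x [s _ ->]; exact: L2norm2_ge0.
pose d := inf A.
have dle s : S s -> d <= L2norm2 (F - s).
  by move=> Ss; apply: ge_inf; [exact: A0.2|exists s].
have ex p : exists s, S s /\ L2norm2 (F - s) < d + p.+1%:R^-1.
  have p0 : 0 < p.+1%:R^-1 :> R by rewrite invr_gt0.
  by have [x [s Ss ->] lt] := inf_adherent p0 A0; exists s.
have [s_ s_P] := choice ex.
have Ss p : S (s_ p) := (s_P p).1.
have s_lt p : L2norm2 (F - s_ p) < d + p.+1%:R^-1 := (s_P p).2.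
have s2 p : L2 (s_ p) := S2 _ (Ss p).
have inv_lt (e : R) : 0 < e -> exists N : nat, forall p, (N <= p)%N -> p.+1%:R^-1 < e.
  move=> e0; exists (Num.bound e^-1) => p Np.
  rewrite -[e]invrK ltf_pV2 ?posrE ?invr_gt0//.
  apply: lt_le_trans (archi_boundP _) _; first by rewrite invr_ge0 ltW.
  by rewrite ler_nat (leq_trans Np).
have cauchy (e : R) : 0 < e -> exists N, forall p q, (N <= p)%N -> (N <= q)%N ->
    L2norm2 (s_ p - s_ q) < e.
  move=> e0; have e4 : 0 < e / 4 by rewrite divr_gt0.
  have [N hN] := inv_lt _ e4.
  exists N => p q Np Nq.
  (* The midpoint of s_p and s_q is in [S], so the sum F - s_p + F - s_q has squared norm at least 4
     d; the parallelogram law leaves little room for s_p - s_q. *)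
  have := parallelogram (L2B f2 (s2 p)) (L2B f2 (s2 q)).
  have -> : F - s_ p - (F - s_ q) = s_ q - s_ p by rewrite opprB addrC addrA subrK.
  have -> : F - s_ p + (F - s_ q) = 2 *: (F - 2^-1 *: (s_ p + s_ q)).
    rewrite scalerBr scalerA divff ?scale1r ?pnatr_eq0// scaler_nat mulr2n.
    by rewrite opprD !addrA [F - s_ p + F]addrAC.
  have Sm : S (2^-1 *: (s_ p + s_ q)).
    have := Slin 2^-1 _ _ (Slin 1 _ _ (Ss p) (Ss q)) S0.
    by rewrite scale1r addr0.
  rewrite L2norm2Z; last by apply: L2B => //; exact: S2.
  have -> : csq (2 : R[i]) = 4 by rewrite (natrD _ 1 1) /csq /cre /cim /=; ring.
  rewrite (L2norm2BC (s_ p)).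
  have := dle _ Sm; have := s_lt p; have := (s_P q).2.
  have := hN p Np; have := hN q Nq.
  set a := L2norm2 (F - s_ p); set b := L2norm2 (F - s_ q).
  set x := L2norm2 (F - _ *: _); set y := L2norm2 (s_ q - s_ p).
  move: (p.+1%:R^-1) (q.+1%:R^-1) => u v; clearbody a b x y; clearbody d. lra.
have [U U2 cvU] := L2_complete s2 cauchy.
exists s_, U; split=> // s Sms.
have s2' := S2 _ Sms.
(* Near-minimality tested in the direction z s, with step eps = 1 / (|s|^2 + 1): it gives 2 eps
   |z|^2 - eps^2 |z|^2 |s|^2 < 1 / (p + 1), and eps |s|^2 <= 1. *)
have ip p : (L2norm2 s + 1)^-1 * csq (inner (F - s_ p) s) <= p.+1%:R^-1.
  set z := inner _ _; set b := L2norm2 s.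
  have b0 : 0 <= b := L2norm2_ge0 s.
  have b1 : b + 1 != 0 by rewrite lt0r_neq0// ltr_wpDl.
  pose eps := (b + 1)^-1; have eps0 : 0 < eps by rewrite invr_gt0 ltr_wpDl.
  have epsb : eps * b <= 1 by rewrite /eps mulrC ler_pdivrMr ?ltr_wpDl// mul1r lerDl.
  have Sx : S ((Complex eps 0 * z) *: s + s_ p) by exact: Slin.
  have := dle _ Sx; rewrite opprD addrA addrAC.
  rewrite -scaleNr L2norm2D//; last exact: L2B.
  have e1 : conjc (- (Complex eps 0 * z)) * z = Complex (- (eps * csq z)) 0.
    by move: z {Sx} => [x y]; apply: complex_eqP; rewrite /csq /cre /cim /=; ring.
  rewrite -/z -/b csqN csqM csq_real e1 /cre /=.
  have := s_lt p; have : 0 <= eps * csq z by rewrite mulr_ge0 ?csq_ge0// ltW.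
  set q := csq z; set x := L2norm2 (F - s_ p); move: (p.+1%:R^-1) => u.
  rewrite -/eps; move: epsb; clearbody eps d x b q => h0 h1 h2 h3.
  have : (eps * q) * (eps * b) <= eps * q by rewrite ler_piMr.
  nra.
apply: (@csq_small_eq0 _ (4 * (L2norm2 s + 1))) => e e0.
have [N1 hN1] := cvU e e0; have [N2 hN2] := inv_lt e e0.
pose p := (N1 + N2)%N.
have -> : inner (F - U) s = inner (F - s_ p) s + inner (s_ p - U) s.
  by rewrite -innerDl ?addrA ?subrK//; exact: L2B.
apply: le_trans (csqD_le _ _) _.
have := ip p; have := hN1 p (leq_addr _ _); have := hN2 p (leq_addl _ _).
have := Cauchy_Schwarz (L2B (s2 p) U2) s2'; have b0 := L2norm2_ge0 s.
rewrite [_^-1 * _]mulrC ler_pdivrMr ?ltr_wpDl//.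
set x := csq _; set y := csq _; set w := L2norm2 _; set b := L2norm2 s.
move: (p.+1%:R^-1) => u; move: b0; rewrite -/b; clearbody x y w b; nra.
Qed.

End L2Space.

Section DominatedConvergence.
Context {R : realType}.
Local Notation mu := (@lebesgue_measure R).
Variables (D : set R) (mD : measurable D).

Lemma Rintegral_dct (f_ : nat -> R -> R) (f h : R -> R) (N : set R) :
  measurable N -> mu N = 0%E ->
  (forall p, measurable_fun D (f_ p)) -> measurable_fun D f ->
  mu.-integrable D (EFin \o h) ->
  (forall t, D t -> ~ N t -> f_ ^~ t @ \oo --> f t) ->
  (forall p t, D t -> ~ N t -> `|f_ p t| <= h t) ->
  (fun p => Rintegral mu D (f_ p)) @ \oo --> Rintegral mu D f.
Proof.
move=> mN N0 mf_ mf ih cv dom.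
have [|||||intf _ cvI] := @dominated_convergence _ _ _ mu D mD (fun p => EFin \o f_ p)
  (EFin \o f) (EFin \o h).
- by move=> p; apply/measurable_EFinP; exact: mf_.
- by apply/measurable_EFinP; exact: mf.
- exists N; split=> // t /= /not_implyP[Dt ncv]; apply: contrapT => Nt.
  by apply: ncv; apply: cvg_EFin; [exact: nearW|exact: cv].
- exact: ih.
- exists N; split=> // t /= nh; apply: contrapT => Nt.
  by apply: nh => p Dt; rewrite lee_fin; exact: dom.
rewrite /Rintegral; apply: fine_cvg.
rewrite fineK//; exact: integrable_fin_num.
Qed.

Lemma cintegral_dct (f_ : nat -> R -> R[i]) (f : R -> R[i]) (h : R -> R) (N : set R) :
  measurable N -> mu N = 0%E ->
  (forall p, cmeasurable D (f_ p)) -> cmeasurable D f ->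
  mu.-integrable D (EFin \o h) ->
  (forall t, D t -> ~ N t -> ccvg \oo (f_ ^~ t) (f t)) ->
  (forall p t, D t -> ~ N t -> `|cre (f_ p t)| <= h t /\ `|cim (f_ p t)| <= h t) ->
  ccvg \oo (fun p => cintegral D (f_ p)) (cintegral D f).
Proof.
move=> mN N0 mf_ [m1 m2] ih cv dom; split.
  apply: (Rintegral_dct mN N0 (fun p => (mf_ p).1) m1 ih) => [t Dt Nt|p t Dt Nt].
    by have [] := cv t Dt Nt.
  by have [] := dom p t Dt Nt.
apply: (Rintegral_dct mN N0 (fun p => (mf_ p).2) m2 ih) => [t Dt Nt|p t Dt Nt].
  by have [] := cv t Dt Nt.
by have [] := dom p t Dt Nt.
Qed.

End DominatedConvergence.

(** * Fourier coefficients *)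

Section PolynomialStep.
Context {R : realType}.

Lemma Bernoulli_ineq (x : R) n : -1 <= x -> 1 + n%:R * x <= (1 + x) ^+ n.
Proof.
move=> x1; elim: n => [|n ih]; first by rewrite mul0r addr0 expr0.
rewrite exprS; have x0 : 0 <= 1 + x by lra.
have := ler_wpM2l x0 ih; rewrite -natr1.
have : 0 <= n%:R * x ^+ 2 by rewrite mulr_ge0 ?sqr_ge0.
nra.
Qed.

(** With w the square root of z, Bernoulli's inequality for 1/w bounds n w^n by w / (1 - w); the
    second factor w^n of n z^n then tends to 0. *)
Lemma cvg_natmul_expr (z : R) : 0 <= z -> z < 1 ->
  (fun n => n%:R * z ^+ n) @ \oo --> (0 : R).
Proof.
move=> z0 z1; have [->|zn0] := eqVneq z 0.
  rewrite (_ : (fun n => _) = fun=> 0); first exact: cvg_cst.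
  by apply/funext => -[|n]; rewrite ?mul0r// expr0n mulr0.
have zgt0 : 0 < z by rewrite lt_neqAle eq_sym zn0.
set w := Num.sqrt z; have w0 : 0 < w by rewrite sqrtr_gt0.
have w1 : w < 1 by rewrite -[ltRHS]sqrtr1 ltr_sqrt.
have bd n : n%:R * w ^+ n <= w / (1 - w).
  have : 1 + n%:R * (w^-1 - 1) <= (1 + (w^-1 - 1)) ^+ n.
    by apply: Bernoulli_ineq; have : 0 <= w^-1 by [rewrite invr_ge0 ltW]; lra.
  rewrite addrCA subrr addr0 exprVn => h.
  have wn : 0 < w ^+ n by rewrite exprn_gt0.
  have : (1 + n%:R * (w^-1 - 1)) * w ^+ n <= 1.
    by apply: le_trans (ler_wpM2r (ltW wn) h) _; rewrite mulVf ?lt0r_neq0.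
  rewrite ler_pdivlMr ?subr_gt0// => h2.
  have e : n%:R * w ^+ n * (1 - w) = w * (n%:R * (w^-1 - 1) * w ^+ n).
    by field; exact: lt0r_neq0.
  by rewrite e ger_pMr//; move: h2; rewrite mulrDl mul1r; lra.
apply: (@squeeze_cvgr _ _ _ _ (fun=> 0) (geometric (w / (1 - w)) w)).
- near=> n; rewrite mulr_ge0 ?exprn_ge0//= -[z]sqr_sqrtr// -/w exprAC expr2.
  by rewrite mulrA ler_wpM2r ?exprn_ge0// ltW.
- exact: cvg_cst.
- by apply: cvg_geometric; rewrite gtr0_norm.
Unshelve. all: by end_near. Qed.

(* The exponent makes n 2^n y^n = n (2 y)^n tend to 0 or to +oo. *)
Lemma cvg_polystep (y : R) : 0 <= y <= 1 ->
  (fun n => (1 - y ^+ n) ^+ (n * 2 ^ n)) @ \oo --> (if y < 1 / 2 then 1 else 0 : R).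
Proof.
move=> /andP[y0 y1].
have yn n : 0 <= y ^+ n <= 1 by rewrite exprn_ge0// exprn_ile1.
have nE n : (n * 2 ^ n)%:R * y ^+ n = n%:R * (2 * y) ^+ n.
  by rewrite natrM natrX exprMn mulrA.
case: ltP => y2.
  apply: (@squeeze_cvgr _ _ _ _ (fun n => 1 - n%:R * (2 * y) ^+ n) (fun=> 1)).
  - near=> n; have /andP[a b] := yn n; rewrite exprn_ile1; [|lra..].
    rewrite andbT -nE -mulrN; apply: Bernoulli_ineq; lra.
  - rewrite -[X in _ --> X]subr0; apply: cvgB; first exact: cvg_cst.
    by apply: cvg_natmul_expr; [rewrite mulr_ge0|lra].
  - exact: cvg_cst.
apply: (@squeeze_cvgr _ _ _ _ (fun=> 0) (@harmonic R)).
- near=> n; have /andP[a b] := yn n; rewrite exprn_ge0/= ?subr_ge0//.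
  set M := (n * 2 ^ n)%N.
  (* For y >= 1/2 one has n 2^n y^n >= n, so Bernoulli makes (1 + y^n)^M at least n + 1; and (1 -
     y^n)^M is at most its inverse, because (1 - x)(1 + x) <= 1. *)
  have n1 : n.+1%:R <= (1 + y ^+ n) ^+ M.
    apply: le_trans (Bernoulli_ineq _ _); last lra.
    rewrite nE -natr1 addrC lerD2l ler_peMr//.
    by apply: exprn_ege1; lra.
  have q0 : (0 : R) < (1 + y ^+ n) ^+ M by rewrite exprn_gt0//; lra.
  rewrite /harmonic/=; apply: (@le_trans _ _ ((1 + y ^+ n) ^+ M)^-1).
    rewrite -[leRHS]mul1r ler_pdivlMr// -exprMn exprn_ile1//; nra.
  by rewrite lef_pV2 ?posrE.
- exact: cvg_cst.
- exact: cvg_harmonic.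
Unshelve. all: by end_near. Qed.

End PolynomialStep.

Section TrigonometricPolynomials.
Context {R : realType}.
Local Notation mu := (@lebesgue_measure R).
Local Notation T := (@Tset R).
Local Notation mT := (@measurable_Tset R).

Lemma cmeasurable_cexpi (D : set R) a : cmeasurable D (fun t => cexpi (a * t)).
Proof.
split; apply: measurable_funTS; apply: continuous_measurable_fun => x;
  apply: continuous_comp.
- by apply: cvgM; [exact: cvg_cst|exact: cvg_id].
- exact: continuous_cos.
- by apply: cvgM; [exact: cvg_cst|exact: cvg_id].
- exact: continuous_sin.
Qed.

Lemma cintegrable_mulb (f b : R -> R[i]) (K : R) : cintegrable T f -> cmeasurable T b ->
  (forall t, T t -> csq (b t) <= K) -> cintegrable T (fun t => f t * b t).
Proof.
move=> fi mb bK; have [f1 f2] := fi.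
have n1 := integrable_norm f1; have n2 := integrable_norm f2.
apply: (@cintegrable_dom _ _ mT _ (fun t => (K + 1) * `|cre (f t)| + (K + 1) * `|cim (f t)|)).
- by apply: cmeasurableM => //; exact: cintegrable_meas.
- exact: (integrable_sublin mT (K + 1) (K + 1) n1 n2).
have key (u v a c k : R) : `|a| <= k -> `|c| <= k ->
    `|u * a + v * c| <= k * `|u| + k * `|v|.
  move=> ak ck; apply: le_trans (ler_normD _ _) _; rewrite !normrM.
  by apply: lerD; rewrite mulrC ler_wpM2r.
move=> t Tt; have [b1 b2] := csq_le_normre (bK t Tt).
split; first by rewrite creM -mulrN; apply: key => //; rewrite normrN.
by rewrite cimM; exact: key.
Qed.

Inductive trigpoly : (R -> R[i]) -> Prop :=
| trigpoly_exp c (m : int) : trigpoly (fun t => c * cexpi (m%:~R * t))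
| trigpolyD p q : trigpoly p -> trigpoly q -> trigpoly (fun t => p t + q t).

Lemma trigpolyM p q : trigpoly p -> trigpoly q -> trigpoly (fun t => p t * q t).
Proof.
elim=> [c m|p1 p2 _ ih1 _ ih2] tq.
  elim: tq => [d l|q1 q2 _ ih1 _ ih2].
    have := trigpoly_exp (c * d) (m + l); congr trigpoly; apply/funext => t.
    by rewrite intrD mulrDl cexpiD; ring.
  have := trigpolyD ih1 ih2; congr trigpoly; apply/funext => t; ring.
have := trigpolyD (ih1 tq) (ih2 tq); congr trigpoly; apply/funext => t; ring.
Qed.

Lemma trigpoly_cst c : trigpoly (fun=> c).
Proof.
have := trigpoly_exp c 0; congr trigpoly; apply/funext => t.
by rewrite mul0r cexpi0 mulr1.
Qed.

Lemma trigpolyX p n : trigpoly p -> trigpoly (fun t => p t ^+ n).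
Proof.
move=> tp; elim: n => [|n ih]; first exact: trigpoly_cst.
by under eq_fun do rewrite exprS; exact: trigpolyM.
Qed.

Lemma trigpoly_cos t0 : trigpoly (fun t => Complex (cos (t - t0)) 0).
Proof.
have := trigpolyD (trigpoly_exp (Complex 2^-1 0 * cexpi (- t0)) 1)
  (trigpoly_exp (Complex 2^-1 0 * cexpi t0) (-1)).
congr trigpoly; apply/funext => t; rewrite -!mulrA -!cexpiD intrN mul1r mulN1r.
rewrite [in RHS](_ : t - t0 = - t0 + t); last by rewrite addrC.
rewrite (_ : t0 - t = - (- t0 + t)); last by rewrite opprD opprK.
by apply: complex_eqP; rewrite !(creE, cimE) /cexpi /cre /cim /= cosN sinN; field.
Qed.

Lemma trigpoly_bounded p : trigpoly p ->
  (forall D, cmeasurable D p) /\ exists K, forall t, csq (p t) <= K.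
Proof.
elim=> [c m|p1 p2 _ [m1 [K1 h1]] _ [m2 [K2 h2]]].
  split=> [D|].
    by apply: cmeasurableM; [exact: cmeasurable_cst|exact: cmeasurable_cexpi].
  by exists (csq c) => t; rewrite csqM csq_cexpi mulr1.
split=> [D|]; first exact: cmeasurableD.
exists (2 * (K1 + K2)) => t; apply: le_trans (csqD_le _ _) _.
by rewrite ler_pM2l// lerD.
Qed.

Variable f : R -> R[i].
Hypothesis fi : cintegrable T f.
Hypothesis f0 : forall m : int, cint (fun t => f t * cexpi (- (m%:~R) * t)) = 0.

Lemma trigpoly_orth p : trigpoly p -> cintegral T (fun t => f t * p t) = 0.
Proof.
have ifp q : trigpoly q -> cintegrable T (fun t => f t * q t).
  move=> /trigpoly_bounded[mq [K hK]].
  by apply: (cintegrable_mulb (K := K)) => // t _; exact: hK.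
elim=> [c m|p1 p2 t1 ih1 t2 ih2]; last first.
  rewrite -[RHS]addr0 -{1}ih1 -ih2 -cintegralD; [|exact: mT|exact: ifp..].
  by apply: eq_cintegral => t _; rewrite mulrDr.
have := f0 (- m); rewrite cintE => /eqP; rewrite mulf_eq0 -csq_eq0 csq_real.
rewrite sqrf_eq0 invr_eq0 (negbTE (lt0r_neq0 twopi_gt0))/= => /eqP fm.
rewrite -[RHS](mulr0 c) -fm -cintegralZ; [|exact: mT|]; last first.
  have := ifp _ (trigpoly_exp 1 m); congr cintegrable; apply/funext => t.
  by rewrite mul1r intrN opprK.
by apply: eq_cintegral => t _; rewrite intrN opprK; ring.
Qed.

(* On [0, 2 pi] the arc ]0, x[ is {t | cos (t - x / 2) > cos (x / 2)}. *)
Lemma cos_arc (x t : R) : 0 < x < 2 * pi -> T t ->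
  (cos (x / 2) < cos (t - x / 2)) = (0 < t < x).
Proof.
move=> /andP[x0 x2]; rewrite /Tset /= in_itv/= => /andP[t0 t2].
have p0 := @pi_gt0 R.
have cosI (a b : R) : 0 <= a <= pi -> 0 <= b <= pi -> (cos a < cos b) = (b < a).
  by move=> ha hb; apply: ltr_cos; rewrite in_itv.
rewrite -(cos_norm (t - x / 2)).
have [le_pi|gt_pi] := leP `|t - x / 2| pi.
  rewrite cosI ?normr_ge0//; last by apply/andP; split; lra.
  by rewrite ltr_norml; apply/idP/idP => /andP[a b]; apply/andP; split; lra.
have tx : x / 2 <= t.
  rewrite leNgt; apply/negP => tx; move: gt_pi.
  by rewrite ltr0_norm ?subr_lt0//; lra.
move: gt_pi; rewrite ger0_norm ?subr_ge0// => gt_pi.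
(* Here t - x/2 exceeds pi; reflection brings the angle back to [0, pi], where the cosine is
   decreasing. *)
have -> : cos (t - x / 2) = cos (2 * pi - (t - x / 2)).
  by rewrite -[LHS]cosN -[LHS]cosD2pi; congr cos; ring.
rewrite cosI; [|by apply/andP; split; lra..].
by apply/idP/idP => [|/andP[a b]]; lra.
Qed.

Lemma arc_integral0 (x : R) : 0 < x < 2 * pi ->
  cintegral T (fun t => f t * Complex (if 0 < t < x then 1 else 0) 0) = 0.
Proof.
move=> x2.
(* [y t < 1/2] exactly on the arc. A difference of cosines lies in [-2, 2], so division by 4 keeps
   [y] in [0, 1], as [cvg_polystep] requires. *)
pose y t : R := 1 / 2 - (cos (t - x / 2) - cos (x / 2)) / 4.
have y01 t : 0 <= y t <= 1.
  rewrite /y; have := cos_geN1 (t - x / 2); have := cos_le1 (t - x / 2).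
  have := cos_geN1 (x / 2); have := cos_le1 (x / 2).
  by move=> *; apply/andP; split; lra.
pose p_ n t : R[i] := Complex ((1 - y t ^+ n) ^+ (n * 2 ^ n)) 0.
have tp n : trigpoly (p_ n).
  have ty : trigpoly (fun t => Complex (y t) 0).
    have := trigpolyD (trigpoly_cst (Complex (1 / 2 + cos (x / 2) / 4) 0))
      (trigpolyM (trigpoly_cst (Complex (- 4^-1) 0)) (trigpoly_cos (x / 2))).
    by congr trigpoly; apply/funext => t; apply: complex_eqP;
      rewrite !(creE, cimE) /y /cre /cim /=; field.
  have := trigpolyX (n * 2 ^ n) (trigpolyD (trigpoly_cst 1)
    (trigpolyM (trigpoly_cst (-1)) (trigpolyX n ty))).
  congr trigpoly; apply/funext => t.
  rewrite /p_ mulN1r -![(_ +i* 0)%C]/(real_complex R _).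
  by rewrite !(rmorphXn, rmorphB, rmorph1).
have p_le n t : 0 <= (1 - y t ^+ n) ^+ (n * 2 ^ n) <= 1.
  have /andP[a b] := y01 t; have h1 := exprn_ge0 n a; have h2 := exprn_ile1 n a b.
  by rewrite exprn_ge0 ?exprn_ile1 ?subr_ge0// lerBlDr lerDl.
have pcv t : T t -> (fun n => (1 - y t ^+ n) ^+ (n * 2 ^ n)) @ \oo -->
    (if 0 < t < x then 1 else 0 : R).
  move=> Tt; have := cvg_polystep (y01 t).
  by rewrite -(cos_arc x2 Tt) (_ : (y t < 1 / 2) = (cos (x / 2) < cos (t - x / 2)))// /y;
    apply/idP/idP; lra.
have [f1 f2] := fi.
pose h t := 1 * `|cre (f t)| + 1 * `|cim (f t)|.
have ih : mu.-integrable T (EFin \o h).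
  exact: (integrable_sublin mT 1 1 (integrable_norm f1) (integrable_norm f2)).
have mfp n : cmeasurable T (fun t => f t * p_ n t).
  apply: cmeasurableM; first exact: cintegrable_meas.
  by have [m _] := trigpoly_bounded (tp n); exact: m.
have cp t : T t -> ccvg \oo (fun n => f t * p_ n t) (f t * Complex (if 0 < t < x then 1 else 0) 0).
  by move=> Tt; apply: ccvgM; [exact: ccvg_cst|apply: ccvg_real; exact: pcv].
apply: (@ccvg_unique R nat \oo _ (fun n => cintegral T (fun t => f t * p_ n t))); last first.
  by under eq_fun do rewrite trigpoly_orth//; exact: ccvg_cst.
apply: (@cintegral_dct R T mT _ _ h set0 measurable0 (measure0 _) mfp _ ih).
- exact: cmeasurable_cvg mfp cp.
- by move=> t Tt _; exact: cp.
move=> n t Tt _; have /andP[q0 q1] := p_le n t.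
have le1 (u v q : R) : 0 <= q -> q <= 1 -> `|u * q| <= 1 * `|u| + 1 * `|v|.
  move=> a b; rewrite normrM (ger0_norm a) !mul1r.
  have := normr_ge0 u; have := normr_ge0 v; nra.
rewrite creM cimM [cim (p_ n t)]/(0 : R) [cre (p_ n t)]/((1 - y t ^+ n) ^+ (n * 2 ^ n)).
rewrite !mulr0 subr0 add0r; split; rewrite /h; first exact: (le1 _ (cim (f t)) _ q0 q1).
by rewrite [leRHS]addrC; exact: (le1 _ (cre (f t)) _ q0 q1).
Qed.

(* The primitive of f vanishes, hence so does f at its Lebesgue points. *)
Lemma fourier_unique : exists N : set R, [/\ measurable N, mu N = 0%E &
  forall t, T t -> ~ N t -> f t = 0].
Proof.
have key (g : R -> R) : mu.-integrable T (EFin \o g) ->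
    (forall x, 0 < x < 2 * pi ->
       Rintegral mu T (fun t => g t * (if 0 < t < x then 1 else 0)) = 0) ->
    exists N : set R, [/\ measurable N, mu N = 0%E & forall t, T t -> ~ N t -> g t = 0].
  move=> ig g0.
  have locg : locally_integrable [set: R] (g \_ T).
    by apply: integrable_locally_restrict => //; exact: mT.
  have igT (y : R) : mu.-integrable `[0, y] (EFin \o (g \_ T)).
    apply: (@integrableS _ _ _ mu setT) => //.
    rewrite -restrict_EFin; apply/integrable_restrict => //; first exact: mT.
    by rewrite setTI.
  have [N [mN N0 hN]] := FTC1 igT locg.
  (* The primitive integrates over the closed interval [0, x], the arcs are open: the two integrands
     differ at most at 0 and x. *)
  have patch_arc x t : 0 < x < 2 * pi -> t <> 0 -> t <> x ->
      ((g \_ T) \_ `[0, x]) t = ((fun t => g t * (if 0 < t < x then 1 else 0)) \_ T) t.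
    move=> /andP[x0 x2] t0 tx; rewrite !patchE.
    have inT : (t \in T) = (0 <= t <= 2 * pi) by rewrite mem_setE in_itv.
    have inx : (t \in `[0, x]%classic) = (0 <= t <= x) by rewrite mem_setE in_itv.
    have -> : (0 < t < x) = (0 <= t <= x).
      rewrite !lt_neqAle eq_sym; move/eqP: t0 => ->; by move/eqP: tx => ->.
    rewrite inT inx; case: ifPn => [/andP[a b]|_]; last by rewrite mulr0 if_same.
    by rewrite mulr1.
  have gx0 x : 0 < x < 2 * pi -> (\int[mu]_(t in `[0%R, x]) (g \_ T) t)%R = 0.
    move=> x2; rewrite -[RHS](g0 x x2) Rintegral_mkcond [RHS]Rintegral_mkcond.
    apply: (@Rintegral_eq_off_null _ _ _ mu setT [set 0; x]).
    - by apply: measurableU; exact: measurable_set1.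
    - by rewrite measureU0 ?lebesgue_measure_set1//; exact: lebesgue_measure_set1.
    by move=> t _ /not_orP[t0 tx]; exact: patch_arc.
  exists (N `|` [set 0; 2 * pi]); split.
  - by apply: measurableU => //; apply: measurableU; exact: measurable_set1.
  - rewrite measureU0//; first by apply: measurableU; exact: measurable_set1.
    by rewrite measureU0 ?lebesgue_measure_set1//; exact: lebesgue_measure_set1.
  move=> t Tt /not_orP[Nt /not_orP[t0 t2]].
  have tin : 0 < t < 2 * pi.
    move: Tt; rewrite /Tset/= in_itv/= => /andP[a b].
    by rewrite !lt_neqAle a b !andbT eq_sym; apply/andP; split; apply/eqP.
  have [] : derivable (fun x : R => \int[mu]_(s in `[0%R, x]%classic) (g \_ T) s) t 1 /\
      derive1 (fun x : R => \int[mu]_(s in `[0%R, x]%classic) (g \_ T) s) t = (g \_ T) t.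
    apply: contrapT => h; apply: Nt; apply: hN => /= h2; apply: h; apply: h2.
    by rewrite lte_fin; case/andP: tin.
  move=> _; rewrite patchE mem_set// => <-.
  (* The primitive is identically 0 near the interior point t, so its derivative there is that of a
     constant. *)
  rewrite derive1E -[RHS](derive_cst (0 : R) t 1).
  apply: near_eq_derive; near=> x; rewrite gx0//.
  have : x \in `]0, (2 * pi)[ by near: x; apply: near_in_itvoo; rewrite in_itv.
  by rewrite in_itv.
have [f1 f2] := fi.
have [x x2|N1 [m1 z1 h1]] := key (fun t => cre (f t)) f1.
  transitivity (cre (cintegral T (fun t => f t * Complex (if 0 < t < x then 1 else 0) 0))).
    apply: eq_Rintegral => t _.
    by rewrite -/(cre (f t * _)) creM /cre /cim /= mulr0 subr0.
  by rewrite arc_integral0.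
have [x x2|N2 [m2 z2 h2]] := key (fun t => cim (f t)) f2.
  transitivity (cim (cintegral T (fun t => f t * Complex (if 0 < t < x then 1 else 0) 0))).
    apply: eq_Rintegral => t _.
    by rewrite -/(cim (f t * _)) cimM /cre /cim /= mulr0 add0r.
  by rewrite arc_integral0.
exists (N1 `|` N2); split; first exact: measurableU.
  by rewrite measureU0.
by move=> t Tt /not_orP[n1 n2]; apply: complex_eqP; [exact: h1|exact: h2].
Unshelve. all: by end_near. Qed.

End TrigonometricPolynomials.

Section FundamentalTheorem.
Context {R : realType}.
Local Notation mu := (@lebesgue_measure R).

Lemma Rintegral_FTC (F f : R -> R) (a b : R) : a <= b ->
  (forall t, is_derive t (1 : R) F (f t)) -> continuous f ->
  Rintegral mu `[a, b] f = F b - F a.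
Proof.
rewrite le_eqVlt => /predU1P[->|ab] dF cf.
  by rewrite subrr set_itv1 Rintegral_set1.
have cF : continuous F.
  by move=> t; apply: differentiable_continuous; apply/derivable1_diffP;
    exact: (@ex_derive _ _ _ _ _ _ _ (dF t)).
rewrite /Rintegral (@continuous_FTC2 _ f F) //.
- exact: continuous_subspaceT.
- split.
  + by move=> t _; exact: (@ex_derive _ _ _ _ _ _ _ (dF t)).
  + by apply: cvg_at_right_filter; exact: cF.
  + by apply: cvg_at_left_filter; exact: cF.
- by move=> t _; rewrite derive1E; exact: (@derive_val _ _ _ _ _ _ _ (dF t)).
Qed.

Lemma is_derive_mull (a t : R) : is_derive t (1 : R) (fun t : R => a * t) a.
Proof.
have := is_deriveZ a (is_derive_id t (1 : R)).
by rewrite (_ : a *: (1 : R) = a)//; exact: mulr1.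
Qed.

Lemma cexpiM_integral (c a b : R) : a <= b ->
  cintegral `[a, b] (fun t => Complex 0 c * cexpi (c * t)) = cexpi (c * b) - cexpi (c * a).
Proof.
move=> ab; have cM (h : R -> R) : continuous h -> continuous (fun t => h (c * t)).
  move=> ch x; apply: continuous_comp; last exact: ch.
  by apply: cvgM; [exact: cvg_cst|exact: cvg_id].
have sE t : - sin (c * t) * c = 0 * cos (c * t) - c * sin (c * t) by ring.
have cE t : cos (c * t) * c = 0 * sin (c * t) + c * cos (c * t) by ring.
apply: complex_eqP; rewrite /cintegral ?creD ?creN ?cimD ?cimN /cexpi /cre /cim /=.
  apply: (@Rintegral_FTC (fun t => cos (c * t))) => // t.
    by have := is_derive1_comp (is_derive_cos (c * t)) (is_derive_mull c t); rewrite sE.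
  under eq_fun do rewrite -sE.
  apply: cvgM; last exact: cvg_cst.
  by apply: cvgN; apply: (cM _ (@continuous_sin R)).
apply: (@Rintegral_FTC (fun t => sin (c * t))) => // t.
  by have := is_derive1_comp (is_derive_sin (c * t)) (is_derive_mull c t); rewrite cE.
under eq_fun do rewrite -cE.
by apply: cvgM; [apply: (cM _ (@continuous_cos R))|exact: cvg_cst].
Qed.

Lemma cexpi_integral (s t : R) : s <= t ->
  cintegral `[s, t] (fun x => Complex 0 1 * cexpi x) = cexpi t - cexpi s.
Proof.
move=> /(cexpiM_integral 1); rewrite !mul1r => <-.
by apply: eq_cintegral => x _; rewrite mul1r.
Qed.

Lemma cosD2pin (x : R) (n : nat) : cos (x + n%:R * (2 * pi)) = cos x.
Proof.
elim: n x => [|n ih] x; first by rewrite mul0r addr0.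
rewrite -[RHS]ih -[RHS]cosD2pi; congr cos; rewrite -natr1; ring.
Qed.
Lemma sinD2pin (x : R) (n : nat) : sin (x + n%:R * (2 * pi)) = sin x.
Proof.
elim: n x => [|n ih] x; first by rewrite mul0r addr0.
rewrite -[RHS]ih -[RHS]sinD2pi; congr sin; rewrite -natr1; ring.
Qed.

Lemma cint_cexpi (m : int) : cint (fun t : R => cexpi (m%:~R * t)) = (m == 0)%:R.
Proof.
have [->|m0] := eqVneq m 0.
  have -> : (fun t : R => cexpi (0%:~R * t)) = fun=> 1.
    by apply/funext => t; rewrite mul0r cexpi0.
  have p0 : 2 * pi != 0 :> R := lt0r_neq0 twopi_gt0.
  have fT : fine (mu (@Tset R)) = 2 * pi by rewrite lebesgue_Tset.
  apply: complex_eqP; rewrite /cint /cre /cim /= Rintegral_cst; try exact: measurable_Tset.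
    by rewrite fT mul1r divff.
  by rewrite !mul0r.
have m0' : Complex 0 (m%:~R) != 0 :> R[i].
  by rewrite -csq_eq0 /csq /cre /cim /= expr0n add0r sqrf_eq0 intr_eq0.
have per : cexpi (m%:~R * (2 * pi)) = 1 :> R[i].
  case: m {m0 m0'} => n; first by rewrite -[_ * _]add0r /cexpi cosD2pin sinD2pin -cexpi0.
  rewrite NegzE mulrNz mulNr cexpiN -[_ * _]add0r /cexpi cosD2pin sinD2pin.
  by rewrite -[Complex _ _]/(cexpi 0) cexpi0 conjc1.
apply: (mulfI m0'); rewrite mulr0 -cintZ; last first.
  apply: (@cintegrable_bounded _ _ measurable_Tset lebesgue_Tset_fin _ 1).
    exact: cmeasurable_cexpi.
  by move=> t _; rewrite csq_cexpi.
by rewrite cintE (cexpiM_integral _ (ltW twopi_gt0)) per mulr0 cexpi0 subrr mulr0.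
Qed.

End FundamentalTheorem.

(** * The Hardy space and analytic polynomials *)

Section FourierCoefficients.
Context {R : realType} (k : nat).
Local Notation mu := (@lebesgue_measure R).
Local Notation T := (@Tset R).
Local Notation mT := (@measurable_Tset R).
Local Notation V := (R -> 'cV[R[i]]_k).
Implicit Types (F G H : V) (a : R[i]).

Definition etrig (m : int) (i : 'I_k) : V :=
  fun t => cexpi (m%:~R * t) *: delta_mx i 0.

Lemma etrigE m i t j : etrig m i t j 0 = if j == i then cexpi (m%:~R * t) else 0.
Proof. by rewrite /etrig !mxE andbT; case: eqP => _; rewrite ?mulr1 ?mulr0. Qed.

Lemma L2_etrig m i : L2 (etrig m i).
Proof.
apply/L2P => j; under eq_fun do rewrite etrigE.
case: eqP => _; last exact: sqi0.
apply: (@sqi_bounded _ _ 1); first exact: cmeasurable_cexpi.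
by move=> t _; rewrite csq_cexpi.
Qed.

Lemma fourierE F m i : fourier F m i 0 = inner F (etrig m i).
Proof.
rewrite mxE /inner; congr cint; apply/funext => t.
rewrite (bigD1 i)//= etrigE eqxx big1 ?addr0 => [|j /negbTE ji].
  by rewrite -cexpiN mulNr.
by rewrite etrigE ji conjc0 mulr0.
Qed.

Lemma inner_etrig m l i j :
  inner (etrig m i) (etrig l j) = ((i == j) && (m == l))%:R.
Proof.
rewrite -fourierE mxE; under eq_fun do rewrite etrigE [j == i]eq_sym.
have [_|_] := eqVneq i j => /=; last first.
  under eq_fun do rewrite mul0r.
  exact: cint0.
rewrite -subr_eq0 -cint_cexpi; congr cint; apply/funext => t.
by rewrite intrB mulrBl cexpiD mulNr.
Qed.

Lemma fourier_eq0 F : L2 F -> (forall m, fourier F m = 0) ->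
  exists N : set R, [/\ measurable N, mu N = 0%E & forall t, T t -> ~ N t -> F t = 0].
Proof.
move=> /L2P F2 F0.
have ex i : exists N : set R, [/\ measurable N, mu N = 0%E &
    forall t, T t -> ~ N t -> F t i 0 = 0].
  apply: fourier_unique; first exact: cintegrable_sqi.
  by move=> m; have /matrixP/(_ i 0) := F0 m; rewrite !mxE.
have /choice[N NP] := ex.
have [mN N0] : measurable (\big[setU/set0]_i N i) /\ mu (\big[setU/set0]_i N i) = 0%E.
  elim/big_ind : _ => [|A B [mA A0] [mB B0]|i _].
  - by split; [exact: measurable0|exact: measure0].
  - by split; [exact: measurableU|rewrite measureU0].
  - by have [m0 z0 _] := NP i.
exists (\big[setU/set0]_i N i); split=> // t Tt Nt.
apply/matrixP => i j; rewrite (ord1 j) mxE; have [_ _] := NP i; apply=> // Nit.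
by apply: Nt; rewrite -bigcup_seq; exists i => //=; rewrite mem_index_enum.
Qed.

Lemma fourier_norm0 F : L2 F -> (forall m, fourier F m = 0) -> L2norm2 F = 0.
Proof.
move=> F2 F0; have [N [mN N0 h]] := fourier_eq0 F2 F0.
rewrite /L2norm2 (@Rintegral_eq_off_null _ _ _ mu T N _ (fun=> 0) mN N0).
  by rewrite /Rintegral integral0 mul0r.
move=> t Tt Nt; rewrite h// msqE big1// => i _.
by rewrite mxE csq0.
Qed.

Lemma H2P F : H2 F <-> L2 F /\ forall m i, (m < 0)%R -> inner F (etrig m i) = 0.
Proof.
split=> -[F2 F0]; split=> // m.
  by move=> i m0; rewrite -fourierE F0// mxE.
by move=> m0; apply/matrixP => i j; rewrite (ord1 j) fourierE F0// mxE.
Qed.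

Lemma H2_L2 F : H2 F -> L2 F. Proof. by case. Qed.

Lemma H2_lin F G a : H2 F -> H2 G -> H2 (a *: F + G).
Proof.
move=> /H2P[f2 f0] /H2P[g2 g0]; apply/H2P; split=> [|m i m0]; first exact: L2_lin.
by rewrite inner_linl ?f0 ?g0 ?mulr0 ?addr0//; exact: L2_etrig.
Qed.
Lemma H2_0 : H2 (0 : V).
Proof. by apply/H2P; split=> [|m i m0]; [exact: L2_0|rewrite inner0l]. Qed.
Lemma H2D F G : H2 F -> H2 G -> H2 (F + G).
Proof. by move=> f g; have := H2_lin 1 f g; rewrite scale1r. Qed.
Lemma H2Z F a : H2 F -> H2 (a *: F).
Proof. by move=> f; have := H2_lin a f H2_0; rewrite addr0. Qed.
Lemma H2N F : H2 F -> H2 (- F).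
Proof. by move=> f; rewrite -scaleN1r; exact: H2Z. Qed.
Lemma H2B F G : H2 F -> H2 G -> H2 (F - G).
Proof. by move=> f g; apply: H2D => //; exact: H2N. Qed.

Lemma H2_etrig (m : nat) i : H2 (etrig m i).
Proof.
apply/H2P; split=> [|l j l0]; first exact: L2_etrig.
rewrite inner_etrig; case: eqP => //= _; case: eqP => // ml.
by move: l0; rewrite -ml.
Qed.

Lemma H2_cvg (F_ : nat -> V) U : (forall p, H2 (F_ p)) -> L2 U -> cvg2 F_ U -> H2 U.
Proof.
move=> hF U2 cv; apply/H2P; split=> // m i m0.
apply: (inner_cvg0 _ _ _ cv) => //.
- by move=> p; exact: H2_L2.
- exact: L2_etrig.
- by move=> p; have /H2P[_] := hF p; exact.
Qed.

Inductive apoly : V -> Prop :=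
| apoly0 : apoly 0
| apolyS a (m : nat) i P : apoly P -> apoly (a *: etrig m i + P).

Lemma apoly_H2 P : apoly P -> H2 P.
Proof. by elim=> [|a m i Q _ ih]; [exact: H2_0|apply: H2_lin => //; exact: H2_etrig]. Qed.

Lemma apoly_lin a P Q : apoly P -> apoly Q -> apoly (a *: P + Q).
Proof.
move=> aP aQ; elim: aP => [|b m i P' _ ih]; first by rewrite scaler0 add0r.
by rewrite scalerDr scalerA -addrA; exact: apolyS.
Qed.

(** Project G onto the closure of the analytic polynomials. The difference G - U has no negative
    coefficients, being in H^2, and no others, being orthogonal to the polynomials; uniqueness of
    Fourier coefficients makes its norm 0. *)
Lemma H2_approx G (e : R) : H2 G -> 0 < e -> exists2 P, apoly P & L2norm2 (G - P) < e.
Proof.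
move=> hG e0; have G2 := H2_L2 hG.
have [||a P Q|s_ [U [sP U2 cv orth]]] := @orthogonal_projection R k apoly G _ _ _ G2.
- by move=> s /apoly_H2/H2_L2.
- exact: apoly0.
- exact: apoly_lin.
have s2 p : L2 (s_ p) by apply/H2_L2/apoly_H2.
have hU : H2 U by apply: (H2_cvg _ U2 cv) => p; exact: apoly_H2.
have GU0 : L2norm2 (G - U) = 0.
  apply: fourier_norm0 => [|m]; first exact: L2B.
  apply/matrixP => i j; rewrite (ord1 j) fourierE mxE.
  have [m0|m0] := ltP m 0; first by have /H2P[_] := H2B hG hU; exact.
  case: m m0 => // m _; apply: orth.
  by have := apolyS 1 m i apoly0; rewrite scale1r addr0.
have e2 : 0 < e / 2 by rewrite divr_gt0.
have [N hN] := cv _ e2; exists (s_ N) => //.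
apply: le_lt_trans (L2norm2_tri G2 U2 (s2 N)) _.
by rewrite GU0 add0r L2norm2BC; have := hN N (leqnn N); lra.
Qed.

Lemma H2_orth F G : L2 F -> (forall m : int, 0 <= m -> fourier F m = 0) -> H2 G ->
  inner G F = 0.
Proof.
move=> F2 F0 hG; apply: inner_approx0 => //; first exact: H2_L2.
move=> e e0; have [P aP le] := H2_approx hG e0.
exists P; split=> //; first by apply/H2_L2/apoly_H2.
elim: aP {le} => [|a m i Q aQ ih]; first by rewrite inner0l.
rewrite inner_linl ?ih ?addr0//; [|exact: L2_etrig|by apply/H2_L2/apoly_H2].
by rewrite (inner_conj F2) -?fourierE ?F0// ?mxE ?conjc0 ?mulr0//; exact: L2_etrig.
Qed.

End FourierCoefficients.

(** * The Cauchy integral formula *)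

Section Bisection.
Context {R : realType}.

Definition half_of (p q : R * R) :=
  q = (p.1, (p.1 + p.2) / 2) \/ q = ((p.1 + p.2) / 2, p.2).

Lemma nested_halves (p_ : nat -> R * R) : (p_ 0).1 <= (p_ 0).2 ->
  (forall n, half_of (p_ n) (p_ n.+1)) ->
  (forall n, (p_ n).2 - (p_ n).1 = ((p_ 0).2 - (p_ 0).1) / 2 ^+ n) /\
  exists x, forall n, (p_ n).1 <= x <= (p_ n).2.
Proof.
move=> p0 step.
have len n : (p_ n).2 - (p_ n).1 = ((p_ 0).2 - (p_ 0).1) / 2 ^+ n.
  elim: n => [|n ih]; first by rewrite expr0 divr1.
  rewrite exprS invfM mulrCA -ih.
  by case: (step n) => -> /=; field.
split=> //.
have le n : (p_ n).1 <= (p_ n).2.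
  by rewrite -subr_ge0 len divr_ge0 ?subr_ge0// exprn_ge0.
have mono n : (p_ n).1 <= (p_ n.+1).1 /\ (p_ n.+1).2 <= (p_ n).2.
  by have := le n; case: (step n) => -> /=; lra.
have nd m n : (m <= n)%N -> (p_ m).1 <= (p_ n).1.
  move=> /subnK <-; elim: (n - m)%N => //= j ih.
  by apply: le_trans ih _; have [] := mono (j + m)%N.
have ni m n : (m <= n)%N -> (p_ n).2 <= (p_ m).2.
  move=> /subnK <-; elim: (n - m)%N => //= j ih.
  by apply: le_trans _ ih; have [] := mono (j + m)%N.
have cross m n : (p_ m).1 <= (p_ n).2.
  have [mn|/ltnW nm] := leqP m n; first exact: le_trans (nd _ _ mn) (le n).
  exact: le_trans (le m) (ni _ _ nm).
pose A := [set (p_ n).1 | n in setT].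
have supA : has_sup A.
  by split; [exists (p_ 0).1; exists 0|exists (p_ 0).2 => _ [n _ <-]].
exists (sup A) => n; apply/andP; split.
  by apply: ub_le_sup; [exact: supA.2|exists n].
by apply: ge_sup; [exact: supA.1|move=> _ [m _ <-]].
Qed.

Variables (Phi : R * R -> R * R -> R[i]) (S T : R * R).
Hypotheses (S12 : S.1 <= S.2) (T12 : T.1 <= T.2).

Let sub (I J : R * R) := J.1 <= I.1 /\ I.1 <= I.2 /\ I.2 <= J.2.

Hypothesis addS : forall I J, sub I S -> sub J T ->
  Phi I J = Phi (I.1, (I.1 + I.2) / 2) J + Phi ((I.1 + I.2) / 2, I.2) J.
Hypothesis addT : forall I J, sub I S -> sub J T ->
  Phi I J = Phi I (J.1, (J.1 + J.2) / 2) + Phi I ((J.1 + J.2) / 2, J.2).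
(* csq is a squared modulus: this says that |Phi| is o(size^2). *)
Hypothesis local : forall x y, S.1 <= x <= S.2 -> T.1 <= y <= T.2 ->
  forall e : R, 0 < e -> exists2 d : R, 0 < d & forall I J, sub I S -> sub J T ->
    I.1 <= x <= I.2 -> J.1 <= y <= J.2 -> I.2 - I.1 < d -> J.2 - J.1 < d ->
    csq (Phi I J) <= e * ((I.2 - I.1) + (J.2 - J.1)) ^+ 4.

(** Among the four quarters of a rectangle one keeps at least 1/16 of the squared modulus. After n
    bisections the factor 16^n is absorbed by the fourth power of a size divided by 2^n, which
    leaves e L^4 with e arbitrary. *)
Lemma rectangle_function_eq0 : Phi S T = 0.
Proof.
(* The inclusions are premises inside the existential, so that [choice] returns a function defined
   on all pairs, ready to be iterated. *)
have quarter (IJ : (R * R) * (R * R)) : exists KL : (R * R) * (R * R),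
    sub IJ.1 S -> sub IJ.2 T ->
    [/\ half_of IJ.1 KL.1, half_of IJ.2 KL.2 &
        csq (Phi IJ.1 IJ.2) <= 16 * csq (Phi KL.1 KL.2)].
  case: IJ => I J /=; have [sI|?] := pselect (sub I S); last by exists (I, J).
  have [sJ|?] := pselect (sub J T); last by exists (I, J).
  pose I1 := (I.1, (I.1 + I.2) / 2); pose I2 := ((I.1 + I.2) / 2, I.2).
  pose J1 := (J.1, (J.1 + J.2) / 2); pose J2 := ((J.1 + J.2) / 2, J.2).
  have sI1 : sub I1 S by move: sI => [? [? ?]]; rewrite /sub /=; lra.
  have sI2 : sub I2 S by move: sI => [? [? ?]]; rewrite /sub /=; lra.
  have E : Phi I J = (Phi I1 J1 + Phi I1 J2) + (Phi I2 J1 + Phi I2 J2).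
    by rewrite (addS sI sJ) -/I1 -/I2 (addT sI1 sJ) (addT sI2 sJ).
  have le4 : csq (Phi I J) <= 4 * (csq (Phi I1 J1) + csq (Phi I1 J2) +
      (csq (Phi I2 J1) + csq (Phi I2 J2))).
    rewrite E; apply: le_trans (csqD_le _ _) _.
    have := csqD_le (Phi I1 J1) (Phi I1 J2); have := csqD_le (Phi I2 J1) (Phi I2 J2).
    by lra.
  have h1 : half_of I I1 by left.
  have h2 : half_of I I2 by right.
  have g1 : half_of J J1 by left.
  have g2 : half_of J J2 by right.
  have [l1|l1] := leP (csq (Phi I J)) (16 * csq (Phi I1 J1)); first by exists (I1, J1).
  have [l2|l2] := leP (csq (Phi I J)) (16 * csq (Phi I1 J2)); first by exists (I1, J2).
  have [l3|l3] := leP (csq (Phi I J)) (16 * csq (Phi I2 J1)); first by exists (I2, J1).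
  exists (I2, J2) => _ _; split=> //=.
  move: le4 l1 l2 l3; rewrite -/I2 -/J2.
  move: (csq (Phi I J)) (csq (Phi I1 J1)) (csq (Phi I1 J2)) (csq (Phi I2 J1))
    (csq (Phi I2 J2)) => *; lra.
have /choice[nxt nxtP] := quarter.
pose Q n := iter n nxt (S, T).
have sub_half I J K : sub I J -> half_of I K -> sub K J.
  by move=> [? [? ?]] [->|->]; rewrite /sub /=; lra.
have inv n : sub (Q n).1 S /\ sub (Q n).2 T.
  elim: n => [|n [iS iT]]; first by split; split=> //; split.
  have [hS hT _] := nxtP (Q n) iS iT.
  by split; [exact: sub_half iS hS|exact: sub_half iT hT].
have step n : [/\ half_of (Q n).1 (Q n.+1).1, half_of (Q n).2 (Q n.+1).2 &
    csq (Phi (Q n).1 (Q n).2) <= 16 * csq (Phi (Q n.+1).1 (Q n.+1).2)].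
  by have [iS iT] := inv n; exact: nxtP.
have grow n : csq (Phi S T) <= 16 ^+ n * csq (Phi (Q n).1 (Q n).2).
  elim: n => [|n ih]; first by rewrite expr0 mul1r.
  apply: le_trans ih _; rewrite exprSr -mulrA ler_wpM2l ?exprn_ge0//.
  by have [] := step n.
have [lenS [x xP]] := @nested_halves (fun n => (Q n).1) S12
  (fun n => let: And3 a _ _ := step n in a).
have [lenT [y yP]] := @nested_halves (fun n => (Q n).2) T12
  (fun n => let: And3 _ a _ := step n in a).
pose L := (S.2 - S.1) + (T.2 - T.1).
have s0 : 0 <= S.2 - S.1 by rewrite subr_ge0.
have t0 : 0 <= T.2 - T.1 by rewrite subr_ge0.
apply: (@csq_small_eq0 R _ (L ^+ 4)) => e e0.
have [d d0 hd] := local (xP 0%N) (yP 0%N) e0.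
have [n hn] : exists n : nat, L / 2 ^+ n < d.
  have := @cvg_geometric R L 2^-1.
  rewrite ger0_norm ?invr_ge0// invf_lt1 ?ltr1n// => /(_ isT) /cvgr0Pnorm_lt /(_ d d0)[n _ hn].
  exists n; apply: le_lt_trans (hn n _) => //=; rewrite exprVn.
  exact: ler_norm.
have [iS iT] := inv n.
have lS : (Q n).1.2 - (Q n).1.1 = (S.2 - S.1) / 2 ^+ n := lenS n.
have lT : (Q n).2.2 - (Q n).2.1 = (T.2 - T.1) / 2 ^+ n := lenT n.
have p0 : (0 : R) <= (2 ^+ n)^-1 by rewrite invr_ge0 exprn_ge0.
have := hd _ _ iS iT (xP n) (yP n).
rewrite lS lT -mulrDl -/L => h.
apply: le_trans (grow n) _.
have -> : e * L ^+ 4 = 16 ^+ n * (e * (L / 2 ^+ n) ^+ 4).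
  have -> : (16 : R) = 2 ^+ 4 by ring.
  by rewrite -exprM mulnC exprM expr_div_n; field; rewrite !expf_neq0.
rewrite ler_wpM2l ?exprn_ge0//; apply: h.
  by apply: le_lt_trans hn; rewrite ler_wpM2r// lerDl.
by apply: le_lt_trans hn; rewrite ler_wpM2r// lerDr.
Qed.

End Bisection.

Section ContinuousComplexFunctions.
Context {R : realType}.
Local Notation mu := (@lebesgue_measure R).
Implicit Types (h g : R -> R[i]) (a b : R).

Definition ccont h (x : R) := ccvg (nbhs x) h (h x).

Lemma ccont_cst c x : ccont (fun=> c) x.
Proof. exact: ccvg_cst. Qed.
Lemma ccontD h g x : ccont h x -> ccont g x -> ccont (fun t => h t + g t) x.
Proof. exact: ccvgD. Qed.
Lemma ccontM h g x : ccont h x -> ccont g x -> ccont (fun t => h t * g t) x.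
Proof. exact: ccvgM. Qed.
Lemma ccontB h g x : ccont h x -> ccont g x -> ccont (fun t => h t - g t) x.
Proof.
move=> hx gx; have -> : (fun t => h t - g t) = (fun t => h t + (-1) * g t).
  by apply/funext => t; rewrite mulN1r.
by apply: ccontD => //; apply: ccontM => //; exact: ccont_cst.
Qed.

Lemma ccont_cexpi x : ccont (fun t => cexpi t) x.
Proof. by split; [exact: continuous_cos|exact: continuous_sin]. Qed.

Lemma ccont_real (u : R -> R) x : {for x, continuous u} -> ccont (fun t => Complex (u t) 0) x.
Proof. by move=> ux; split=> //; exact: cvg_cst. Qed.

Lemma ccont_inv h x : ccont h x -> h x != 0 -> ccont (fun t => (h t)^-1) x.
Proof.
move=> hx h0.
have E : (fun t => (h t)^-1) = (fun t => Complex (csq (h t))^-1 0 * conjc (h t)).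
  apply/funext => t; have [->|ht0] := eqVneq (h t) 0; first by rewrite invr0 conjc0 mulr0.
  have q0 : csq (h t) != 0 by rewrite csq_eq0.
  apply: (mulfI ht0); rewrite divff// mulrCA mul_conjE.
  by apply: complex_eqP; rewrite !(creE, cimE) /cre /cim /=; field.
rewrite E; apply: ccontM; last exact: ccvg_conj.
by apply: ccont_real; apply: cvgV; [rewrite csq_eq0|exact: (ccvg_csq hx)].
Qed.

Lemma cintegrable_cont h a b : (forall x, a <= x <= b -> ccont h x) ->
  cintegrable `[a, b] h.
Proof.
move=> hc; split; apply: continuous_compact_integrable;
  try exact: segment_compact;
  apply: continuous_in_subspaceT => x; rewrite inE/= in_itv/= => xab;
  by have [] := hc x xab.
Qed.

(** The factor 2 comes from estimating the real and the imaginary part separately. *)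
Lemma csq_cintegral_le h a b (K : R) : a <= b -> 0 <= K -> cintegrable `[a, b] h ->
  (forall x, a <= x <= b -> csq (h x) <= K) ->
  csq (cintegral `[a, b] h) <= 2 * K * (b - a) ^+ 2.
Proof.
move=> ab K0 [i1 i2] hK.
have s0 := sqrtr_ge0 K.
have mab : fine (mu `[a, b]%classic) = b - a.
  rewrite lebesgue_measure_itv/= lte_fin; case: ltP => //= ba.
  by rewrite (le_anti (introT andP (conj ab ba))) subrr.
have mI : measurable (`[a, b]%classic : set R) by exact: measurable_itv.
have fI : (mu `[a, b]%classic < +oo)%E.
  by rewrite lebesgue_measure_itv/=; case: ifP => _; rewrite ?ltry// -EFinB ltry.
have key (u : R -> R) : mu.-integrable `[a, b] (EFin \o u) ->
    (forall x, a <= x <= b -> u x ^+ 2 <= K) ->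
    Rintegral mu `[a, b] u ^+ 2 <= K * (b - a) ^+ 2.
  move=> iu uK; rewrite -(real_normK (num_real (Rintegral _ _ _))).
  rewrite -(sqr_sqrtr K0) -exprMn ler_pXn2r ?nnegrE//; last by rewrite mulr_ge0// subr_ge0.
  apply: le_trans (@le_normr_Rintegral _ _ _ mu `[a, b]%classic u mI iu) _.
  have -> : Num.sqrt K * (b - a) = Rintegral mu `[a, b] (fun=> Num.sqrt K).
    by rewrite Rintegral_cst// mab.
  apply: le_Rintegral => //.
  - exact: integrable_norm.
  - exact: integrable_cst.
  move=> x; rewrite /= in_itv/= => xab; apply: normr_le_sq => //.
  by rewrite sqr_sqrtr// uK.
have k1 := key _ i1 (fun x xab => le_trans (cre_sq_le _) (hK x xab)).
have k2 := key _ i2 (fun x xab => le_trans (cim_sq_le _) (hK x xab)).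
rewrite /csq /cintegral /cre /cim /=; move: k1 k2.
set u := Rintegral _ _ _ ^+ 2; set v := Rintegral _ _ _ ^+ 2.
by move=> k1 k2; rewrite -mulrA mulr2n mulrDl mul1r lerD.
Qed.

Lemma cintegral_split h a m b : a <= m -> m <= b -> cintegrable `[a, b] h ->
  cintegral `[a, b] h = cintegral `[a, m] h + cintegral `[m, b] h.
Proof.
move=> am mb [i1 i2].
have key (u : R -> R) : mu.-integrable `[a, b] (EFin \o u) ->
    Rintegral mu `[a, b] u = Rintegral mu `[a, m] u + Rintegral mu `[m, b] u.
  move=> iu; have := Rintegral_itvB iu (x := m); rewrite !bnd_simp => /(_ am mb) e.
  apply/eqP; rewrite addrC -subr_eq e Rintegral_itv_obnd_cbnd//.
  apply: (integrableS _ _ _ iu) => //.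
  by apply: subset_itv; rewrite bnd_simp.
by apply: complex_eqP; rewrite ?creD ?cimD; exact: key.
Qed.

Lemma csq_cexpiB (s t : R) : csq (cexpi t - cexpi s) <= 2 * (t - s) ^+ 2.
Proof.
wlog st : s t / s <= t.
  move=> h; have [st|/ltW ts] := leP s t; first exact: h.
  by rewrite -csqN opprB -[X in _ <= 2 * X]sqrrN opprB; exact: h.
rewrite -(cexpi_integral st).
have := @csq_cintegral_le (fun x => Complex 0 1 * cexpi x) s t 1 st ler01.
rewrite mulr1; apply.
  by apply: cintegrable_cont => x _; apply: ccontM; [exact: ccont_cst|exact: ccont_cexpi].
by move=> x _; rewrite csqM csq_cexpi mulr1 /csq /cre /cim /= expr0n add0r expr1n.
Qed.

End ContinuousComplexFunctions.

Section CauchyKernel.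
Context {R : realType}.
Local Notation mu := (@lebesgue_measure R).
Local Notation T := (@Tset R).
Local Notation mT := (@measurable_Tset R).
Implicit Types (z w la : R[i]).

Lemma csq_sub_lower z w : csq z = 1 -> (1 - Num.sqrt (csq w)) ^+ 2 <= csq (z - w).
Proof.
move=> z1; set m := Num.sqrt (csq w).
have m2 : m ^+ 2 = csq w by rewrite sqr_sqrtr ?csq_ge0.
have : cre (z * conjc w) <= m.
  apply: le_trans (ler_norm _) _; apply: normr_le_sq; first exact: sqrtr_ge0.
  by apply: le_trans (cre_sq_le _) _; rewrite csqM csq_conj z1 mul1r m2.
rewrite creM cre_conj cim_conj; move: z1 m2; rewrite /csq creD cimD creN cimN.
nra.
Qed.

(** The Cauchy kernel: 1 / (1 - la e^{-it}) = e^{it} / (e^{it} - la), so that integrating against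
    [kern la] in t is integrating against dw / (i (w - la)) on the unit circle. *)
Definition kern la (t : R) : R[i] := (1 - la * conjc (cexpi t))^-1.

Definition kern_bound la : R := ((1 - Num.sqrt (csq la)) ^+ 2)^-1.

Lemma one_sub_sqrt_gt0 la : inD la -> 0 < (1 - Num.sqrt (csq la)) ^+ 2.
Proof.
move=> l1; rewrite exprn_gt0// subr_gt0 -[ltRHS]sqrtr1 ltr_sqrt//.
Qed.

Lemma kern_bound_gt0 la : inD la -> 0 < kern_bound la.
Proof. by move=> l1; rewrite invr_gt0 one_sub_sqrt_gt0. Qed.

Lemma kern_den_csq la t : csq (1 - la * conjc (cexpi t)) = csq (cexpi t - la).
Proof.
rewrite -[LHS]mul1r -(csq_cexpi t) -csqM mulrBr mulr1 mulrCA cexpiVJ mulr1.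
by [].
Qed.

Lemma cexpi_sub_neq0 la t : inD la -> cexpi t - la != 0.
Proof.
move=> l1; rewrite -csq_gt0; apply: lt_le_trans (one_sub_sqrt_gt0 l1) _.
by apply: csq_sub_lower; rewrite csq_cexpi.
Qed.

Lemma kern_den_neq0 la t : inD la -> 1 - la * conjc (cexpi t) != 0.
Proof. by move=> l1; rewrite -csq_gt0 kern_den_csq csq_gt0 cexpi_sub_neq0. Qed.

Lemma csq_kern_le la t : inD la -> csq (kern la t) <= kern_bound la.
Proof.
move=> l1; rewrite csqV kern_den_csq lef_pV2 ?posrE ?one_sub_sqrt_gt0//.
  by apply: csq_sub_lower; rewrite csq_cexpi.
by rewrite csq_gt0 cexpi_sub_neq0.
Qed.

Lemma ccont_conj_cexpi t : ccont (fun t : R => conjc (cexpi t)) t.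
Proof.
split; first exact: continuous_cos.
by apply: cvgN; exact: continuous_sin.
Qed.

Lemma ccont_kern la t : inD la -> ccont (kern la) t.
Proof.
move=> l1; apply: ccont_inv; last exact: kern_den_neq0.
apply: ccontB; first exact: ccont_cst.
by apply: ccontM; [exact: ccont_cst|exact: ccont_conj_cexpi].
Qed.

Lemma ccont_meas (h : R -> R[i]) : (forall x, ccont h x) -> cmeasurable T h.
Proof.
move=> hc; split; apply: measurable_funTS; apply: continuous_measurable_fun => x;
  by have [] := hc x.
Qed.

Lemma cmeasurable_kern la : inD la -> cmeasurable T (kern la).
Proof. by move=> l1; apply: ccont_meas => x; exact: ccont_kern. Qed.

Lemma csq_cint_le (h : R -> R[i]) (K : R) : 0 <= K -> cintegrable T h ->
  (forall t, T t -> csq (h t) <= K) -> csq (cint h) <= 2 * K.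
Proof.
move=> K0 ih hK; have p0 := @twopi_gt0 R.
rewrite cintE csqM csq_real exprVn.
have := @csq_cintegral_le R h 0 (2 * pi) K (ltW p0) K0 ih.
rewrite subr0 => h1; rewrite mulrC ler_pdivrMr ?exprn_gt0//; apply: h1 => x xT.
by apply: hK; rewrite /Tset/= in_itv.
Qed.

Lemma cintegrable_cexpi (m : int) : cintegrable T (fun t : R => cexpi (m%:~R * t)).
Proof.
apply: (@cintegrable_bounded _ _ mT lebesgue_Tset_fin _ 1).
  exact: cmeasurable_cexpi.
by move=> t _; rewrite csq_cexpi.
Qed.

(** From kern = 1 + la e^{-it} kern, the integral I(l) satisfies I(l) = [l = 0] + la I(l - 1).
    Iterating M times leaves a remainder la^M I(l - M), which tends to 0 because I is bounded
    uniformly in l. *)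
Lemma cint_kern la (m : int) : inD la ->
  cint (fun t => cexpi (m%:~R * t) * kern la t) =
  if m is Posz n then la ^+ n else 0.
Proof.
move=> l1.
have cexpi_int (l : int) t : cexpi (l%:~R * t) * conjc (cexpi t) = cexpi ((l - 1)%:~R * t).
  by rewrite -cexpiN -cexpiD intrB mulrBl mul1r.
have ik (l : int) : cintegrable T (fun t => cexpi (l%:~R * t) * kern la t).
  apply: (@cintegrable_bounded _ _ mT lebesgue_Tset_fin _ (kern_bound la)).
    by apply: cmeasurableM; [exact: cmeasurable_cexpi|exact: cmeasurable_kern].
  by move=> t _; rewrite csqM csq_cexpi mul1r csq_kern_le.
have step (l : int) : cint (fun t => cexpi (l%:~R * t) * kern la t) =
    (l == 0)%:R + la * cint (fun t => cexpi ((l - 1)%:~R * t) * kern la t).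
  have ikl := ik (l - 1); have izk := cintegrableZ mT la ikl.
  rewrite -cint_cexpi -cintZ// -cintD//; last exact: cintegrable_cexpi.
  congr cint; apply/funext => t; rewrite -cexpi_int /kern.
  have k0 := @kern_den_neq0 la t l1.
  by field.
have iter (l : int) N : cint (fun t => cexpi (l%:~R * t) * kern la t) =
    \sum_(j < N) la ^+ j * (l == j%:Z)%:R +
    la ^+ N * cint (fun t => cexpi ((l - N%:Z)%:~R * t) * kern la t).
  elim: N => [|N ->]; first by rewrite big_ord0 add0r expr0 mul1r subr0.
  rewrite big_ord_recr /= -addrA; congr (_ + _).
  rewrite step subr_eq0 mulrDr mulrA -exprSr -addn1 PoszD opprD addrA.
  by rewrite eq_sym.
apply/eqP; rewrite -subr_eq0; apply/eqP.
apply: (@csq_small_eq0 _ _ (2 * kern_bound la)) => e e0.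
have cg : csq la ^+ p @[p --> \oo] --> (0 : R).
  rewrite (_ : (fun p => _) = geometric 1 (csq la)); last first.
    by apply/funext => p /=; rewrite mul1r.
  by apply: cvg_geometric; rewrite ger0_norm ?csq_ge0.
have /cvgr0Pnorm_lt/(_ e e0)[N _ hN] := cg.
(* Beyond N, so that the remainder is small, and beyond the absolute value of m, so that the index m
   occurs in the sum when it is nonnegative. *)
pose M := (N + `|m|.+1)%N.
rewrite (iter m M).
have -> : \sum_(j < M) la ^+ j * (m == j%:Z)%:R = (if m is Posz n then la ^+ n else 0).
  case: m @M => n /=; last first.
    by rewrite big1// => j _; rewrite mulr0.
  have nM : (n < N + n.+1)%N by rewrite addnS ltnS leq_addl.
  rewrite (bigD1 (Ordinal nM))//= eqxx mulr1 big1 ?addr0// => j /eqP jn.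
  case: eqP => [[nj]|_]; last by rewrite mulr0.
  by case: jn; apply: val_inj.
rewrite addrAC subrr add0r csqM csqX.
have hM := hN M (leq_addr _ _).
apply: ler_pM; rewrite ?csq_ge0// ?exprn_ge0 ?csq_ge0//.
  by apply: ltW; apply: le_lt_trans hM; rewrite /=; exact: ler_norm.
apply: csq_cint_le; first exact/ltW/kern_bound_gt0.
  exact: ik.
by move=> t _; rewrite csqM csq_cexpi mul1r csq_kern_le.
Qed.

End CauchyKernel.

Section HolomorphicFunctions.
Context {R : realType}.
Implicit Types (f : R[i] -> R[i]) (z w : R[i]).

Lemma holo_diff f z : holo f -> inD z -> exists d, forall e : R, 0 < e ->
  exists2 del : R, 0 < del & forall w, inD w -> csq (w - z) < del ->
    csq (f w - f z - d * (w - z)) <= e * csq (w - z).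
Proof.
move=> hf zD; have [d hd] := hf z zD; exists d => e e0.
have [del del0 h] := hd e e0; exists del => // w wD wz.
have [->|w0] := eqVneq w z.
  by rewrite !subrr mulr0 subr0 csq0 mulr0.
have wz0 : w - z != 0 by rewrite subr_eq0.
have wzp : 0 < csq (w - z) by rewrite csq_gt0.
have -> : f w - f z - d * (w - z) = ((f w - f z) / (w - z) - d) * (w - z).
  by rewrite mulrBl divfK.
by rewrite csqM ler_wpM2r ?csq_ge0// ltW// h// wzp wz.
Qed.

Lemma holo_cont f z : holo f -> inD z -> forall e : R, 0 < e ->
  exists2 del : R, 0 < del & forall w, inD w -> csq (w - z) < del ->
    csq (f w - f z) < e.
Proof.
move=> hf zD e e0; have [d hd] := holo_diff hf zD.
have [del del0 h] := hd 1 ltr01.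
have c0 : 0 < 2 * (1 + csq d) by have := csq_ge0 d; lra.
exists (Num.min del (e / (2 * (1 + csq d)))) => [|w wD].
  by rewrite lt_min del0 divr_gt0.
rewrite lt_min => /andP[w1 w2].
pose y := f w - f z - d * (w - z).
have h2 : csq y <= csq (w - z) by have := h w wD w1; rewrite mul1r.
have -> : f w - f z = y + d * (w - z) by rewrite /y subrK.
apply: le_lt_trans (csqD_le _ _) _; rewrite csqM.
move: w2; rewrite ltr_pdivlMr// => w2.
apply: le_lt_trans w2; move: h2; set a := csq y; set b := csq (w - z); set c := csq d.
by move=> h2; clearbody a b c; lra.
Qed.

Lemma holo_ccont f (h : R -> R[i]) x : holo f -> ccont h x -> inD (h x) ->
  ccont (fun t => f (h t)) x.
Proof.
move=> hf hx hD; apply: ccvg_small => e e0.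
have [del del0 hd] := holo_cont hf hD e0.
have n1 : \forall y \near x, csq (h y - h x) < del.
  by apply: (cvgr_lt _ (ccvg_csq (ccontB hx (ccont_cst (h x) x)))); rewrite subrr csq0.
have n2 : \forall y \near x, csq (h y) < 1 by exact: (cvgr_lt _ (ccvg_csq hx)).
by near=> y; apply: hd; near: y.
Unshelve. all: by end_near. Qed.

Lemma inD_scale (r : R) z : 0 <= r -> r < 1 -> csq z <= 1 -> inD (Complex r 0 * z).
Proof.
move=> r0 r1 z1; rewrite /inD csqM csq_real.
have := csq_ge0 z; have r2 : r ^+ 2 < 1 by rewrite expr_lt1.
have r3 : 0 <= r ^+ 2 by rewrite sqr_ge0.
nra.
Qed.

Lemma csq_convex (s : R) z w : 0 <= s <= 1 ->
  csq z <= 1 -> csq w <= 1 -> csq (z + Complex s 0 * (w - z)) <= 1.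
Proof.
move=> /andP[s0 s1] z1 w1.
have -> : csq (z + Complex s 0 * (w - z)) =
    (1 - s) * csq z + s * csq w - s * (1 - s) * csq (w - z).
  by case: z {z1} => a b; case: w {w1} => c d; rewrite /csq /cre /cim /=; ring.
have := csq_ge0 (w - z).
have : 0 <= s * (1 - s) by rewrite mulr_ge0// subr_ge0.
nra.
Qed.

End HolomorphicFunctions.

Lemma cintegral_cst {R : realType} (D : set R) (c : R[i]) : measurable D ->
  cintegral D (fun=> c) = Complex (fine (@lebesgue_measure R D)) 0 * c.
Proof.
move=> mD; rewrite /cintegral !Rintegral_cst//.
by case: c => x y; apply: complex_eqP; rewrite /cre /cim /=; ring.
Qed.

Lemma small_square {R : realType} (L d del : R) : 0 <= L -> L < 2 * d -> d <= 1 ->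
  d <= del / 32 -> 8 * L ^+ 2 < del.
Proof. by move=> *; nra. Qed.

Lemma dist_in_itv {R : realType} (a b x y : R) :
  a <= x -> x <= b -> a <= y -> y <= b -> `|y - x| <= b - a.
Proof. by move=> *; rewrite ler_norml; apply/andP; split; lra. Qed.

Lemma sum_sq_le {R : realType} (a b x y : R) : 0 <= a -> 0 <= b -> a <= x -> b <= y ->
  a ^+ 2 + b ^+ 2 <= (x + y) ^+ 2.
Proof. by move=> *; nra. Qed.

Section Goursat.
Context {R : realType}.
Local Notation mu := (@lebesgue_measure R).
Local Notation T := (@Tset R).
Local Notation mT := (@measurable_Tset R).
Variables (f : R[i] -> R[i]) (r : R) (la : R[i]) (sig : R).
Hypotheses (hf : holo f) (r0 : 0 < r) (r1 : r < 1) (laD : inD la).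
Hypotheses (sig0 : 0 < sig) (sig1 : sig <= 1).

(* Radial homotopy from the unit circle (s = 1) to the point la (s = 0). *)
Let W (s t : R) : R[i] := la + Complex s 0 * (cexpi t - la).
Let u (s t : R) : R[i] := f (Complex r 0 * W s t).
(** Since W - la = s (e^{it} - la), the form dw / (w - la) pulls back to ds / s + kap dt: the
    variables separate, and the only singularity is at s = 0, which [sig] keeps away. *)
Let kap (t : R) : R[i] := Complex 0 1 * cexpi t / (cexpi t - la).

(* The integral of v dw / (w - la) along the image under W of the boundary of
   the parameter rectangle I x J. *)
Let Phi (v : R -> R -> R[i]) (I J : R * R) : R[i] :=
  cintegral `[J.1, J.2] (fun t => (v I.2 t - v I.1 t) * kap t) -
  cintegral `[I.1, I.2] (fun s => (v s J.2 - v s J.1) * Complex s^-1 0).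

Let nice (v : R -> R -> R[i]) := forall s t, sig <= s <= 1 ->
  ccont (v s) t /\ ccont (v^~ t) s.

Let sub (I J : R * R) := J.1 <= I.1 /\ I.1 <= I.2 /\ I.2 <= J.2.

Let ccont_kap t : ccont kap t.
Proof.
apply: ccontM; first by apply: ccontM; [exact: ccont_cst|exact: ccont_cexpi].
apply: ccont_inv; last exact: cexpi_sub_neq0.
by apply: ccontB; [exact: ccont_cexpi|exact: ccont_cst].
Qed.

Let csq_kap_le t : csq (kap t) <= kern_bound la.
Proof.
rewrite /kap csqM csqM csq_cexpi mulr1 csqV -kern_den_csq -csqV.
have -> : csq (Complex (0 : R) 1) = 1 by rewrite /csq /cre /cim /=; ring.
by rewrite mul1r; exact: csq_kern_le.
Qed.

Let int_t (v : R -> R -> R[i]) (I J : R * R) : nice v -> sub I (sig, 1) ->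
  cintegrable `[J.1, J.2] (fun t => (v I.2 t - v I.1 t) * kap t).
Proof.
move=> nv [/= a [b c]]; apply: cintegrable_cont => t _.
apply: ccontM; last exact: ccont_kap.
have h1 : sig <= I.1 <= 1 by rewrite a (le_trans b c).
have h2 : sig <= I.2 <= 1 by rewrite c (le_trans a b).
by apply: ccontB; [have [] := nv _ t h2|have [] := nv _ t h1].
Qed.

Let int_s (v : R -> R -> R[i]) (I J : R * R) : nice v -> sub I (sig, 1) ->
  cintegrable `[I.1, I.2] (fun s => (v s J.2 - v s J.1) * Complex s^-1 0).
Proof.
move=> nv [/= a [b c]]; apply: cintegrable_cont => s sI.
have s01 : sig <= s <= 1.
  by case/andP: sI => s1 s2; rewrite (le_trans a s1) (le_trans s2 c).
apply: ccontM; last first.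
  apply: ccont_real; apply: inv_continuous; apply: lt0r_neq0.
  by case/andP: s01 => s1 _; exact: lt_le_trans s1.
by apply: ccontB; [have [_] := nv s J.2 s01|have [_] := nv s J.1 s01].
Qed.

Let PhiD v1 v2 I J : nice v1 -> nice v2 -> sub I (sig, 1) ->
  Phi (fun s t => v1 s t + v2 s t) I J = Phi v1 I J + Phi v2 I J.
Proof.
move=> n1 n2 sI; rewrite /Phi addrACA -opprD -!cintegralD; last first.
- exact: int_t.
- exact: int_t.
- exact: measurable_itv.
- exact: int_s.
- exact: int_s.
- exact: measurable_itv.
by congr (_ - _); apply: eq_cintegral => x _; ring.
Qed.

Let Phi_splitS v I J : nice v -> sub I (sig, 1) ->
  Phi v I J = Phi v (I.1, (I.1 + I.2) / 2) J + Phi v ((I.1 + I.2) / 2, I.2) J.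
Proof.
move=> nv sI; have [/= a [b c]] := sI.
set m := (I.1 + I.2) / 2.
have am : I.1 <= m by rewrite /m; lra.
have mb : m <= I.2 by rewrite /m; lra.
have sI1 : sub (I.1, m) (sig, 1) by rewrite /sub /=; lra.
have sI2 : sub (m, I.2) (sig, 1) by rewrite /sub /=; lra.
rewrite /Phi addrACA -opprD (cintegral_split am mb); last exact: int_s.
rewrite -cintegralD; last first.
- exact: (int_t J nv sI2).
- exact: (int_t J nv sI1).
- exact: measurable_itv.
by congr (_ - _); apply: eq_cintegral => x _ /=; ring.
Qed.

Let Phi_splitT v I J : nice v -> sub I (sig, 1) -> J.1 <= J.2 ->
  Phi v I J = Phi v I (J.1, (J.1 + J.2) / 2) + Phi v I ((J.1 + J.2) / 2, J.2).
Proof.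
move=> nv sI J12.
set m := (J.1 + J.2) / 2.
have am : J.1 <= m by rewrite /m; lra.
have mb : m <= J.2 by rewrite /m; lra.
rewrite /Phi addrACA -opprD (cintegral_split am mb); last exact: int_t.
rewrite -cintegralD; last first.
- exact: (int_s (m, J.2) nv sI).
- exact: (int_s (J.1, m) nv sI).
- exact: measurable_itv.
by congr (_ - _); apply: eq_cintegral => x _ /=; ring.
Qed.

(** The function is a + b (w - la). In the differences over opposite sides a cancels, and what
    remains cancels the denominators s and e^{it} - la; both integrals then equal b (I.2 - I.1)
    (e^{i J.2} - e^{i J.1}). *)
Let Phi_affine (a b : R[i]) I J : sub I (sig, 1) -> J.1 <= J.2 ->
  Phi (fun s t => a + b * (Complex s 0 * (cexpi t - la))) I J = 0.
Proof.
move=> [/= sI [I12 I1]] J12; rewrite /Phi.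
have -> : cintegral `[J.1, J.2] (fun t => (a + b * (Complex I.2 0 * (cexpi t - la)) -
    (a + b * (Complex I.1 0 * (cexpi t - la)))) * kap t) =
    b * Complex (I.2 - I.1) 0 * (cexpi J.2 - cexpi J.1).
  rewrite -(cexpi_integral J12) -cintegralZ; last first.
  - apply: cintegrable_cont => t _.
    by apply: ccontM; [exact: ccont_cst|exact: ccont_cexpi].
  - exact: measurable_itv.
  apply: eq_cintegral => t _; rewrite /kap.
  have c0 := cexpi_sub_neq0 t laD.
  have -> : Complex (I.2 - I.1) 0 = Complex I.2 0 - Complex I.1 0 :> R[i].
    by apply: complex_eqP; rewrite !(creE, cimE) /cre /cim /=; ring.
  by field.
rewrite (@eq_cintegral _ _ _ (fun=> b * (cexpi J.2 - cexpi J.1))) => [|s]; last first.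
  rewrite inE /= in_itv /= => /andP[s1 s2].
  have s0 : s != 0 by apply: lt0r_neq0; exact: lt_le_trans (lt_le_trans sig0 sI) s1.
  have -> : Complex s^-1 0 = (Complex s 0)^-1 :> R[i].
    by apply: complex_eqP; rewrite /cre /cim /= ?mul0r ?oppr0 ?expr0n ?addr0//=; field.
  have s0' : Complex s 0 != 0 :> R[i].
    by apply/eqP => -[/eqP]; exact/negP.
  by field.
have -> : cintegral `[I.1, I.2] (fun=> b * (cexpi J.2 - cexpi J.1)) =
    Complex (I.2 - I.1) 0 * (b * (cexpi J.2 - cexpi J.1)).
  have mI : fine (mu `[I.1, I.2]%classic) = I.2 - I.1.
    rewrite lebesgue_measure_itv/= lte_fin; case: ltP => //= ba.
    by rewrite (le_anti (introT andP (conj I12 ba))) subrr.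
  by rewrite cintegral_cst ?mI//; exact: measurable_itv.
by rewrite mulrA [b * _]mulrC subrr.
Qed.

Let W_in s t : 0 <= s <= 1 -> inD (Complex r 0 * W s t).
Proof.
move=> s01; apply: inD_scale => //; first exact: ltW.
by apply: csq_convex => //; [exact: ltW|rewrite csq_cexpi].
Qed.

Let nice_u : nice u.
Proof.
move=> s t /andP[s1 s2].
have s01 : 0 <= s <= 1 by rewrite s2 andbT; apply: le_trans s1; exact: ltW.
split; apply: holo_ccont => //; try exact: W_in.
  apply: ccontM; first exact: ccont_cst.
  apply: ccontD; first exact: ccont_cst.
  apply: ccontM; first exact: ccont_cst.
  by apply: ccontB; [exact: ccont_cexpi|exact: ccont_cst].
apply: ccontM; first exact: ccont_cst.
apply: ccontD; first exact: ccont_cst.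
apply: ccontM; last exact: ccont_cst.
by apply: ccont_real; exact: cvg_id.
Qed.

Let nice_affine a b : nice (fun s t => a + b * (Complex s 0 * (cexpi t - la))).
Proof.
move=> s t _; split; apply: ccontD; try exact: ccont_cst.
  apply: ccontM; first exact: ccont_cst.
  apply: ccontM; first exact: ccont_cst.
  by apply: ccontB; [exact: ccont_cexpi|exact: ccont_cst].
apply: ccontM; first exact: ccont_cst.
apply: ccontM; last exact: ccont_cst.
by apply: ccont_real; exact: cvg_id.
Qed.

Let Phi_bound v I J (K : R) : nice v -> sub I (sig, 1) -> J.1 <= J.2 -> 0 <= K ->
  (forall s t, I.1 <= s <= I.2 -> J.1 <= t <= J.2 -> csq (v s t) <= K) ->
  csq (Phi v I J) <= 16 * K * (kern_bound la + (sig ^+ 2)^-1) *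
    ((I.2 - I.1) + (J.2 - J.1)) ^+ 2.
Proof.
move=> nv sI J12 K0 vK; have [/= a [b c]] := sI.
have k0 := kern_bound_gt0 laD.
have sg : 0 < (sig ^+ 2)^-1 by rewrite invr_gt0 exprn_gt0.
have diff x y : csq x <= K -> csq y <= K -> csq (x - y) <= 4 * K.
  by move=> xK yK; apply: le_trans (csqB_le _ _) _; lra.
have i1 : csq (cintegral `[J.1, J.2] (fun t => (v I.2 t - v I.1 t) * kap t)) <=
    2 * (4 * K * kern_bound la) * (J.2 - J.1) ^+ 2.
  apply: csq_cintegral_le => //; [by rewrite !mulr_ge0// ltW|exact: int_t|].
  move=> t tJ; rewrite csqM ler_pM ?csq_ge0 ?csq_kap_le//.
  by apply: diff; apply: vK => //; rewrite ?lexx ?b.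
have i2 : csq (cintegral `[I.1, I.2] (fun s => (v s J.2 - v s J.1) * Complex s^-1 0)) <=
    2 * (4 * K * (sig ^+ 2)^-1) * (I.2 - I.1) ^+ 2.
  apply: csq_cintegral_le => //; [by rewrite !mulr_ge0// ltW|exact: int_s|].
  move=> s sJ; rewrite csqM ler_pM ?csq_ge0//.
    by apply: diff; apply: vK => //; rewrite ?lexx ?J12.
  rewrite csq_real exprVn; case/andP: sJ => s1 s2.
  have ss : sig <= s := le_trans a s1.
  have s0 : 0 < s := lt_le_trans sig0 ss.
  by rewrite lef_pV2 ?posrE ?exprn_gt0// ler_pXn2r ?nnegrE// ltW.
apply: le_trans (csqB_le _ _) _.
move: i1 i2; set p := csq _; set q := csq _.
set x := J.2 - J.1; set y := I.2 - I.1.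
have x0 : 0 <= x by rewrite subr_ge0.
have y0 : 0 <= y by rewrite subr_ge0.
set k := kern_bound la; set g := (sig ^+ 2)^-1 => i1 i2.
have h1 : K * k * x ^+ 2 <= K * k * (y + x) ^+ 2.
  by apply: ler_wpM2l; [rewrite mulr_ge0// ltW|nra].
have h2 : K * g * y ^+ 2 <= K * g * (y + x) ^+ 2.
  by apply: ler_wpM2l; [rewrite mulr_ge0// ltW|nra].
have -> : 16 * K * (k + g) * (y + x) ^+ 2 =
  16 * (K * k * (y + x) ^+ 2) + 16 * (K * g * (y + x) ^+ 2) by ring.
move: i1 i2 h1 h2.
have -> : 2 * (4 * K * k) * x ^+ 2 = 8 * (K * k * x ^+ 2) by ring.
have -> : 2 * (4 * K * g) * y ^+ 2 = 8 * (K * g * y ^+ 2) by ring.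
set a1 := K * k * x ^+ 2; set a2 := K * g * y ^+ 2.
set a3 := K * k * _; set a4 := K * g * _.
clearbody p q a1 a2 a3 a4; lra.
Qed.

Let csq_W_le x y s t : 0 <= x <= 1 ->
  csq (W s t - W x y) <= 8 * ((s - x) ^+ 2 + (t - y) ^+ 2).
Proof.
move=> /andP[x0 x1].
have -> : W s t - W x y =
    Complex (s - x) 0 * (cexpi t - la) + Complex x 0 * (cexpi t - cexpi y).
  have -> : Complex (s - x) 0 = Complex s 0 - Complex x 0 :> R[i].
    by apply: complex_eqP; rewrite !(creE, cimE) /cre /cim /=; ring.
  by rewrite /W; ring.
apply: le_trans (csqD_le _ _) _; rewrite !csqM !csq_real.
have h1 : csq (cexpi t - la) <= 4.
  by apply: le_trans (csqB_le _ _) _; rewrite csq_cexpi; move: laD; rewrite /inD; lra.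
have h2 := csq_cexpiB y t.
have h3 : x ^+ 2 <= 1 by rewrite expr_le1.
have h4 : (s - x) ^+ 2 * csq (cexpi t - la) <= (s - x) ^+ 2 * 4.
  by rewrite ler_wpM2l ?sqr_ge0.
have h5 : x ^+ 2 * csq (cexpi t - cexpi y) <= 2 * (t - y) ^+ 2.
  by apply: le_trans h2; rewrite ler_piMl ?csq_ge0.
have := sqr_ge0 (s - x); have := sqr_ge0 (t - y); lra.
Qed.

(** Subtracting from [u] its first-order expansion at (x, y) does not change [Phi], by [Phi_affine].
    The remainder has squared modulus at most a small multiple of L^2, and [Phi_bound] contributes
    another L^2. *)
Let Phi_u_local x y : sig <= x <= 1 -> 0 <= y <= 2 * pi -> forall e : R, 0 < e ->
  exists2 d : R, 0 < d & forall I J, sub I (sig, 1) -> sub J (0, 2 * pi) ->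
    I.1 <= x <= I.2 -> J.1 <= y <= J.2 -> I.2 - I.1 < d -> J.2 - J.1 < d ->
    csq (Phi u I J) <= e * ((I.2 - I.1) + (J.2 - J.1)) ^+ 4.
Proof.
move=> /andP[sx x1] _ e e0.
have x01 : 0 <= x <= 1 by rewrite x1 (le_trans (ltW sig0) sx).
set z := Complex r 0 * W x y.
have zD : inD z by exact: W_in.
have [b hb] := holo_diff hf zD.
set C := kern_bound la + (sig ^+ 2)^-1.
have C0 : 0 < C by rewrite addr_gt0 ?kern_bound_gt0// invr_gt0 exprn_gt0.
(* The factor 16 C comes from [Phi_bound] and the factor 8 from [csq_W_le]; they cancel exactly at
   the end. *)
have e1 : 0 < e / (16 * 8 * C) by rewrite divr_gt0// !mulr_gt0.
have [del del0 hdel] := hb _ e1.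
(* With L < 2 d and d <= 1 this gives 8 L^2 < 32 d^2 <= 32 d <= del. *)
pose d : R := Num.min 1 (del / 32).
have d0 : 0 < d by rewrite lt_min ltr01 divr_gt0.
exists d => // I J sI sJ /andP[xI1 xI2] /andP[yJ1 yJ2] dI dJ.
have [/= sI1 [sI2 sI3]] := sI; have [_ [J12 _]] := sJ.
pose L := (I.2 - I.1) + (J.2 - J.1).
(* The expansion f z + b (r w - z) rewritten as A + Bc (w - la), the shape treated by
   [Phi_affine]. *)
pose A := f z + b * (Complex r 0 * la - z).
pose Bc := b * Complex r 0.
pose aff s t := A + Bc * (Complex s 0 * (cexpi t - la)).
pose rem s t := u s t - aff s t.
have nrem : nice rem.
  move=> s t sT; have [n1 n2] := nice_u t sT; have [m1 m2] := nice_affine A Bc t sT.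
  by split; apply: ccontB.
have uE : Phi u I J = Phi aff I J + Phi rem I J.
  rewrite -PhiD//; last exact: nice_affine.
  by congr (Phi _ I J); apply/funext => s; apply/funext => t; rewrite /rem addrC subrK.
rewrite uE Phi_affine// add0r.
have remE s t : rem s t = f (Complex r 0 * W s t) - f z - b * (Complex r 0 * W s t - z).
  by rewrite /rem /aff /u /A /Bc /W; ring.
have L0 : 0 <= L by rewrite /L addr_ge0 ?subr_ge0.
have d1 : d <= 1 by rewrite /d ge_min lexx.
have d2 : d <= del / 32 by rewrite /d ge_min lexx orbT.
have Ldel : 8 * L ^+ 2 < del.
  have L2d : L < 2 * d by rewrite /L mulr2n mulrDl mul1r ltrD.
  exact: small_square L2d d1 d2.
have Wle s t : I.1 <= s <= I.2 -> J.1 <= t <= J.2 ->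
    csq (Complex r 0 * W s t - z) <= 8 * L ^+ 2.
  move=> /andP[s1 s2] /andP[t1 t2]; rewrite /z -mulrBr csqM csq_real.
  have r2 : r ^+ 2 <= 1 by rewrite expr_le1// ltW.
  apply: le_trans (_ : csq (W s t - W x y) <= _).
    by rewrite ler_piMl ?csq_ge0.
  apply: le_trans (csq_W_le y s t x01) _; rewrite ler_pM2l//.
  have h1 : `|s - x| <= I.2 - I.1 by exact: dist_in_itv.
  have h2 : `|t - y| <= J.2 - J.1 by exact: dist_in_itv.
  rewrite -(real_normK (num_real (s - x))) -(real_normK (num_real (t - y))) /L.
  by apply: sum_sq_le => //; exact: normr_ge0.
have remle s t : I.1 <= s <= I.2 -> J.1 <= t <= J.2 ->
    csq (rem s t) <= e / (16 * 8 * C) * (8 * L ^+ 2).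
  move=> sI' tJ'; rewrite remE.
  have wD : inD (Complex r 0 * W s t).
    apply: W_in; case/andP: sI' => s1 s2.
    by rewrite (le_trans s2 sI3) (le_trans (ltW sig0) (le_trans sI1 s1)).
  have Wl := Wle s t sI' tJ'.
  apply: le_trans (hdel _ wD _) _; first exact: le_lt_trans Wl Ldel.
  by rewrite ler_pM2l.
have K0 : 0 <= e / (16 * 8 * C) * (8 * L ^+ 2).
  by rewrite mulr_ge0 ?(ltW e1)// mulr_ge0// sqr_ge0.
apply: le_trans (Phi_bound nrem sI J12 K0 remle) _.
rewrite -/C -/L le_eqVlt; apply/orP; left; apply/eqP.
by field; exact: lt0r_neq0.
Qed.

Let Phi_u_eq0 : Phi u (sig, 1) (0, 2 * pi) = 0.
Proof.
refine (@rectangle_function_eq0 R (Phi u) (sig, 1) (0, 2 * pi) sig1 (ltW twopi_gt0) _ _ _).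
- by move=> I J sI sJ; exact: Phi_splitS nice_u sI.
- by move=> I J sI [_ [J12 _]]; exact: Phi_splitT nice_u sI J12.
- exact: Phi_u_local.
Qed.

Lemma radial_homotopy :
  cintegral T (fun t => (f (Complex r 0 * cexpi t) -
    f (Complex r 0 * (la + Complex sig 0 * (cexpi t - la)))) * kap t) = 0.
Proof.
have := Phi_u_eq0; rewrite /Phi /=.
(* The two radial sides t = 0 and t = 2 pi have the same image, so the integral over s
   disappears. *)
have per s : u s (2 * pi) = u s 0.
  suff e : cexpi (2 * pi) = cexpi 0 :> R[i] by rewrite /u /W e.
  have := cosD2pin (0 : R) 1; have := sinD2pin (0 : R) 1.
  by rewrite mul1r add0r /cexpi => -> ->.
rewrite (@eq_cintegral _ `[sig, 1] _ (fun=> 0)); last first.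
  by move=> s _; rewrite per subrr mul0r.
rewrite cintegral0 subr0 => <-; apply: eq_cintegral => t _.
rewrite /u /W; congr ((f (_ * _) - _) * _).
by rewrite -[Complex 1 0]/(1 : R[i]) mul1r addrC subrK.
Qed.

End Goursat.

(** * Boundary values of bounded analytic functions *)

Section BoundaryValues.
Context {R : realType}.
Local Notation mu := (@lebesgue_measure R).
Local Notation T := (@Tset R).
Local Notation mT := (@measurable_Tset R).
Implicit Types (f : R[i] -> R[i]) (la z w : R[i]).

Lemma inD_circle (r t : R) : 0 <= r -> r < 1 -> inD (Complex r 0 * cexpi t).
Proof. by move=> r0 r1; apply: inD_scale => //; rewrite csq_cexpi. Qed.

Lemma ccont_circle f (r t : R) : holo f -> 0 <= r -> r < 1 ->
  ccont (fun t => f (Complex r 0 * cexpi t)) t.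
Proof.
move=> hf r0 r1; apply: holo_ccont => //; last exact: inD_circle.
by apply: ccontM; [exact: ccont_cst|exact: ccont_cexpi].
Qed.

(** Cauchy's formula for z |-> f(r z), which is analytic across the unit circle. The homotopy
    replaces the unit circle by its image shrunk towards la by the factor sig; there f(r w) is close
    to f(r la), and sig is arbitrary. *)
Lemma cauchy_circle f (r : R) la : holo f -> 0 < r -> r < 1 -> inD la ->
  cint (fun t => f (Complex r 0 * cexpi t) * kern la t) = f (Complex r 0 * la).
Proof.
move=> hf r0 r1 laD.
have laD' : inD (Complex r 0 * la) by apply: inD_scale => //; exact: ltW.
pose kap (t : R) : R[i] := Complex 0 1 * cexpi t / (cexpi t - la).
have kapE t : kap t = Complex 0 1 * kern la t.
  have h1 := cexpi_sub_neq0 t laD; have h2 := kern_den_neq0 t laD.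
  rewrite /kap /kern -mulrA; congr (_ * _); apply: (mulIf h1); rewrite divfK//.
  apply: (mulfI h2); rewrite mulrA divff// mul1r mulrBl mul1r -mulrA.
  by rewrite [conjc _ * _]mulrC cexpiVJ mulr1.
have csq_i : csq (Complex (0 : R) 1) = 1 by rewrite /csq /cre /cim /=; ring.
have ckern t : ccont (kern la) t by exact: ccont_kern.
have ccirc t : ccont (fun t => f (Complex r 0 * cexpi t)) t.
  by apply: ccont_circle => //; exact: ltW.
have iT (h : R -> R[i]) : (forall t, ccont h t) -> cintegrable T h.
  by move=> hc; apply: cintegrable_cont.
have z0 : cintegral T (fun t => (f (Complex r 0 * cexpi t) - f (Complex r 0 * la)) *
    kern la t) = 0.
  apply: (@csq_small_eq0 _ _ (2 * kern_bound la * (2 * pi) ^+ 2)) => e e0.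
  have [del del0 hdel] := holo_cont hf laD' e0.
  (* The squared distance from w(t) to r la is at most 4 sig^2 <= 4 sig <= del / 2. *)
  pose sig : R := Num.min 1 (del / 8).
  have sig0 : 0 < sig by rewrite lt_min ltr01 divr_gt0.
  have sig1 : sig <= 1 by rewrite ge_min lexx.
  have sig2 : sig <= del / 8 by rewrite ge_min lexx orbT.
  pose w t := Complex r 0 * (la + Complex sig 0 * (cexpi t - la)).
  have wD t : inD (w t).
    apply: inD_scale => //; first exact: ltW.
    by apply: csq_convex; rewrite ?csq_cexpi ?(ltW sig0)//; exact: ltW.
  have wdel t : csq (w t - Complex r 0 * la) < del.
    rewrite /w -mulrBr addrC addKr !csqM !csq_real.
    have h1 : csq (cexpi t - la) <= 4.
      by apply: le_trans (csqB_le _ _) _; rewrite csq_cexpi; move: laD; rewrite /inD; lra.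
    have h2 : r ^+ 2 <= 1 by rewrite expr_le1// ltW.
    have h3 : sig ^+ 2 <= sig by rewrite expr2 ger_pMr.
    have h4 : sig ^+ 2 * csq (cexpi t - la) <= del / 8 * 4.
      by apply: ler_pM; rewrite ?sqr_ge0 ?csq_ge0//; exact: le_trans sig2.
    have h5 : r ^+ 2 * (sig ^+ 2 * csq (cexpi t - la)) <= sig ^+ 2 * csq (cexpi t - la).
      by rewrite ler_piMl// mulr_ge0 ?sqr_ge0 ?csq_ge0.
    by move: h4 h5; set a := _ * csq _; set b := _ * a; clearbody a b; lra.
  have cw t : ccont (fun t => f (w t)) t.
    apply: holo_ccont => //; apply: ccontM; first exact: ccont_cst.
    apply: ccontD; first exact: ccont_cst.
    apply: ccontM; first exact: ccont_cst.
    by apply: ccontB; [exact: ccont_cexpi|exact: ccont_cst].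
  have -> : cintegral T (fun t => (f (Complex r 0 * cexpi t) - f (Complex r 0 * la)) *
      kern la t) = cintegral T (fun t => (f (w t) - f (Complex r 0 * la)) * kern la t).
    have := radial_homotopy hf r0 r1 laD sig0 sig1.
    rewrite (_ : (fun t => _) = (fun t => Complex 0 1 *
      ((f (Complex r 0 * cexpi t) - f (w t)) * kern la t))); last first.
      by apply/funext => t; rewrite -/(kap t) kapE /w; ring.
    rewrite cintegralZ; [|exact: mT|]; last first.
      by apply: iT => t; apply: ccontM => //; apply: ccontB.
    move/eqP; rewrite mulf_eq0 -csq_eq0 csq_i oner_eq0/= => /eqP h.
    rewrite -[RHS]add0r -h -cintegralD; [|exact: mT| |].
    - by apply: eq_cintegral => t _; ring.
    - by apply: iT => t; apply: ccontM => //; apply: ccontB.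
    - by apply: iT => t; apply: ccontM => //; apply: ccontB => //; exact: ccont_cst.
  have := @csq_cintegral_le R (fun t => (f (w t) - f (Complex r 0 * la)) * kern la t)
    0 (2 * pi) (e * kern_bound la) (ltW twopi_gt0).
  rewrite subr0 [2 * (e * _)]mulrCA -[X in _ -> _ -> _ -> _ <= X]mulrA; apply.
  - by rewrite mulr_ge0// ltW// kern_bound_gt0.
  - by apply: iT => t; apply: ccontM => //; apply: ccontB => //; exact: ccont_cst.
  - move=> t _; rewrite csqM ler_pM ?csq_ge0 ?csq_kern_le//.
    by apply: ltW; apply: hdel.
have ik : cintegrable T (kern la) by exact: iT.
have k1 : cint (kern la) = 1.
  have := cint_kern (Posz 0) laD; rewrite expr0 => <-; congr cint; apply/funext => t.
  by rewrite mul0r cexpi0 mul1r.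
rewrite -[RHS]mulr1 -k1 !cintE mulrCA; congr (_ * _).
rewrite -[RHS]add0r -z0 -cintegralZ//; last exact: mT.
rewrite -cintegralD; [|exact: mT| |].
- by apply: eq_cintegral => t _; ring.
- by apply: iT => t; apply: ccontM => //; apply: ccontB => //; exact: ccont_cst.
- by apply: cintegrableZ => //; exact: mT.
Qed.

(** The radii 1/2, 2/3, 3/4, ...: positive from the start, as [cauchy_circle] requires. *)
Definition rad (p : nat) : R := 1 - p.+2%:R^-1.

Lemma rad_gt0 p : 0 < rad p.
Proof. by rewrite subr_gt0 invf_lt1 ?ltr1n. Qed.
Lemma rad_lt1 p : rad p < 1.
Proof. by rewrite gtrBl invr_gt0. Qed.
Lemma rad_near (d : R) : 0 < d -> exists N, forall p, (N <= p)%N -> 1 - d < rad p.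
Proof.
move=> d0; exists (Num.bound d^-1) => p Np.
rewrite /rad ltrD2l ltrN2 -[d]invrK ltf_pV2 ?posrE ?invr_gt0//.
apply: lt_le_trans (archi_boundP _) _; first by rewrite invr_ge0 ltW.
by rewrite ler_nat (leq_trans Np)// ltnW// ltnW.
Qed.

Lemma radlim_cvg f t (l : R[i]) : radlim f t l ->
  ccvg \oo (fun p => f (Complex (rad p) 0 * cexpi t)) l.
Proof.
move=> fl; apply: ccvg_small => e e0; have [d d0 hd] := fl e e0.
have [N hN] := rad_near d0; exists N => // p Np.
by apply: hd; [exact: hN|exact: rad_lt1].
Qed.

Lemma cmeasurable_if (D N : set R) (g h : R -> R[i]) :
  measurable D -> measurable N -> cmeasurable D g -> cmeasurable D h ->
  cmeasurable D (fun t => if t \in N then g t else h t).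
Proof.
move=> mD mN [g1 g2] [h1 h2].
have mb : measurable_fun D (fun t => t \in N).
  apply: (measurable_fun_bool true).
  rewrite (_ : _ `&` _ = D `&` N); first exact: measurableI.
  by apply/seteqP; split => t [Dt] /=; [move=> /set_mem|move=> /mem_set].
split.
  under eq_fun do rewrite (fun_if (@cre R)).
  by apply: measurable_fun_if => //; [apply: measurable_funS g1|apply: measurable_funS h1].
under eq_fun do rewrite (fun_if (@cim R)).
by apply: measurable_fun_if => //; [apply: measurable_funS g2|apply: measurable_funS h2].
Qed.

(** Measurability of boundary values is not part of the data. Off [N] they are limits of the
    continuous functions t |-> f(r_p e^{it}); on [N] the constant value takes over, so the limit
    holds at every point of the circle. *)
Lemma bdry_measurable f (g : R -> R[i]) (N : set R) c : holo f -> measurable N ->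
  (forall t, N t -> g t = c) -> (forall t, T t -> ~ N t -> radlim f t (g t)) ->
  cmeasurable T g.
Proof.
move=> hf mN gN gl.
pose h p t := if t \in N then c else f (Complex (rad p) 0 * cexpi t).
have mh p : cmeasurable T (h p).
  apply: cmeasurable_if; [exact: mT|exact: mN|exact: cmeasurable_cst|].
  apply: ccont_meas => t; apply: ccont_circle => //; first exact/ltW/rad_gt0.
  exact: rad_lt1.
refine (@cmeasurable_cvg R T h g mh _) => t Tt; rewrite /h; have [Nt|Nt] := pselect (N t).
  by rewrite mem_set// gN//; exact: ccvg_cst.
by rewrite memNset//; apply: radlim_cvg; exact: gl.
Qed.

Lemma radial_cint_cvg f (g h : R -> R[i]) (N : set R) (K L : R) :
  holo f -> (forall z, inD z -> csq (f z) <= K) ->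
  cmeasurable T g -> measurable N -> mu N = 0%E ->
  (forall t, T t -> ~ N t -> radlim f t (g t)) ->
  cmeasurable T h -> (forall t, T t -> csq (h t) <= L) ->
  ccvg \oo (fun p => cint (fun t => f (Complex (rad p) 0 * cexpi t) * h t))
    (cint (fun t => g t * h t)).
Proof.
move=> hf fK mg mN N0 gl mh hL; have rp p : 0 <= rad p by exact/ltW/rad_gt0.
under eq_fun do rewrite cintE; rewrite cintE; apply: ccvgM; first exact: ccvg_cst.
apply: (cintegral_dct mT mN N0 _ _ (integrable_cst mT lebesgue_Tset_fin (K * L + 1))).
- move=> p; apply: cmeasurableM => //; apply: ccont_meas => t.
  by apply: ccont_circle => //; exact: rad_lt1.
- exact: cmeasurableM.
- by move=> t Tt Nt; apply: ccvgM; [exact: radlim_cvg (gl t Tt Nt)|exact: ccvg_cst].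
- move=> p t Tt Nt; apply: csq_le_normre; rewrite csqM ler_pM ?csq_ge0 ?hL//.
  by apply: fK; apply: inD_circle => //; exact: rad_lt1.
Qed.

Lemma cauchy_boundary f (g : R -> R[i]) (N : set R) (K : R) la :
  holo f -> (forall z, inD z -> csq (f z) <= K) -> inD la ->
  cmeasurable T g -> measurable N -> mu N = 0%E ->
  (forall t, T t -> ~ N t -> radlim f t (g t)) ->
  cint (fun t => g t * kern la t) = f la.
Proof.
move=> hf fK laD mg mN N0 gl.
have rp p : 0 <= rad p by exact/ltW/rad_gt0.
have rp1 p := rad_lt1 p.
have cv := radial_cint_cvg hf fK mg mN N0 gl (cmeasurable_kern laD)
  (fun t _ => csq_kern_le t laD).
apply: (ccvg_unique cv).
under eq_fun => p do rewrite (cauchy_circle hf (rad_gt0 p) (rp1 p) laD).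
apply: ccvg_small => e e0.
have [del del0 hdel] := holo_cont hf laD e0; have [M hM] := rad_near (del0 : 0 < del).
exists M => // p Mp; apply: hdel; first by apply: inD_scale => //; exact: ltW.
have -> : Complex (rad p) 0 * la - la = Complex (rad p - 1) 0 * la.
  have -> : Complex (rad p - 1) 0 = Complex (rad p) 0 - 1 :> R[i].
    by apply: complex_eqP; rewrite !(creE, cimE) /cre /cim /=; ring.
  by ring.
rewrite csqM csq_real; have := hM p Mp; have := rp p; have := rp1 p.
move: laD; rewrite /inD; have := csq_ge0 la.
set q := csq la; set s := rad p => q0 q1 s1 s0 ds.
have h1 : (s - 1) ^+ 2 <= 1 - s by nra.
have h2 : (s - 1) ^+ 2 * q <= (s - 1) ^+ 2 by rewrite ler_piMr ?sqr_ge0// ltW.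
lra.
Qed.

Lemma holo_mulX f : holo f -> holo (fun z => z * f z).
Proof.
move=> hf z zD; have [d hd] := hf z zD; exists (f z + z * d) => e e0.
have c0 : 0 < 4 * (csq z + 1) by have := csq_ge0 z; lra.
have [d1 d10 h1] := hd _ (divr_gt0 e0 c0).
have e4 : 0 < e / 4 by rewrite divr_gt0.
have [d2 d20 h2] := holo_cont hf zD e4.
exists (Num.min d1 d2) => [|w wD]; first by rewrite lt_min d10.
rewrite lt_min => /andP[wz0 /andP[w1 w2]].
have wz : w - z != 0 by rewrite -csq_gt0.
have -> : (w * f w - z * f z) / (w - z) - (f z + z * d) =
    z * ((f w - f z) / (w - z) - d) + (f w - f z) by field.
have k1 := h1 w wD (introT andP (conj wz0 w1)).
have k2 := h2 w wD w2.
apply: le_lt_trans (csqD_le _ _) _; rewrite csqM.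
move: k1 k2; set a := csq (_ - d); set b := csq (f w - f z); rewrite ltr_pdivlMr// => k1 k2.
have z0 := csq_ge0 z; have a0 : 0 <= a := csq_ge0 _.
set q := csq z; move: z0; rewrite -/q => z0.
by move: k1; rewrite -/q; clearbody a b q => k1; nra.
Qed.

(** For m = - (j + 1), apply Cauchy's formula at 0 to z^(j+1) f(z), which vanishes there, divide by
    r^(j+1), and let r tend to 1. *)
Lemma boundary_neg_fourier f (g : R -> R[i]) (N : set R) (K : R) (m : int) :
  holo f -> (forall z, inD z -> csq (f z) <= K) ->
  cmeasurable T g -> measurable N -> mu N = 0%E ->
  (forall t, T t -> ~ N t -> radlim f t (g t)) -> m < 0 ->
  cint (fun t => g t * cexpi (- (m%:~R) * t)) = 0.
Proof.
move=> hf fK mg mN N0 gl; case: m => // j _.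
rewrite NegzE mulrNz opprK -[j.+1%:~R]/(j.+1%:R).
pose F (n : nat) z := z ^+ n * f z.
have hF n : holo (F n).
  elim: n => [|n ih]; first by rewrite /F; under eq_fun do rewrite expr0 mul1r.
  by rewrite /F; under eq_fun do rewrite exprS -mulrA; exact: holo_mulX.
have D0 : inD (0 : R[i]) by rewrite /inD csq0.
have e1 t : T t -> csq (cexpi (j.+1%:R * t)) <= 1 by rewrite csq_cexpi.
have cv := radial_cint_cvg hf fK mg mN N0 gl (@cmeasurable_cexpi R T j.+1%:R) e1.
apply: (ccvg_unique cv); under eq_fun => p.
  rewrite (_ : cint _ = 0); first by over.
  have r0 : Complex (rad p) 0 ^+ j.+1 != 0 :> R[i].
    by rewrite expf_neq0// -csq_gt0 csq_real exprn_gt0// rad_gt0.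
  apply: (mulfI r0); rewrite mulr0.
  have := cauchy_circle (hF j.+1) (rad_gt0 p) (rad_lt1 p) D0.
  rewrite {2}/F mulr0 expr0n mul0r => h0; rewrite -[RHS]h0 -cintZ.
    congr cint; apply/funext => t.
    by rewrite /F /kern mul0r subr0 invr1 mulr1 exprMn cexpi_nat; ring.
  apply: (@cintegrable_bounded _ _ mT lebesgue_Tset_fin _ K).
    apply: cmeasurableM; last exact: cmeasurable_cexpi.
    by apply: ccont_meas => t; apply: ccont_circle => //; [exact/ltW/rad_gt0|exact: rad_lt1].
  move=> t _; rewrite csqM csq_cexpi mulr1; apply: fK.
  by apply: inD_circle; [exact/ltW/rad_gt0|exact: rad_lt1].
exact: ccvg_cst.
Qed.

End BoundaryValues.

(** * Bounded analytic multipliers of H^2 *)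

Section Multipliers.
Context {R : realType}.
Local Notation mu := (@lebesgue_measure R).
Local Notation T := (@Tset R).
Local Notation mT := (@measurable_Tset R).
Implicit Types (a b : R -> R[i]).

(* Boundary functions of bounded analytic functions on the disc. *)
Definition Hi a := [/\ cmeasurable T a, exists K, forall t, T t -> csq (a t) <= K &
  forall m : int, m < 0 -> cint (fun t => a t * cexpi (- (m%:~R) * t)) = 0].

Lemma mulmx_entry p q (M : R -> 'M[R[i]]_(p, q)) (X : R -> 'cV[R[i]]_q) t i :
  (M t *m X t) i 0 = \sum_j M t i j * X t j 0.
Proof. by rewrite mxE. Qed.

Lemma L2_mulmx p q (M : R -> 'M[R[i]]_(p, q)) (X : R -> 'cV[R[i]]_q) :
  (forall i j, cmeasurable T (fun t => M t i j)) ->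
  (forall i j, exists K, forall t, T t -> csq (M t i j) <= K) ->
  L2 X -> L2 (fun t => M t *m X t).
Proof.
move=> mM bM /L2P X2; apply/L2P => i; under eq_fun do rewrite mulmx_entry.
apply: sqi_sum => j; have [K hK] := bM i j.
by apply: (sqi_mulb _ hK).
Qed.

(** The m-th coefficient of row i of M X is the inner product of X with G = conj(M_ij) e^{imt}. The
    l-th coefficient of G is the conjugate of the (m - l)-th one of M_ij, which vanishes for m < 0
    <= l; so G is orthogonal to H^2. *)
Lemma H2_mulmx p q (M : R -> 'M[R[i]]_(p, q)) (X : R -> 'cV[R[i]]_q) :
  (forall i j, Hi (fun t => M t i j)) -> H2 X -> H2 (fun t => M t *m X t).
Proof.
move=> HM hX; have X2 := H2_L2 hX.
have mM i j : cmeasurable T (fun t => M t i j) by have [] := HM i j.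
have bM i j : exists K, forall t, T t -> csq (M t i j) <= K by have [] := HM i j.
apply/H2P; split=> [|m i m0]; first exact: L2_mulmx.
pose G t : 'cV[R[i]]_q := \col_j (conjc (M t i j) * cexpi (m%:~R * t)).
have G2 : L2 G.
  apply/L2P => j; under eq_fun do rewrite mxE.
  have [K hK] := bM i j; apply: (@sqi_bounded _ _ K).
    by apply: cmeasurableM; [exact: cmeasurable_conj|exact: cmeasurable_cexpi].
  by move=> t Tt; rewrite csqM csq_conj csq_cexpi mulr1 hK.
have -> : inner (fun t => M t *m X t) (etrig m i) = inner X G.
  rewrite -fourierE mxE /inner; congr cint; apply/funext => t.
  rewrite mulmx_entry mulr_suml; apply: eq_bigr => j _.
  by rewrite mxE conjcM conjcK -cexpiN mulNr; ring.
apply: H2_orth => // l l0; apply/matrixP => j j'; rewrite (ord1 j') !mxE.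
have ml : m - l < 0 by rewrite subr_lt0; exact: lt_le_trans l0.
have [mj [K hK] /(_ _ ml) z] := HM i j.
have ic : cintegrable T (fun t => M t i j * cexpi (- ((m - l)%:~R) * t)).
  apply: (@cintegrable_bounded _ _ mT lebesgue_Tset_fin _ K).
    by apply: cmeasurableM => //; exact: cmeasurable_cexpi.
  by move=> t Tt; rewrite csqM csq_cexpi mulr1 hK.
have := congr1 conjc z; rewrite conjc0 => <-.
rewrite -cint_conj//; congr cint; apply/funext => t; rewrite mxE conjcM -mulrA; congr (_ * _).
by rewrite -cexpiD -cexpiN intrB; congr cexpi; ring.
Qed.

Definition sc a : R -> 'cV[R[i]]_1 := fun t => (a t)%:M.

Lemma scE a t i : sc a t i 0 = a t.
Proof. by rewrite (ord1 i) !mxE. Qed.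

Lemma sc_L2 a : sqi a -> L2 (sc a).
Proof. by move=> sa; apply/L2P => i; under eq_fun do rewrite scE. Qed.

Lemma scB a b : sc a - sc b = sc (fun t => a t - b t).
Proof. by apply/funext => t; apply/matrixP => i j; rewrite (ord1 j) !fctE !mxE (ord1 i). Qed.

Lemma Hi_sqi a : Hi a -> sqi a.
Proof. by move=> [ma [K hK] _]; exact: sqi_bounded hK. Qed.

Lemma sc_H2 a : Hi a -> H2 (sc a).
Proof.
move=> ha; have [ma [K hK] a0] := ha; split; first exact/sc_L2/Hi_sqi.
move=> m m0; apply/matrixP => i j; rewrite (ord1 j) !mxE -[RHS](a0 m m0).
by congr cint; apply/funext => t; rewrite scE.
Qed.

Lemma H2_Hi a : cmeasurable T a -> (exists K, forall t, T t -> csq (a t) <= K) ->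
  H2 (sc a) -> Hi a.
Proof.
move=> ma ba [_ a0]; split=> // m m0; have /matrixP/(_ 0 0) := a0 m m0.
by rewrite !mxE => e; rewrite -[RHS]e; congr cint; apply/funext => t; rewrite scE.
Qed.

Lemma HiM a b : Hi a -> Hi b -> Hi (fun t => a t * b t).
Proof.
move=> ha hb; have [ma [K hK] _] := ha; have [mb [L hL] _] := hb.
apply: H2_Hi; first exact: cmeasurableM.
  by exists (K * L) => t Tt; rewrite csqM ler_pM ?csq_ge0 ?hK ?hL.
have := @H2_mulmx 1 1 (sc a) (sc b) _ (sc_H2 hb).
rewrite (_ : (fun t => sc a t *m sc b t) = sc (fun t => a t * b t)); last first.
  by apply/funext => t; rewrite /sc -scalar_mxM.
by apply=> i j; rewrite (ord1 j); under eq_fun do rewrite scE.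
Qed.

Lemma HiD a b : Hi a -> Hi b -> Hi (fun t => a t + b t).
Proof.
move=> ha hb; have [ma [K hK] _] := ha; have [mb [L hL] _] := hb.
apply: H2_Hi; first exact: cmeasurableD.
  exists (2 * (K + L)) => t Tt; apply: le_trans (csqD_le _ _) _.
  by rewrite ler_pM2l// lerD ?hK ?hL.
have := H2D (sc_H2 ha) (sc_H2 hb); congr H2.
by apply/funext => t; apply/matrixP => i j; rewrite (ord1 j) !fctE !mxE (ord1 i).
Qed.

Lemma Hi_cexpi (m : nat) c : Hi (fun t => c * cexpi (m%:R * t)).
Proof.
apply: H2_Hi.
- by apply: cmeasurableM; [exact: cmeasurable_cst|exact: cmeasurable_cexpi].
- by exists (csq c) => t _; rewrite csqM csq_cexpi mulr1.
have := H2Z c (@H2_etrig R 1 m 0); congr H2; apply/funext => t.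
by apply/matrixP => i j; rewrite (ord1 j) (ord1 i) !fctE mxE etrigE eqxx scE.
Qed.

Lemma Hi_cst c : Hi (fun=> c).
Proof.
by have := Hi_cexpi 0 c; under eq_fun do rewrite mul0r cexpi0 mulr1.
Qed.

Lemma Hi_sum (I : Type) (r : seq I) (P : pred I) (F : I -> R -> R[i]) :
  (forall i, Hi (F i)) -> Hi (fun t => \sum_(i <- r | P i) F i t).
Proof.
move=> mF; elim: r => [|i r ih].
  by under eq_fun do rewrite big_nil; exact: Hi_cst.
case Pi: (P i); first by under eq_fun do rewrite big_cons Pi; exact: HiD.
by under eq_fun do rewrite big_cons Pi.
Qed.

Lemma Hi_prod (I : Type) (r : seq I) (P : pred I) (F : I -> R -> R[i]) :
  (forall i, Hi (F i)) -> Hi (fun t => \prod_(i <- r | P i) F i t).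
Proof.
move=> mF; elim: r => [|i r ih].
  by under eq_fun do rewrite big_nil; exact: Hi_cst.
case Pi: (P i); first by under eq_fun do rewrite big_cons Pi; exact: HiM.
by under eq_fun do rewrite big_cons Pi.
Qed.

Lemma Hi_det n (M : R -> 'M[R[i]]_n) : (forall i j, Hi (fun t => M t i j)) ->
  Hi (fun t => \det (M t)).
Proof.
move=> hM; apply: Hi_sum => s; apply: HiM; first exact: Hi_cst.
by apply: Hi_prod.
Qed.

Lemma Hi_cofactor n (M : R -> 'M[R[i]]_n) i j : (forall i j, Hi (fun t => M t i j)) ->
  Hi (fun t => cofactor (M t) i j).
Proof.
move=> hM; apply: HiM; first exact: Hi_cst.
by apply: Hi_det => k l; under eq_fun do rewrite !mxE.
Qed.

Lemma Hi_adj n (M : R -> 'M[R[i]]_n) : (forall i j, Hi (fun t => M t i j)) ->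
  forall i j, Hi (fun t => (\adj (M t)) i j).
Proof. by move=> hM i j; under eq_fun do rewrite mxE; exact: Hi_cofactor. Qed.

Lemma Hi_apoly k (P : R -> 'cV[R[i]]_k) i : apoly P -> Hi (fun t => P t i 0).
Proof.
elim=> [|c m j Q _ ih]; first by under eq_fun do rewrite mxE; exact: Hi_cst.
under eq_fun do rewrite !fctE !mxE.
apply: HiD => //; have := Hi_cexpi m (c * (((i == j) && (0 == 0 :> 'I_1))%:R)).
by congr Hi; apply/funext => t; rewrite mulrA [c * _ * _]mulrAC.
Qed.

Lemma L2norm2_le p q (C : R) (F : R -> 'cV[R[i]]_p) (G : R -> 'cV[R[i]]_q) :
  L2 F -> L2 G ->
  (forall t, T t -> msq (F t) <= C * msq (G t)) -> L2norm2 F <= C * L2norm2 G.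
Proof.
move=> F2 G2 le; rewrite /L2norm2 mulrA ler_pM2r ?invr_gt0 ?twopi_gt0//.
have [mF /(integrable_msqP mF) iF] := F2; have [mG /(integrable_msqP mG) iG] := G2.
rewrite -RintegralZl//; last exact: mT.
apply: le_Rintegral => //; first exact: mT.
have := integrable_sublin mT C 0 iG iG; congr (_.-integrable _ _).
by apply/funext => t /=; rewrite mul0r addr0.
Qed.

Lemma msq_mulmx_le p q (M : 'M[R[i]]_(p, q)) (v : 'cV[R[i]]_q) (K : R) :
  (forall i j, csq (M i j) <= K) -> msq (M *m v) <= (p * q)%:R * K * msq v.
Proof.
move=> MK; rewrite msqE.
apply: le_trans (_ : \sum_(i < p) q%:R * (K * msq v) <= _); last first.
  by rewrite sumr_const card_ord -[_ *+ p]mulr_natl natrM !mulrA.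
apply: ler_sum => i _; rewrite mxE; apply: le_trans (csq_sum_le _) _.
rewrite card_ord ler_wpM2l// msqE mulr_sumr; apply: ler_sum => j _.
by rewrite csqM ler_wpM2r ?csq_ge0.
Qed.

End Multipliers.

(** * Division by an outer matrix function *)

Section OuterDeterminant.
Context {R : realType} (n : nat).
Local Notation T := (@Tset R).
Local Notation mT := (@measurable_Tset R).
Variables (A : R -> 'M[R[i]]_n) (K : R).
Hypothesis HA : forall i j, Hi (fun t => A t i j).
Hypothesis AK : forall t i j, csq (A t i j) <= K.
Hypothesis outerA : forall G : R -> 'cV[R[i]]_n, H2 G -> forall e : R, 0 < e ->
  exists X, H2 X /\ L2norm2 (fun t => G t - A t *m X t) < e.

Let H2_A X : H2 X -> H2 (fun t => A t *m X t).
Proof. exact: H2_mulmx. Qed.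

(** Polynomials are bounded, unlike general elements of H^2: the determinants and cofactors formed
    from the columns A p_j stay in H^infty. *)
Lemma outer_apoly j (e : R) : 0 < e ->
  exists P, apoly P /\ L2norm2 (etrig 0 j - (fun t => A t *m P t)) < e.
Proof.
move=> e0; have e4 : 0 < e / 4 by rewrite divr_gt0.
have [X [hX lX]] := outerA (H2_etrig 0 j) e4.
pose C : R := (n * n)%:R * `|K| + 1.
have C0 : 0 < C by rewrite ltr_wpDl// mulr_ge0.
have eC : 0 < e / (4 * C) by rewrite divr_gt0// mulr_gt0.
have [P aP lP] := H2_approx hX eC.
exists P; split=> //.
have hP := apoly_H2 aP.
have l1 : L2 (etrig 0 j : R -> 'cV[R[i]]_n) := L2_etrig _ _.
have l2 := H2_L2 (H2_A hX); have l3 := H2_L2 (H2_A hP).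
apply: le_lt_trans (L2norm2_tri l1 l2 l3) _.
have h : L2norm2 ((fun t => A t *m X t) - (fun t => A t *m P t)) <= C * L2norm2 (X - P).
  apply: L2norm2_le; [exact: L2B|by apply: L2B; exact: H2_L2|].
  move=> t _; rewrite !fctE -mulmxBr.
  apply: le_trans (msq_mulmx_le (K := K) _ _) _ => //.
  by rewrite ler_wpM2r ?msq_ge0// /C; have := ler_norm K; have : (0 : R) <= (n * n)%:R by []; nra.
have h2 : C * L2norm2 (X - P) < e / 4.
  by move: lP; rewrite invfM mulrA ltr_pdivlMr// mulrC.
move: lX h h2; rewrite -[(fun t => _ - _)]/(etrig 0 j - (fun t => A t *m X t)).
set x := L2norm2 _; set y := L2norm2 _; set z := C * _ => lX h h2; lra.
Qed.

Let delta t := \det (A t).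
Let HD : Hi delta := Hi_det HA.

(* Membership in the L2-closure of det A * H^infty. *)
Let clos (g : R -> R[i]) := forall e : R, 0 < e -> exists2 q, Hi q &
  L2norm2 (sc (fun t => g t - delta t * q t)) < e.

Let Cmx (k : nat) (P : 'I_n -> R -> 'cV[R[i]]_n) t : 'M[R[i]]_n :=
  \matrix_(i, j) if (j < k)%N then (i == j)%:R else (A t *m P j t) i 0.

Let Hi_Cmx k P i j : (forall j, apoly (P j)) -> Hi (fun t => Cmx k P t i j).
Proof.
move=> aP; case jk: (j < k)%N; under eq_fun do rewrite mxE jk.
  exact: Hi_cst.
under eq_fun do rewrite mulmx_entry.
by apply: Hi_sum => l; apply: HiM => //; exact: Hi_apoly.
Qed.

(* The columns of the identity are replaced one at a time by columns A p_j close
   to them; at k = 0 the determinant is det A * det (p_j), at k = n it is 1. *)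
Let clos_Cmx k P : (k <= n)%N -> (forall j, apoly (P j)) ->
  clos (fun t => \det (Cmx k P t)).
Proof.
elim: k P => [|k ih] P kn aP e e0.
  exists (fun t => \det (\matrix_(i, j) (P j t i 0))).
    by apply: Hi_det => i j; under eq_fun do rewrite mxE; exact: Hi_apoly.
  rewrite (_ : sc _ = 0) ?L2norm2_0//; apply/funext => t; apply/matrixP => i j.
  rewrite (ord1 j) scE mxE /delta -det_mulmx (_ : Cmx 0 P t = A t *m \matrix_(i, j) P j t i 0).
    by rewrite subrr.
  by apply/matrixP => a b; rewrite !mxE; apply: eq_bigr => c _; rewrite mxE.
pose j0 := Ordinal kn.
(* The cofactors along column [j0] do not involve that column. They are bounded before [p] is
   chosen, so [p] can be taken accurate enough to make the change of the determinant small. *)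
have bC i : exists L, forall t, T t -> csq (cofactor (Cmx k.+1 P t) i j0) <= L.
  by have [] := @Hi_cofactor R n (Cmx k.+1 P) i j0 (fun i j => Hi_Cmx k.+1 i j aP).
have /choice[L hL] := bC.
pose M := \sum_i `|L i|.
have M0 : 0 <= M by apply: sumr_ge0.
have LM i : L i <= M by apply: le_trans (ler_norm _) _; rewrite /M (bigD1 i)//= lerDl sumr_ge0.
have e4 : 0 < e / 4 by rewrite divr_gt0.
have C0 : 0 < 4 * (n%:R * M + 1) by rewrite mulr_gt0// ltr_wpDl// mulr_ge0.
have [p [ap lp]] := outer_apoly j0 (divr_gt0 e0 C0).
pose P' j := if j == j0 then p else P j.
have aP' j : apoly (P' j) by rewrite /P'; case: ifP.
have [q hq lq] := ih P' (ltnW kn) aP' _ e4.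
exists q => //.
pose d1 t := \det (Cmx k.+1 P t); pose d2 t := \det (Cmx k P' t).
have cofE t i : cofactor (Cmx k P' t) i j0 = cofactor (Cmx k.+1 P t) i j0.
  congr (_ * \det _); apply/matrixP => a b; rewrite !mxE.
  have bj : lift j0 b != j0 by rewrite eq_sym neq_lift.
  have nk : (lift j0 b == k :> nat) = false by apply: negbTE.
  by rewrite ltnS [in RHS]leq_eqVlt nk /P' (negbTE bj).
have diff t : d1 t - d2 t =
    \sum_i (etrig 0 j0 - (fun t => A t *m p t)) t i 0 * cofactor (Cmx k.+1 P t) i j0.
  rewrite /d1 /d2 !(expand_det_col _ j0) -sumrB; apply: eq_bigr => i _.
  rewrite cofE -mulrBl; congr (_ * _).
  rewrite !mxE /= ltnSn ltnn /P' eqxx.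
  by rewrite mul0r cexpi0 mul1r eqxx andbT.
have H1 : Hi d1 by apply: Hi_det => i j; exact: Hi_Cmx.
have H2' : Hi d2 by apply: Hi_det => i j; exact: Hi_Cmx.
have s1 := sc_H2 H1; have s2 := sc_H2 H2'.
have s3 := sc_H2 (HiM HD hq).
have := L2norm2_tri (H2_L2 s1) (H2_L2 s2) (H2_L2 s3); rewrite !scB => /le_lt_trans; apply.
have h : L2norm2 (sc (fun t => d1 t - d2 t)) <=
    (n%:R * M) * L2norm2 (etrig 0 j0 - (fun t => A t *m p t)).
  apply: L2norm2_le; [by rewrite -scB; apply: L2B; exact: H2_L2|
    by apply: L2B; [exact: L2_etrig|exact/H2_L2/H2_A/apoly_H2]|].
  move=> t Tt; rewrite msqE big_ord1 scE diff.
  apply: le_trans (csq_sum_le _) _; rewrite card_ord -mulrA ler_wpM2l// msqE mulr_sumr.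
  apply: ler_sum => i _; rewrite csqM mulrC ler_wpM2r ?csq_ge0//.
  exact: le_trans (hL i t Tt) (LM i).
have h2 : (n%:R * M) * L2norm2 (etrig 0 j0 - (fun t => A t *m p t)) <= e / 4.
  move: lp; rewrite invfM mulrA ltr_pdivlMr ?ltr_wpDl ?mulr_ge0//.
  have := L2norm2_ge0 (etrig 0 j0 - (fun t => A t *m p t)).
  set x := L2norm2 _; set y := n%:R * M; move=> x0 lp.
  by move: lp; rewrite mulrDr mulr1 mulrC; lra.
by move: h h2 lq; set x := L2norm2 _; set y := L2norm2 _; set z := _ * y; lra.
Qed.

Lemma outer_det (e : R) : 0 < e -> exists2 q, Hi q &
  L2norm2 (sc (fun t => 1 - \det (A t) * q t)) < e.
Proof.
move=> e0.
have [q hq lq] := @clos_Cmx n (fun=> 0) (leqnn n) (fun=> @apoly0 R n) e e0.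
exists q => //; move: lq; congr (L2norm2 (sc _) < _); apply/funext => t.
rewrite (_ : Cmx n _ t = 1%:M) ?det1//; apply/matrixP => i j.
by rewrite !mxE ltn_ord.
Qed.

(** For q in H^infty, q det A u = q adj(A) (A u) is in H^2. When det A q is close to 1 in L^2 this
    product is close to u only in L^1, but that suffices for each negative Fourier coefficient of u
    to vanish. *)
Lemma outer_division (u : R -> 'cV[R[i]]_n) : L2 u -> H2 (fun t => A t *m u t) -> H2 u.
Proof.
move=> u2 hAu; apply/H2P; split=> // m i m0.
have /L2P/(_ i) ui := u2.
pose w t := conjc (u t i 0 * cexpi (- (m%:~R) * t)).
have sw : sqi w.
  apply: sqi_conj; under eq_fun do rewrite mulrC.
  apply: (@sqi_mulb _ _ _ 1 _ _ ui); first exact: cmeasurable_cexpi.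
  by move=> t _; rewrite csq_cexpi.
have hdu : H2 (fun t => \adj (A t) *m (A t *m u t)).
  by apply: H2_mulmx => // k l; exact: Hi_adj.
apply: (@csq_small_eq0 _ _ (L2norm2 (sc w))) => e e0.
have [q hq lq] := outer_det e0.
have hqdu : H2 (fun t => (q t)%:M *m (\adj (A t) *m (A t *m u t))).
  apply: H2_mulmx => // k l; under eq_fun do rewrite mxE.
  by case: eqP => _ /=; [|under eq_fun do rewrite mulr0n; exact: Hi_cst].
have z : inner (fun t => (q t)%:M *m (\adj (A t) *m (A t *m u t))) (etrig m i) = 0.
  by have /H2P[_] := hqdu; exact.
have sq : sqi (fun t => 1 - \det (A t) * q t).
  apply: Hi_sqi; apply: HiD; [exact: Hi_cst|].
  by have := HiM (Hi_cst (-1)) (HiM HD hq); under eq_fun do rewrite mulN1r.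
have -> : inner u (etrig m i) = inner (sc (fun t => 1 - \det (A t) * q t)) (sc w).
  rewrite -[LHS]subr0 -z -innerBl//; [|exact: H2_L2|exact: L2_etrig].
  rewrite -fourierE mxE /inner; congr cint; apply/funext => t.
  rewrite big_ord1 !scE conjcK !fctE [\adj _ *m _]mulmxA mul_adj_mx !mul_scalar_mx !mxE.
  ring.
apply: le_trans (Cauchy_Schwarz (sc_L2 sq) (sc_L2 sw)) _.
by rewrite ler_wpM2r ?L2norm2_ge0// ltW.
Qed.

End OuterDeterminant.

(** * The model space of H(B) *)

Section ColumnBlocks.
Context {R : realType} (p q : nat).
Local Notation T := (@Tset R).
Local Notation mT := (@measurable_Tset R).

Definition colf (F : R -> 'cV[R[i]]_p) (G : R -> 'cV[R[i]]_q) : R -> 'cV[R[i]]_(p + q) :=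
  fun t => col_mx (F t) (G t).

Lemma L2_colf F G : L2 F -> L2 G -> L2 (colf F G).
Proof.
move=> /L2P F2 /L2P G2; apply/L2P => i; rewrite /colf.
case: (splitP i) => j ij.
  have -> : i = lshift q j by exact/val_inj.
  by under eq_fun do rewrite col_mxEu.
have -> : i = rshift p j by exact/val_inj.
by under eq_fun do rewrite col_mxEd.
Qed.

Lemma inner_colf F G F' G' : L2 F -> L2 G -> L2 F' -> L2 G' ->
  inner (colf F G) (colf F' G') = inner F F' + inner G G'.
Proof.
move=> F2 G2 F'2 G'2; rewrite !innerE//; try exact: L2_colf.
rewrite big_split_ord /colf /=; congr (_ + _); apply: eq_bigr => i _; congr cint;
  apply/funext => t; by rewrite ?col_mxEu ?col_mxEd.
Qed.

Lemma L2norm2_colf F G : L2 F -> L2 G -> L2norm2 (colf F G) = L2norm2 F + L2norm2 G.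
Proof. by move=> F2 G2; rewrite !L2norm2E inner_colf// creD. Qed.

Lemma fourier_colf F G m : fourier (colf F G) m = col_mx (fourier F m) (fourier G m).
Proof.
apply/matrixP => i j; rewrite (ord1 j) mxE /colf.
case: (splitP i) => k ik.
  have -> : i = lshift q k by exact/val_inj.
  by rewrite col_mxEu mxE; under eq_fun do rewrite col_mxEu.
have -> : i = rshift p k by exact/val_inj.
by rewrite col_mxEd mxE; under eq_fun do rewrite col_mxEd.
Qed.

Lemma H2_colf F G : H2 F -> H2 G -> H2 (colf F G).
Proof.
move=> [F2 F0] [G2 G0]; split=> [|m m0]; first exact: L2_colf.
by rewrite fourier_colf F0// G0// col_mx0.
Qed.

Lemma H2_colfP (W : R -> 'cV[R[i]]_(p + q)) : H2 W -> exists F G, [/\ H2 F, H2 G & W = colf F G].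
Proof.
move=> hW; have [/L2P W2 W0] := hW.
pose F t := usubmx (W t); pose G t := dsubmx (W t).
have WE : W = colf F G by apply/funext => t; rewrite /colf vsubmxK.
have F2 : L2 F.
  by apply/L2P => i; have := W2 (lshift q i); congr sqi; apply/funext => t; rewrite mxE.
have G2 : L2 G.
  by apply/L2P => i; have := W2 (rshift p i); congr sqi; apply/funext => t; rewrite mxE.
have sp m : m < 0 -> fourier F m = 0 /\ fourier G m = 0.
  by move=> /W0; rewrite WE fourier_colf -[RHS]col_mx0 => /eq_col_mx.
by exists F, G; split=> //; split=> // m /sp[].
Qed.

End ColumnBlocks.

Section InnerMultiplication.
Context {R : realType}.
Local Notation T := (@Tset R).

Lemma inner_mulmx p q (M : R -> 'M[R[i]]_(p, q)) (X : R -> 'cV[R[i]]_q) (W : R -> 'cV[R[i]]_p) :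
  inner (fun t => M t *m X t) W = inner X (fun t => adjmx (M t) *m W t).
Proof.
rewrite /inner; congr cint; apply/funext => t.
under eq_bigr => i _ do rewrite mxE mulr_suml.
rewrite exchange_big /=; apply: eq_bigr => j _.
rewrite mxE conjc_sum mulr_sumr; apply: eq_bigr => i _.
by rewrite !mxE conjcM conjcK; ring.
Qed.

Lemma L2norm2_eq p (F G : R -> 'cV[R[i]]_p) : L2 F -> L2 G -> L2norm2 (F - G) = 0 ->
  L2norm2 F = L2norm2 G.
Proof.
move=> F2 G2 h; rewrite !L2norm2E (inner_norm0B F2 G2 F2 h).
by rewrite (inner_conj F2 G2) (inner_norm0B F2 G2 G2 h) inner_self cre_conj.
Qed.

End InnerMultiplication.

(** * Szego kernels and point evaluations on H^2 *)

Section PointEvaluation.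
Context {R : realType}.
Local Notation T := (@Tset R).
Local Notation mT := (@measurable_Tset R).
Implicit Types (la z : R[i]).

(* The Szego kernel at la; kern la is its complex conjugate. *)
Definition kb la (t : R) : R[i] := conjc (kern la t).

Lemma kernE la t : kern la t = 1 + la * (conjc (cexpi t) * kern la t) \/ ~ inD la.
Proof.
have [l1|l1] := pselect (inD la); [left|by right].
by have h := kern_den_neq0 t l1; rewrite /kern; field.
Qed.

Lemma Hi_kb la : inD la -> Hi (kb la).
Proof.
move=> l1; split.
- by apply: cmeasurable_conj; exact: cmeasurable_kern.
- by exists (kern_bound la) => t _; rewrite csq_conj csq_kern_le.
move=> m m0; have := congr1 conjc (cint_kern m l1); case: m m0 => // m _.
rewrite conjc0 => <-; rewrite -cint_conj.
  by congr cint; apply/funext => t; rewrite conjcM mulNr cexpiN mulrC.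
apply: (@cintegrable_bounded _ _ mT lebesgue_Tset_fin _ (kern_bound la)).
  by apply: cmeasurableM; [exact: cmeasurable_cexpi|exact: cmeasurable_kern].
by move=> t _; rewrite csqM csq_cexpi mul1r csq_kern_le.
Qed.

Lemma extE (F : R -> 'cV[R[i]]_1) z : ext F z = inner F (sc (kb z)).
Proof.
rewrite /ext /inner; congr cint; apply/funext => t.
by rewrite big_ord1 scE conjcK.
Qed.

(* A bounded analytic multiplier acts at the point la as its value there:
   (b - b la) * kern la is antianalytic up to complex conjugation. *)
Lemma cint_mul_kern n (b : R -> R[i]) (bla : R[i]) la (X : R -> 'cV[R[i]]_n) j :
  inD la -> Hi b -> cint (fun t => b t * kern la t) = bla -> H2 X ->
  cint (fun t => b t * X t j 0 * kern la t) = bla * cint (fun t => X t j 0 * kern la t).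
Proof.
move=> l1 hb bE hX; have [mb [K hK] b0] := hb; have X2 := H2_L2 hX.
have mk := cmeasurable_kern l1.
have ibd (h : R -> R[i]) L : cmeasurable T h -> (forall t, T t -> csq (h t) <= L) ->
    cintegrable T h by exact: (@cintegrable_bounded _ _ mT lebesgue_Tset_fin).
have ibk (l : nat) : cintegrable T (fun t => cexpi (l%:R * t) * (b t * kern la t)).
  apply: (ibd _ (K * kern_bound la)).
    by apply: cmeasurableM; [exact: cmeasurable_cexpi|exact: cmeasurableM].
  by move=> t Tt; rewrite !csqM csq_cexpi mul1r ler_pM ?csq_ge0 ?csq_kern_le ?hK.
have ib (l : nat) : cintegrable T (fun t => b t * cexpi (l%:R * t)).
  apply: (ibd _ K); first by apply: cmeasurableM; [|exact: cmeasurable_cexpi].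
  by move=> t Tt; rewrite csqM csq_cexpi mulr1 hK.
(* The recurrence of [cint_kern]; at each step the integral of b e^{i(l+1)t} drops out because b has
   no negative coefficients. *)
have bk (l : nat) : cint (fun t => cexpi (l%:R * t) * (b t * kern la t)) = la ^+ l * bla.
  elim: l => [|l ih].
    by rewrite expr0 mul1r -bE; congr cint; apply/funext => t; rewrite mul0r cexpi0 mul1r.
  have bz : cint (fun t => b t * cexpi (l.+1%:R * t)) = 0.
    have := b0 (Negz l) isT; congr (_ = _); congr cint; apply/funext => t.
    by rewrite NegzE mulrNz opprK.
  have ilk := ibk l; have izk := cintegrableZ mT la ilk.
  rewrite exprS -mulrA -ih -[RHS]add0r -{1}bz -cintZ// -cintD//.
  congr cint; apply/funext => t.
  have e : cexpi (l%:R * t) = cexpi (l.+1%:R * t) * conjc (cexpi t).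
    by rewrite -cexpiN -cexpiD -natr1; congr cexpi; ring.
  have [k|//] := kernE la t.
  by rewrite {1}k e; ring.
(* The l-th coefficient of G, for l >= 0, is the conjugate of la^l bla - bla la^l = 0, so G is
   orthogonal to H^2. *)
pose G t : 'cV[R[i]]_n := conjc ((b t - bla) * kern la t) *: delta_mx j 0.
have GE t i : G t i 0 = if i == j then conjc ((b t - bla) * kern la t) else 0.
  by rewrite /G !mxE andbT; case: eqP => _; rewrite ?mulr1 ?mulr0.
have mbk : cmeasurable T (fun t => (b t - bla) * kern la t).
  by apply: cmeasurableM => //; exact: (cmeasurableD mb (@cmeasurable_cst R T (- bla))).
have bbk t : T t -> csq ((b t - bla) * kern la t) <= (2 * (K + csq bla)) * kern_bound la.
  move=> Tt; rewrite csqM ler_pM ?csq_ge0 ?csq_kern_le//.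
  by apply: le_trans (csqB_le _ _) _; rewrite ler_pM2l// lerD2r hK.
have G2 : L2 G.
  apply/L2P => i; under eq_fun do rewrite GE; case: eqP => _; last exact: sqi0.
  by apply: sqi_conj; apply: (sqi_bounded mbk bbk).
have z : inner X G = 0.
  apply: H2_orth => // -[l|//] _; apply/matrixP => i i'; rewrite (ord1 i') !mxE.
  under eq_fun do rewrite GE.
  case: eqP => [_|_]; last first.
    by under eq_fun do rewrite mul0r; exact: cint0.
  have ek : cintegrable T (fun t => cexpi (l%:R * t) * kern la t).
    apply: (ibd _ (kern_bound la)).
      by apply: cmeasurableM; [exact: cmeasurable_cexpi|].
    by move=> t _; rewrite csqM csq_cexpi mul1r csq_kern_le.
  have ilk := ibk l; have izk := cintegrableZ mT (- bla) ek.
  have c0 : cint (fun t => cexpi (l%:R * t) * (b t * kern la t) +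
      (- bla) * (cexpi (l%:R * t) * kern la t)) = 0.
    by rewrite cintD// cintZ// bk (cint_kern (Posz l) l1); ring.
  have := congr1 conjc c0; rewrite conjc0 => <-; rewrite -cint_conj; last exact: (cintegrableD mT).
  congr cint; apply/funext => t; rewrite mulNr cexpiN -conjcM; congr conjc.
  by rewrite -pmulrn; ring.
have iX : cintegrable T (fun t => X t j 0 * kern la t).
  apply: cintegrable_sqiM; first by have /L2P := X2; exact.
  by apply: (sqi_bounded mk) => t _; exact: csq_kern_le.
have iXb : cintegrable T (fun t => X t j 0 * ((b t - bla) * kern la t)).
  by apply: cintegrable_sqiM; [have /L2P := X2; exact|apply: (sqi_bounded mbk bbk)].
apply/eqP; rewrite -subr_eq0; apply/eqP; rewrite -z /inner.
have izX := cintegrableZ mT bla iX.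
rewrite -cintZ// (_ : (fun t => b t * _ * _) = (fun t => X t j 0 * ((b t - bla) * kern la t) +
    bla * (X t j 0 * kern la t))); last by apply/funext => t; ring.
rewrite cintD// addrK; congr cint; apply/funext => t.
rewrite (bigD1 j)//= big1 ?addr0 => [|i /negbTE ij].
  by rewrite GE eqxx conjcK.
by rewrite GE ij conjc0 mulr0.
Qed.

(** [kb la] is the inverse of the analytic function b = 1 - conj(la) e^{it}. Evaluating b kb = 1 at
    z by [cint_mul_kern] gives 1 = b(z) times the integral. *)
Lemma cint_kb_kern la z : inD la -> inD z ->
  cint (fun t => kb la t * kern z t) = (1 - z * conjc la)^-1.
Proof.
move=> l1 z1.
pose b t : R[i] := 1 + (- conjc la) * cexpi t.
have hb : Hi b.
  apply: HiD; first exact: Hi_cst.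
  by have := Hi_cexpi 1 (- conjc la); under eq_fun do rewrite mul1r.
have k1 : cint (kern z) = 1.
  have := cint_kern (Posz 0) z1; rewrite expr0 => <-; congr cint; apply/funext => t.
  by rewrite mul0r cexpi0 mul1r.
have ik : cintegrable T (kern z).
  apply: (@cintegrable_bounded _ _ mT lebesgue_Tset_fin _ (kern_bound z)).
    exact: cmeasurable_kern.
  by move=> t _; exact: csq_kern_le.
have ik1 : cintegrable T (fun t => cexpi t * kern z t).
  apply: (@cintegrable_bounded _ _ mT lebesgue_Tset_fin _ (kern_bound z)).
    apply: cmeasurableM; last exact: cmeasurable_kern.
    by have := @cmeasurable_cexpi R T 1; under eq_fun do rewrite mul1r.
  by move=> t _; rewrite csqM csq_cexpi mul1r csq_kern_le.
have k2 : cint (fun t => cexpi t * kern z t) = z.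
  have := cint_kern (Posz 1) z1; rewrite expr1 => h; rewrite -[RHS]h; congr cint; apply/funext => t.
  by rewrite mul1r.
have bE : cint (fun t => b t * kern z t) = 1 - z * conjc la.
  rewrite (_ : (fun t => _) = (fun t => kern z t + (- conjc la) * (cexpi t * kern z t))).
    by rewrite cintD ?cintZ ?k1 ?k2//; [ring|exact: (cintegrableZ mT)].
  by apply/funext => t; rewrite /b; ring.
have := cint_mul_kern 0 z1 hb bE (sc_H2 (Hi_kb l1)).
have -> : (fun t => sc (kb la) t 0 0 * kern z t) = (fun t => kb la t * kern z t).
  by apply/funext => t; rewrite scE.
have -> : (fun t => b t * sc (kb la) t 0 0 * kern z t) = kern z.
  apply/funext => t; rewrite scE (_ : b t * kb la t = 1) ?mul1r//.
  have h : 1 - conjc la * cexpi t != 0.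
    have := kern_den_neq0 t l1; rewrite -conjc_eq0 conjcB conjcM conjcK.
    by rewrite conjc1.
  rewrite /b /kb /kern conjc_inv conjcB conjcM conjcK conjc1 mulNr.
  by rewrite divff.
rewrite k1 => e.
have d0 : 1 - z * conjc la != 0.
  apply/eqP => d0; move: e; rewrite d0 mul0r => /eqP; exact/negP/oner_neq0.
by apply: (mulfI d0); rewrite -e divff.
Qed.

Lemma csq_ext_le (F : R -> 'cV[R[i]]_1) z : L2 F -> inD z ->
  csq (ext F z) <= L2norm2 F * kern_bound z.
Proof.
move=> F2 z1; rewrite extE.
have sk : sqi (kb z) by apply/Hi_sqi/Hi_kb.
apply: le_trans (Cauchy_Schwarz F2 (sc_L2 sk)) _.
rewrite ler_wpM2l ?L2norm2_ge0//.
have s1 : L2norm2 (sc (fun=> 1 : R[i])) = 1.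
  rewrite L2norm2E /inner (_ : (fun t : R => _) = (fun t => cexpi (0%:~R * t))).
    by rewrite cint_cexpi.
  by apply/funext => t; rewrite big_ord1 scE conjc1 mulr1 mul0r cexpi0.
rewrite -[leRHS]mulr1 -s1; apply: L2norm2_le; first exact: sc_L2.
  by apply/sc_L2/Hi_sqi; exact: Hi_cst.
move=> t _; rewrite !msqE !big_ord1 !scE csq1 mulr1 csq_conj.
exact: csq_kern_le.
Qed.

Let shift (F : R -> 'cV[R[i]]_1) t : 'cV[R[i]]_1 := conjc (cexpi t) *: F t.

(** Rests on F(z) = F^(0) + z (shift F)(z). Letting z tend to 0 kills the constant; dividing by z
    then gives the vanishing of the shifted function only for z != 0, which is why the hypothesis
    excludes 0 and the statement can be iterated. *)
Lemma backward_shift (F : R -> 'cV[R[i]]_1) : H2 F ->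
  (forall z, inD z -> z != 0 -> ext F z = 0) ->
  [/\ fourier F 0 = 0, H2 (shift F), forall z, inD z -> z != 0 -> ext (shift F) z = 0 &
    forall m, fourier (shift F) m = fourier F (m + 1)].
Proof.
move=> hF hext; have F2 := H2_L2 hF.
have F1E t : shift F t 0 0 = conjc (cexpi t) * F t 0 0 by rewrite mxE.
have mc : cmeasurable T (fun t : R => conjc (cexpi t)).
  apply: cmeasurable_conj.
  by have := @cmeasurable_cexpi R T 1; under eq_fun do rewrite mul1r.
have sF : sqi (fun t => F t 0 0) by have /L2P := F2; exact.
have sF1 : sqi (fun t => shift F t 0 0).
  under eq_fun do rewrite F1E.
  by apply: (@sqi_mulb _ _ _ 1 mc) => // t _; rewrite csq_conj csq_cexpi.
have F12 : L2 (shift F) by apply/L2P => i; rewrite (ord1 i).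
have fE m : fourier (shift F) m = fourier F (m + 1).
  apply/matrixP => i j; rewrite (ord1 j) (ord1 i) !mxE; congr cint.
  apply/funext => t; rewrite F1E mulrAC -cexpiN -cexpiD mulrC; congr (_ * cexpi _).
  by rewrite intrD; ring.
have split0 z : inD z -> ext F z = fourier F 0 0 0 + z * ext (shift F) z.
  move=> z1; rewrite /ext mxE.
  have sk : sqi (kern z).
    apply: (@sqi_bounded _ _ (kern_bound z)); first exact: cmeasurable_kern.
    by move=> t _; exact: csq_kern_le.
  have i1 : cintegrable T (fun t => shift F t 0 0 / (1 - z * conjc (cexpi t))).
    exact: cintegrable_sqiM.
  have i2 : cintegrable T (fun t => F t 0 0 * cexpi (- 0%:~R * t)).
    under eq_fun do rewrite oppr0 mul0r cexpi0 mulr1.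
    exact: cintegrable_sqi.
  have iz1 := cintegrableZ mT z i1.
  rewrite -cintZ// -cintD//; congr cint; apply/funext => t; rewrite F1E oppr0 mul0r cexpi0 mulr1.
  have h := kern_den_neq0 t z1; by field.
have f0 : fourier F 0 0 0 = 0.
  apply: (@csq_small_eq0 _ _ (4 * L2norm2 (shift F))) => e e0.
  (* s <= 1/2 keeps [kern_bound] at most 4, and s <= e gives s^2 <= e. *)
  pose s : R := Num.min 2^-1 e.
  have s0 : 0 < s by rewrite lt_min invr_gt0 ltr0n.
  have s1 : s <= 2^-1 by rewrite ge_min lexx.
  have s2 : s <= e by rewrite ge_min lexx orbT.
  have csq_s : csq (Complex s 0) = s ^+ 2 by rewrite csq_real.
  have sD : inD (Complex s 0) by rewrite /inD csq_s; nra.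
  have sn0 : Complex s 0 != 0 :> R[i] by rewrite -csq_gt0 csq_s exprn_gt0.
  have -> : fourier F 0 0 0 = - (Complex s 0 * ext (shift F) (Complex s 0)).
    by have := split0 _ sD; rewrite (hext _ sD sn0) => /eqP; rewrite eq_sym addr_eq0 => /eqP.
  rewrite csqN csqM csq_s.
  have h1 := csq_ext_le F12 sD.
  have h2 : kern_bound (Complex s 0) <= 4.
    rewrite /kern_bound csq_s sqrtr_sqr gtr0_norm//.
    rewrite -[leRHS]invrK lef_pV2 ?posrE ?invr_gt0 ?exprn_gt0//; [nra|lra].
  have h3 : s ^+ 2 <= e by nra.
  have n0 := L2norm2_ge0 (shift F).
  apply: le_trans (_ : s ^+ 2 * (L2norm2 (shift F) * 4) <= _).
    by rewrite ler_wpM2l ?sqr_ge0//; apply: le_trans h1 _; rewrite ler_wpM2l.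
  by rewrite [_ * 4]mulrC ler_wpM2r// mulr_ge0.
have F0 : fourier F 0 = 0 by apply/matrixP => i j; rewrite (ord1 i) (ord1 j) f0 mxE.
split=> //.
  split=> // m m0; rewrite fE.
  have [->|m1] := eqVneq m (-1); first by rewrite addNr.
  have [_] := hF; apply; rewrite lt_neqAle lezD1 m0 andbT.
  by apply: contra m1 => /eqP h; rewrite -[m](addrK 1) h add0r.
move=> z z1 z0; have := split0 z z1; rewrite (hext z z1 z0) f0 add0r => /esym/eqP.
by rewrite mulf_eq0 (negbTE z0)/= => /eqP.
Qed.

(* Peel off one Fourier coefficient at a time. *)
Lemma ext_eq0_fourier (F : R -> 'cV[R[i]]_1) : H2 F ->
  (forall z, inD z -> z != 0 -> ext F z = 0) -> forall m : int, fourier F m = 0.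
Proof.
move=> hF hext m; have [m0|] := ltP m 0; first by have [_] := hF; exact.
case: m => // m _; elim: m F hF hext => [|m ih] F hF hext.
  by have [] := backward_shift hF hext.
have [_ hF1 hext1 fE] := backward_shift hF hext.
by have := ih _ hF1 hext1; rewrite fE -[m.+1]addn1 PoszD.
Qed.

End PointEvaluation.

Lemma L2norm2_cvg {R : realType} k (F_ : nat -> R -> 'cV[R[i]]_k) (W : R -> 'cV[R[i]]_k) :
  (forall m, L2 (F_ m)) -> L2 W -> cvg2 F_ W -> (fun m => L2norm2 (F_ m)) @ \oo --> L2norm2 W.
Proof.
move=> F2 W2 cv; pose D m := F_ m - W; have D2 m : L2 (D m) by exact: L2B.
have E m : L2norm2 (F_ m) = L2norm2 W + 2 * cre (inner W (D m)) + L2norm2 (D m).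
  have -> : F_ m = W + 1 *: D m by rewrite scale1r addrC subrK.
  by rewrite L2norm2D// csq1 !mul1r conjc1 mul1r.
have w0 := L2norm2_ge0 W.
have [c1 _] : ccvg \oo (fun m => inner W (D m)) 0.
  apply: ccvg_small => e e0; have w1 : 0 < L2norm2 W + 1 by rewrite ltr_wpDl.
  have [N hN] := cv _ (divr_gt0 e0 w1); exists N => // m Nm; rewrite subr0.
  apply: le_lt_trans (Cauchy_Schwarz W2 (D2 m)) _.
  have := hN m Nm; rewrite ltr_pdivlMr// mulrDr mulr1 [X in X + _]mulrC; apply: le_lt_trans.
  by rewrite lerDl L2norm2_ge0.
under eq_fun do rewrite E.
suff : (fun m => L2norm2 W + 2 * cre (inner W (D m)) + L2norm2 (D m)) @ \oo -->
    L2norm2 W + 2 * 0 + 0 by rewrite mulr0 !addr0.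
apply: cvgD.
  by apply: cvgD; [exact: cvg_cst|apply: cvgM; [exact: cvg_cst|exact: c1]].
apply/cvgrPdist_lt => e e0; have [N hN] := cv e e0; exists N => // m Nm.
by rewrite sub0r normrN ger0_norm ?L2norm2_ge0//; exact: hN.
Qed.

Section ModelSpace.
Context {R : realType} (n : nat).
Local Notation T := (@Tset R).
Local Notation mT := (@measurable_Tset R).
Variables (B : R[i] -> 'M[R[i]]_(1, n)) (Bb : R -> 'M[R[i]]_(1, n)) (Ab : R -> 'M[R[i]]_n).
Hypothesis HB : forall i j, Hi (fun t => Bb t i j).
Hypothesis HA : forall i j, Hi (fun t => Ab t i j).
Hypothesis isoBA : forall t, adjmx (Bb t) *m Bb t + adjmx (Ab t) *m Ab t = 1%:M.
Hypothesis outerA : forall G : R -> 'cV[R[i]]_n, H2 G -> forall e : R, 0 < e ->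
  exists X, H2 X /\ L2norm2 (fun t => G t - Ab t *m X t) < e.
Hypothesis cauchyB : forall la, inD la -> forall j, cint (fun t => Bb t 0 j * kern la t) = B la 0 j.

Local Notation V := (R -> 'cV[R[i]]_(1 + n)).
Implicit Types (u : R -> 'cV[R[i]]_n) (W : V).

Definition BA u : V := colf (fun t => Bb t *m u t) (fun t => Ab t *m u t).

Lemma H2_Bb u : H2 u -> H2 (fun t => Bb t *m u t).
Proof. exact: H2_mulmx. Qed.
Lemma H2_Ab u : H2 u -> H2 (fun t => Ab t *m u t).
Proof. exact: H2_mulmx. Qed.
Lemma H2_BA u : H2 u -> H2 (BA u).
Proof. by move=> hu; apply: H2_colf; [exact: H2_Bb|exact: H2_Ab]. Qed.

Lemma inner_BA u v : H2 u -> H2 v -> inner (BA u) (BA v) = inner u v.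
Proof.
move=> hu hv; have v2 := H2_L2 hv.
rewrite inner_colf; try by apply: H2_L2; (exact: H2_Bb || exact: H2_Ab).
rewrite !inner_mulmx /inner.
have cf (p : nat) (M : R -> 'M[R[i]]_(p, n)) : (forall i j, Hi (fun t => M t i j)) ->
    cintegrable T (fun t => \sum_i u t i 0 * conjc ((adjmx (M t) *m (M t *m v t)) i 0)).
  move=> HM; apply: inner_integrable; first exact: H2_L2.
  have h := H2_L2 (H2_mulmx HM hv).
  apply: L2_mulmx => // i j.
    by under eq_fun do rewrite !mxE; apply: cmeasurable_conj; have [] := HM j i.
  have [_ [K hK] _] := HM j i.
  by exists K => t Tt; rewrite !mxE csq_conj hK.
rewrite -cintD; [|exact: cf|exact: cf].
congr cint; apply/funext => t; rewrite -big_split /=; apply: eq_bigr => i _.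
rewrite -mulrDr -conjcD; congr (_ * conjc _).
by rewrite -[v t in RHS]mul1mx -(isoBA t) mulmxDl -!mulmxA [RHS]mxE.
Qed.

(* The orthogonal complement of (B; A) H^2 in H^2 + H^2_{C^n}; projecting to
   the first component identifies it with H(B). *)
Definition model W := H2 W /\ forall u, H2 u -> inner (BA u) W = 0.

Lemma model_lin a W W' : model W -> model W' -> model (a *: W + W').
Proof.
move=> [hW W0] [hW' W'0]; split=> [|u hu]; first exact: H2_lin.
rewrite inner_linr ?W0 ?W'0 ?mulr0 ?addr0//; try exact: H2_L2.
by apply/H2_L2/H2_BA.
Qed.

Lemma model0 : model 0.
Proof. by split=> [|u _]; [exact: H2_0|rewrite inner0r]. Qed.

Lemma model_cvg (F_ : nat -> V) U : (forall p, model (F_ p)) -> L2 U -> cvg2 F_ U -> model U.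
Proof.
move=> mF U2 cv; split=> [|u hu]; first by apply: (H2_cvg _ U2 cv) => p; have [] := mF p.
have F2 p : L2 (F_ p) by apply: H2_L2; have [] := mF p.
have b2 : L2 (BA u) := H2_L2 (H2_BA hu).
rewrite (inner_conj U2 b2) (inner_cvg0 F2 U2 b2 cv) ?conjc0// => p.
by rewrite (inner_conj b2 (F2 p)); have [_ ->] := mF p; rewrite ?conjc0.
Qed.

Let kvec (la : R[i]) : R -> 'cV[R[i]]_n := fun t => adjmx (B la) *m sc (kb la) t.

Let H2_kvec la : inD la -> H2 (kvec la).
Proof.
move=> l1; apply: (@H2_mulmx R n 1 (fun=> adjmx (B la)) (sc (kb la))).
  by move=> i j; exact: Hi_cst.
exact/sc_H2/Hi_kb.
Qed.

(* The element of the model space representing evaluation at la; its first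
   component is the boundary function of the kernel K_B(., la). *)
Definition mker (la : R[i]) : V :=
  if inD la then colf (sc (kb la)) 0 - BA (kvec la) else 0.

(** Pairing (B u, A u) with (k_la, 0) evaluates B u at la, giving B(la) u(la). This is also the
    inner product of u with B(la)^* k_la, which the isometry [inner_BA] turns into the pairing with
    the second term of [mker]. *)
Lemma inner_BA_mker u la : inD la -> H2 u -> inner (BA u) (mker la) = 0.
Proof.
move=> l1 hu; rewrite /mker l1.
have hk := sc_H2 (Hi_kb l1); have hc := H2_kvec l1.
have c2 : L2 (colf (sc (kb la)) (0 : R -> 'cV[R[i]]_n)).
  by apply: L2_colf; [exact: H2_L2|exact: L2_0].
rewrite innerBr//; [|exact/H2_L2/H2_BA|exact/H2_L2/H2_BA].
rewrite inner_BA// inner_colf; [|exact/H2_L2/H2_Bb|exact/H2_L2/H2_Ab|exact: H2_L2|exact: L2_0].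
rewrite inner0r addr0 {1}/inner.
have u2 := H2_L2 hu; have sk : sqi (kern la).
  apply: (@sqi_bounded _ _ (kern_bound la)); first exact: cmeasurable_kern.
  by move=> t _; exact: csq_kern_le.
have iu j : cintegrable T (fun t => Bb t 0 j * u t j 0 * kern la t).
  apply: cintegrable_sqiM => //; have [mb [K hK] _] := HB 0 j.
  by apply: (sqi_mulb mb hK); have /L2P := u2; exact.
have iv j : cintegrable T (fun t => u t j 0 * kern la t).
  by apply: cintegrable_sqiM => //; have /L2P := u2; exact.
have -> : cint (fun t => \sum_i (Bb t *m u t) i 0 * conjc (sc (kb la) t i 0)) =
    \sum_j cint (fun t => Bb t 0 j * u t j 0 * kern la t).
  rewrite -cint_sum//; congr cint; apply/funext => t.
  by rewrite big_ord1 scE conjcK mulmx_entry mulr_suml.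
have -> : inner u (kvec la) = \sum_j B la 0 j * cint (fun t => u t j 0 * kern la t).
  under [RHS]eq_bigr => j _ do rewrite -cintZ//.
  rewrite -cint_sum => [|j]; last exact: (cintegrableZ mT).
  congr cint; apply/funext => t; apply: eq_bigr => j _.
  by rewrite /kvec [X in conjc X]mxE big_ord1 scE conjcM conjcK !mxE conjcK; ring.
apply/eqP; rewrite subr_eq0; apply/eqP; apply: eq_bigr => j _.
by apply: cint_mul_kern => //; exact: cauchyB.
Qed.

(** The value 0 of [mker] outside the disc frees this fact, and [model_mcomb] after it, from side
    conditions on the points. *)
Lemma model_mker la : model (mker la).
Proof.
case l1 : (inD la); last by rewrite /mker l1; exact: model0.
split=> [|u hu]; last exact: inner_BA_mker.
rewrite /mker l1; apply: H2B; last by apply: H2_BA; exact: H2_kvec.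
by apply: H2_colf; [exact/sc_H2/Hi_kb|exact: H2_0].
Qed.

Let top W : R -> 'cV[R[i]]_1 := fun t => usubmx (W t).

Lemma inner_mker W la : inD la -> model W -> inner W (mker la) = ext (top W) la.
Proof.
move=> l1 [hW W0]; rewrite /mker l1; have W2 := H2_L2 hW.
have hk := sc_H2 (Hi_kb l1); have hc := H2_kvec l1.
rewrite innerBr//; [|by apply: L2_colf; [exact: H2_L2|exact: L2_0]|exact/H2_L2/H2_BA].
rewrite (inner_conj (H2_L2 (H2_BA hc)) W2) W0// conjc0 subr0 extE.
have [F [G [hF hG WE]]] := H2_colfP hW.
rewrite {1}WE inner_colf//; [|exact: H2_L2|exact: H2_L2|exact: H2_L2|exact: L2_0].
rewrite inner0r addr0; congr (inner _ _); apply/funext => t.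
by rewrite /top WE /colf col_mxKu.
Qed.

(** By [inner_mker] this is the value at z of k_la - B B(la)^* k_la, and [cint_mul_kern] evaluates
    each product of an entry of B with k_la factor by factor. *)
Lemma inner_mker_mker la z : inD la -> inD z -> inner (mker la) (mker z) = kerB B z la.
Proof.
move=> l1 z1; rewrite inner_mker//; last exact: model_mker.
have hc := H2_kvec l1.
have sk w : inD w -> sqi (kern w).
  move=> w1; apply: (@sqi_bounded _ _ (kern_bound w)); first exact: cmeasurable_kern.
  by move=> t _; exact: csq_kern_le.
have skb w : inD w -> sqi (kb w) by move=> w1; exact: Hi_sqi (Hi_kb w1).
have ik j : cintegrable T (fun t => Bb t 0 j * kb la t * kern z t).
  apply: cintegrable_sqiM; last exact: sk.
  by have [mb [K hK] _] := HB 0 j; apply: (sqi_mulb mb hK); exact: skb.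
have ikk : cintegrable T (fun t => kb la t * kern z t).
  by apply: cintegrable_sqiM; [exact: skb|exact: sk].
have isum : cintegrable T (fun t => \sum_j conjc (B la 0 j) * (Bb t 0 j * kb la t * kern z t)).
  by apply: cintegrable_sum; [exact: mT|move=> j; apply: cintegrableZ; [exact: mT|]].
have topE t : top (mker la) t 0 0 = kb la t - \sum_j Bb t 0 j * (conjc (B la 0 j) * kb la t).
  rewrite /top /mker l1 !fctE /BA /colf /kvec linearB /= !col_mxKu !mxE mulr1n.
  by congr (_ - _); apply: eq_bigr => j _; rewrite !mxE big_ord1 !mxE mulr1n.
rewrite /ext; under eq_fun do rewrite topE.
have -> : cint (fun t => (kb la t - \sum_j Bb t 0 j * (conjc (B la 0 j) * kb la t)) /
    (1 - z * conjc (cexpi t))) = cint (fun t => kb la t * kern z t) -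
    \sum_j conjc (B la 0 j) * cint (fun t => Bb t 0 j * kb la t * kern z t).
  under [X in _ = _ - X]eq_bigr => j _ do rewrite -cintZ//.
  rewrite -cint_sum => [|j]; last exact: (cintegrableZ mT).
  rewrite -cintB//; congr cint; apply/funext => t; rewrite mulrBl; congr (_ - _).
  by rewrite mulr_suml; apply: eq_bigr => j _; rewrite /kern; ring.
have e j : cint (fun t => Bb t 0 j * kb la t * kern z t) = B z 0 j * (1 - z * conjc la)^-1.
  rewrite -cint_kb_kern//; have := cint_mul_kern 0 z1 (HB 0 j) (cauchyB z1 j) (sc_H2 (Hi_kb l1)).
  have -> : (fun t => sc (kb la) t 0 0 * kern z t) = (fun t => kb la t * kern z t).
    by apply/funext => t; rewrite scE.
  by move=> <-; congr cint; apply/funext => t; rewrite scE.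
rewrite cint_kb_kern// /kerB mulrBl mul1r; congr (_ - _).
rewrite mxE mulr_suml; apply: eq_bigr => j _.
by rewrite e !mxE; ring.
Qed.

Definition mcomb (s : seq (R[i] * R[i])) : V := \sum_(p <- s) p.1 *: mker p.2.

Lemma model_mcomb s : model (mcomb s).
Proof.
rewrite /mcomb; elim: s => [|p s ih]; first by rewrite big_nil; exact: model0.
by rewrite big_cons; apply: model_lin => //; exact: model_mker.
Qed.

Let mker2 la : L2 (mker la).
Proof. by apply: H2_L2; have [] := model_mker la. Qed.

Let mcomb2 s : L2 (mcomb s).
Proof. by apply: H2_L2; have [] := model_mcomb s. Qed.

Lemma inner_mcomb_mker s z : all (fun p => inD p.2) s -> inD z ->
  inner (mcomb s) (mker z) = keval B s z.
Proof.
move=> /allP sD z1; rewrite /mcomb inner_suml//; last by move=> p; exact: L2Z.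
rewrite /keval big_seq [RHS]big_seq; apply: eq_bigr => p /sD p1.
by rewrite innerZl// inner_mker_mker.
Qed.

Lemma L2norm2_mcomb s : all (fun p => inD p.2) s -> L2norm2 (mcomb s) = knorm2 B s.
Proof.
move=> sD; rewrite L2norm2E /knorm2; congr cre.
rewrite {1}/mcomb inner_suml//; last by move=> p; exact: L2Z.
rewrite big_seq [RHS]big_seq; apply: eq_bigr => p ps.
rewrite innerZl// {1}/mcomb inner_sumr//; last by move=> q; exact: L2Z.
rewrite mulr_sumr big_seq [RHS]big_seq; apply: eq_bigr => q qs.
rewrite innerZr// inner_mker_mker ?mulrA//; by move/allP: sD; apply.
Qed.

Lemma mcomb_kdiff s s' : mcomb (kdiff s s') = mcomb s - mcomb s'.
Proof.
rewrite /mcomb /kdiff big_cat big_map /= -sumrN; congr (_ + _).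
by apply: eq_bigr => p _; rewrite scaleNr.
Qed.

Lemma all_kdiff s s' : all (fun p => inD p.2) s -> all (fun p => inD p.2) s' ->
  all (fun p : R[i] * R[i] => inD p.2) (kdiff s s').
Proof. by move=> h h'; rewrite all_cat h /= all_map. Qed.

Lemma model_unique W : model W -> (forall z, inD z -> ext (top W) z = 0) -> L2norm2 W = 0.
Proof.
move=> [hW W0] ext0; have [F [G [hF hG WE]]] := H2_colfP hW.
have topE : top W = F by apply/funext => t; rewrite /top WE /colf col_mxKu.
have F2 := H2_L2 hF; have G2 := H2_L2 hG.
have F0 : L2norm2 F = 0.
  apply: fourier_norm0 => //; apply: ext_eq0_fourier => // z z1 _.
  by rewrite -topE ext0.
have AG u : H2 u -> inner (fun t => Ab t *m u t) G = 0.
  move=> hu; have := W0 u hu.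
  rewrite WE inner_colf//; [|exact/H2_L2/H2_Bb|exact/H2_L2/H2_Ab].
  rewrite (inner_conj F2); last exact/H2_L2/H2_Bb.
  by rewrite inner_norm0 ?conjc0 ?add0r//; exact/H2_L2/H2_Bb.
have GG : inner G G = 0.
  apply: inner_approx0 => // e e0; have [X [hX lX]] := outerA hG e0.
  by exists (fun t => Ab t *m X t); split=> //; [exact/H2_L2/H2_Ab|exact: AG].
by rewrite WE L2norm2_colf// F0 add0r L2norm2E GG.
Qed.

Lemma model_dense W : model W -> exists s_ : nat -> seq (R[i] * R[i]),
  (forall m, all (fun p => inD p.2) (s_ m)) /\ cvg2 (fun m => mcomb (s_ m)) W.
Proof.
move=> mW; have W2 := H2_L2 mW.1.
pose S F := exists2 s, all (fun p => inD p.2) s & F = mcomb s.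
have scal a s : mcomb [seq (a * p.1, p.2) | p <- s] = a *: mcomb s.
  by rewrite /mcomb big_map scaler_sumr; apply: eq_bigr => p _; rewrite scalerA.
have [||a F G|F_ [U [SF U2 cv orth]]] := @orthogonal_projection R _ S W _ _ _ W2.
- by move=> F [s _ ->].
- by exists [::] => //; rewrite /mcomb big_nil.
- move=> [s sD ->] [s' sD' ->]; exists ([seq (a * p.1, p.2) | p <- s] ++ s').
    by rewrite all_cat all_map sD'; rewrite andbT.
  by rewrite -scal /mcomb big_cat.
have /choice[s_ s_P] : forall m, exists s, all (fun p => inD p.2) s /\ F_ m = mcomb s.
  by move=> m; have [s sD ->] := SF m; exists s.
have sD m := (s_P m).1; have FE m : F_ m = mcomb (s_ m) := (s_P m).2.
have mU : model U.
  by apply: (model_cvg _ U2 cv) => m; rewrite FE; exact: model_mcomb.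
have mWU : model (W - U).
  by rewrite addrC -scaleN1r; exact: model_lin.
exists s_; split=> // e e0.
have WU0 : L2norm2 (W - U) = 0.
  apply: model_unique => // z z1; rewrite -inner_mker//; apply: orth.
  exists [:: (1, z)]; first by rewrite /= z1.
  by rewrite /mcomb big_seq1 scale1r.
have e2 : 0 < e / 2 by rewrite divr_gt0.
have [N hN] := cv _ e2; exists N => m Nm.
apply: le_lt_trans (L2norm2_tri (mcomb2 _) U2 W2) _.
by rewrite (L2norm2BC U) WU0 addr0 -FE; have := hN m Nm; lra.
Qed.

(** [mcomb] realizes kernel combinations isometrically, so a Cauchy sequence of them has a limit in
    L^2, and this limit is in the closed space [model]. Evaluation at z is the bounded functional
    given by [mker z], hence the limit takes the values of f. *)
Lemma HB_approx_model g f : HB_approx B g f -> exists W, [/\ model W,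
  forall z, inD z -> ext (top W) z = f z &
  (fun m => knorm2 B (g m)) @ \oo --> L2norm2 W].
Proof.
move=> [gD [cauchy pt]].
have [|e e0|W W2 cv] := @L2_complete R _ (fun m => mcomb (g m)).
- by move=> m.
- have [N hN] := cauchy e e0; exists N => p q Np Nq.
  by rewrite -mcomb_kdiff L2norm2_mcomb ?hN//; exact: all_kdiff.
have mW : model W by apply: (model_cvg _ W2 cv) => m; exact: model_mcomb.
exists W; split=> //.
- move=> z z1; apply/eqP; rewrite -subr_eq0; apply/eqP.
  apply: (@csq_small_eq0 _ _ (2 * (L2norm2 (mker z) + 1))) => e e0.
  have [N1 h1] := cv e e0; have [N2 h2] := pt z z1 e e0.
  pose m := (N1 + N2)%N.
  have k1 := h1 m (leq_addr _ _); have k2 := h2 m (leq_addl _ _).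
  rewrite -inner_mker//.
  have -> : inner W (mker z) - f z = - inner (mcomb (g m) - W) (mker z) + (keval B (g m) z - f z).
    by rewrite innerBl// inner_mcomb_mker//; ring.
  apply: le_trans (csqD_le _ _) _; rewrite csqN.
  have := Cauchy_Schwarz (L2B (mcomb2 (g m)) W2) (mker2 z).
  have := L2norm2_ge0 (mker z); move: k1 k2.
  set a := L2norm2 _; set b := csq _; set c := L2norm2 _; set d := csq _.
  clearbody a b c d; nra.
- have := L2norm2_cvg (fun m => mcomb2 (g m)) W2 cv.
  by under eq_fun do rewrite L2norm2_mcomb//.
Qed.

Lemma model_inHB W f : model W -> (forall z, inD z -> ext (top W) z = f z) -> inHB B f.
Proof.
move=> mW Wf; have W2 := H2_L2 mW.1.
have [s_ [sD cv]] := model_dense mW.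
exists s_; split=> //; split=> [e e0|z z1 e e0].
  have e4 : 0 < e / 4 by rewrite divr_gt0.
  have [N hN] := cv _ e4; exists N => p q Np Nq.
  rewrite -L2norm2_mcomb; last exact: all_kdiff.
  rewrite mcomb_kdiff; apply: le_lt_trans (L2norm2_tri (mcomb2 _) W2 (mcomb2 _)) _.
  have := hN p Np; have := hN q Nq; rewrite (L2norm2BC W).
  set a := L2norm2 _; set b := L2norm2 _; clearbody a b; lra.
have c0 : 0 < L2norm2 (mker z) + 1 by rewrite ltr_wpDl// L2norm2_ge0.
have [N hN] := cv _ (divr_gt0 e0 c0); exists N => m Nm.
rewrite -Wf// -inner_mker// -inner_mcomb_mker// -innerBl//.
apply: le_lt_trans (Cauchy_Schwarz (L2B (mcomb2 (s_ m)) W2) (mker2 z)) _.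
have := hN m Nm; rewrite ltr_pdivlMr//.
have := L2norm2_ge0 (mcomb (s_ m) - W).
set a := L2norm2 _; set b := L2norm2 _; clearbody a b; lra.
Qed.

(** [HBnorm2] quantifies over all approximating sequences. Each of them has a limit in the model
    space whose first component extends to f, and [model_unique] puts it at distance 0 from W. *)
Lemma model_HBnorm2 W f : model W -> (forall z, inD z -> ext (top W) z = f z) ->
  HBnorm2 B f (L2norm2 W).
Proof.
move=> mW Wf; split=> [|g gf]; first exact: model_inHB mW Wf.
have [W' [mW' Wf' cv]] := HB_approx_model gf.
rewrite (@L2norm2_eq _ _ W W')//; [exact: H2_L2 mW.1|exact: H2_L2 mW'.1|].
have mD : model (W - W') by rewrite addrC -scaleN1r; exact: model_lin.
apply: model_unique => // z z1.
rewrite -inner_mker// innerBl//; [|exact: H2_L2 mW.1|exact: H2_L2 mW'.1].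
by rewrite !inner_mker// Wf// Wf'// subrr.
Qed.

End ModelSpace.

(** The (j, j) entry of the identity is the sum of the squared moduli in the j-th columns of both
    matrices. *)
Lemma isometry_entry_le {R : realType} (p q n : nat) (M : 'M[R[i]]_(p, n)) (M' : 'M[R[i]]_(q, n)) :
  adjmx M *m M + adjmx M' *m M' = 1%:M -> forall i j, csq (M i j) <= 1.
Proof.
move=> e i j; have := congr1 (fun (Z : 'M[R[i]]_n) => cre (Z j j)) e.
rewrite !mxE eqxx creD !cre_sum cre1.
have cc (z : R[i]) : cre (conjc z * z) = csq z by rewrite mulrC mul_conjE.
under eq_bigr do rewrite !mxE cc.
under [X in _ + X]eq_bigr do rewrite !mxE cc.
move=> <-; rewrite [X in _ <= X + _](bigD1 i)//= -addrA lerDl addr_ge0//.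
  by apply: sumr_ge0 => k _; exact: csq_ge0.
by apply: sumr_ge0 => k _; exact: csq_ge0.
Qed.

(** * The adjoint of the Toeplitz operator *)

Section ToeplitzAdjoint.
Context {R : realType} (n : nat).
Local Notation T := (@Tset R).
Variables (B : R[i] -> 'M[R[i]]_(1, n)) (Bb : R -> 'M[R[i]]_(1, n)) (Ab : R -> 'M[R[i]]_n).
Variable psi : R -> 'M[R[i]]_(1, n).
Hypothesis HB : forall i j, Hi (fun t => Bb t i j).
Hypothesis HA : forall i j, Hi (fun t => Ab t i j).
Hypothesis isoBA : forall t, adjmx (Bb t) *m Bb t + adjmx (Ab t) *m Ab t = 1%:M.
Hypothesis outerA : forall G : R -> 'cV[R[i]]_n, H2 G -> forall e : R, 0 < e ->
  exists X, H2 X /\ L2norm2 (fun t => G t - Ab t *m X t) < e.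
Hypothesis cauchyB : forall la, inD la -> forall j, cint (fun t => Bb t 0 j * kern la t) = B la 0 j.
Hypothesis psiA : forall t, psi t *m Ab t = Bb t.

Local Notation BA := (BA Bb Ab).
Local Notation model := (model Bb Ab).
Implicit Types (F : R -> 'cV[R[i]]_1) (G h u X : R -> 'cV[R[i]]_n).

Let HBu u (hu : H2 u) := H2_Bb HB hu.
Let HAu u (hu : H2 u) := H2_Ab HA hu.

Lemma inner_BA_colf u F G : H2 u -> L2 F -> L2 G ->
  inner (BA u) (colf F G) = inner (fun t => Bb t *m u t) F + inner (fun t => Ab t *m u t) G.
Proof.
by move=> hu F2 G2; rewrite inner_colf//; apply: H2_L2; [exact: HBu|exact: HAu].
Qed.

Let AK t i j : csq (Ab t i j) <= 1.
Proof. by apply: (@isometry_entry_le _ _ _ _ _ (Bb t)); rewrite addrC. Qed.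

Let L2_adj (m : nat) (M : R -> 'M[R[i]]_(m, n)) (X : R -> 'cV[R[i]]_m) :
  (forall i j, Hi (fun t => M t i j)) -> L2 X -> L2 (fun t => adjmx (M t) *m X t).
Proof.
move=> HM X2; apply: L2_mulmx => // i j; have [mM [K hK] _] := HM j i.
  by under eq_fun do rewrite !mxE; exact: cmeasurable_conj.
by exists K => t Tt; rewrite !mxE csq_conj hK.
Qed.

(* adjmx B *m psi + adjmx A is a left inverse of A, hence a right inverse. *)
Lemma Tdom_outer X : Tdom psi X -> exists u, [/\ H2 u,
  forall t, Ab t *m u t = X t & forall t, Bb t *m u t = psi t *m X t].
Proof.
move=> [hX psiX].
pose L t := adjmx (Bb t) *m psi t + adjmx (Ab t).
have AL t : Ab t *m L t = 1%:M.
  by apply: mulmx1C; rewrite mulmxDl -mulmxA psiA isoBA.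
pose u t := adjmx (Bb t) *m (psi t *m X t) + adjmx (Ab t) *m X t.
have uE t : u t = L t *m X t by rewrite /u mulmxDl mulmxA.
have Au t : Ab t *m u t = X t by rewrite uE mulmxA AL mul1mx.
exists u; split=> //; last by move=> t; rewrite -{1}psiA -mulmxA Au.
apply: (outer_division HA AK outerA).
  apply: (@L2D _ _ (fun t => adjmx (Bb t) *m (psi t *m X t)) (fun t => adjmx (Ab t) *m X t)).
    exact: L2_adj.
  by apply: L2_adj => //; exact: H2_L2.
by under eq_fun do rewrite Au.
Qed.

Lemma adj_rel_model F h : H2 F -> H2 h -> adj_rel psi F h <-> model (colf F (- h)).
Proof.
move=> hF hh; have F2 := H2_L2 hF; have h2 := H2_L2 hh.
have h2N := L2N h2.
have e u : H2 u -> inner (BA u) (colf F (- h)) =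
    inner (fun t => Bb t *m u t) F - inner (fun t => Ab t *m u t) h.
  by move=> hu; rewrite inner_BA_colf// innerNr//; exact/H2_L2/HAu.
split=> [[_ [_ adj]]|[_ mW]].
  split=> [|u hu]; first by apply: H2_colf => //; exact: H2N.
  rewrite e// (adj (fun t => Ab t *m u t) (fun t => Bb t *m u t)) ?subrr//.
  have BE : (fun t => psi t *m (Ab t *m u t)) = (fun t => Bb t *m u t).
    by apply/funext => t; rewrite mulmxA psiA.
  split; rewrite /Tdom /isP BE; split=> //; [exact: HAu|exact/H2_L2/HBu|exact: HBu].
split=> //; split=> // X Y [dX [hY PY]].
have [u [hu Au Bu]] := Tdom_outer dX.
have := mW u hu; rewrite e// => /eqP; rewrite subr_eq0 => /eqP.
have -> : (fun t => Ab t *m u t) = X by apply/funext.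
move=> <-; have Y2 := H2_L2 hY; have hBu := HBu hu.
(* [Y] is P(psi X), and psi X = B u is already in H^2. [Y] and B u therefore have the same Fourier
   coefficients, and are at distance 0 without being equal as functions. *)
apply: inner_norm0B => //; first exact: H2_L2.
apply: fourier_norm0; first by apply: L2B => //; exact: H2_L2.
move=> m; have [m0|m0] := ltP m 0; first by have [_] := H2B hY hBu; exact.
apply/matrixP => i j; rewrite (ord1 j) fourierE innerBl//; [|exact: H2_L2|exact: L2_etrig].
have BuE : (fun t => Bb t *m u t) = (fun t => psi t *m X t) by apply/funext.
by rewrite -!fourierE PY// BuE subrr mxE.
Qed.

Let topE F G : (fun t => usubmx (colf F G t)) = F.
Proof. by apply/funext => t; rewrite col_mxKu. Qed.

Lemma adjoint_densely_defined : densely_defined psi.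
Proof.
move=> G hG e e0; have [u [hu lu]] := outerA hG e0.
exists (fun t => Ab t *m u t); split=> //; split; first exact: HAu.
under eq_fun do rewrite mulmxA psiA.
exact/H2_L2/HBu.
Qed.

Lemma adjoint_domain F : H2 F -> (exists h, adj_rel psi F h) <-> inHB B (ext F).
Proof.
move=> hF; have F2 := H2_L2 hF; split=> [[h aFh]|[g gF]].
  have [_ [hh _]] := aFh; have /(adj_rel_model hF hh) mW := aFh.
  by apply: (model_inHB HB HA isoBA outerA cauchyB mW) => z _; rewrite topE.
(* Membership in H(B) yields an element (F', G) of the model space whose first component extends
   like F. F and F' are then at distance 0, so F' can be replaced by F in every inner product. *)
have [W [mW Wf _]] := HB_approx_model HB HA isoBA cauchyB gF.
have [F' [G [hF' hG WE]]] := H2_colfP mW.1.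
move: mW Wf; rewrite {W}WE => -[_ mW]; rewrite topE => Wf.
have F'2 := H2_L2 hF'; have G2 := H2_L2 hG.
exists (- G); apply/adj_rel_model => //; first exact: H2N.
rewrite opprK; split=> [|u hu]; first exact: H2_colf.
rewrite -(mW u hu) !inner_BA_colf//; congr (_ + _).
have bu := H2_L2 (HBu hu).
rewrite (inner_conj F2 bu) (inner_conj F'2 bu); congr conjc.
apply: inner_norm0B => //; have hD := H2B hF hF'.
apply: fourier_norm0; first exact: H2_L2.
apply: ext_eq0_fourier => // z z1 _.
have sk : L2 (sc (kb z)) by apply/sc_L2/Hi_sqi/Hi_kb.
by rewrite extE innerBl// -!extE Wf// subrr.
Qed.

Lemma HB_boundary f : inHB B f -> exists F, H2 F /\ forall z, inD z -> ext F z = f z.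
Proof.
move=> [g gf]; have [W [mW Wf _]] := HB_approx_model HB HA isoBA cauchyB gf.
have [F' [G [hF' hG WE]]] := H2_colfP mW.1.
by exists F'; split=> // z /Wf; rewrite WE topE.
Qed.

(** Moving B^* and A^* to the other side, the vanishing of P(B^* F + A^* G) becomes the
    orthogonality of (F, G) to every (B u, A u), which is membership in [model]. *)
Lemma adjoint_fplus F G : H2 F -> H2 G ->
  isP (fun t => adjmx (Bb t) *m F t + adjmx (Ab t) *m G t) (fun=> 0) ->
  adj_rel psi F (- G).
Proof.
move=> hF hG [_ P0]; have F2 := H2_L2 hF; have G2 := H2_L2 hG.
apply/adj_rel_model => //; first exact: H2N.
rewrite opprK; split=> [|u hu]; first exact: H2_colf.
rewrite inner_BA_colf// !inner_mulmx -innerDr; [|exact: L2_adj|exact: L2_adj|exact: H2_L2].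
apply: H2_orth => //; first by apply: L2D; exact: L2_adj.
move=> m m0; rewrite -[LHS]P0//.
by apply/matrixP => i j; rewrite (ord1 j) fourierE inner0l mxE.
Qed.

Lemma adjoint_norm F h : H2 F -> adj_rel psi F h ->
  HBnorm2 B (ext F) (L2norm2 F + L2norm2 h).
Proof.
move=> hF aFh; have [_ [hh _]] := aFh; have /(adj_rel_model hF hh) mW := aFh.
have h2 := H2_L2 hh.
rewrite -(L2norm2N h) -L2norm2_colf; [|exact: H2_L2|exact: L2N].
by apply: (model_HBnorm2 HB HA isoBA outerA cauchyB mW) => z _; rewrite topE.
Qed.

End ToeplitzAdjoint.

(** * Radial limits of matrix products, and invertibility of A on the circle *)

Section MatrixLimits.
Context {R : realType}.
Implicit Types (u v : nat -> R[i]) (x y : R[i]).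

Lemma ccvg_sum (I : Type) (r : seq I) (P : pred I) (F : I -> nat -> R[i]) (x : I -> R[i]) :
  (forall i, ccvg \oo (F i) (x i)) ->
  ccvg \oo (fun p => \sum_(i <- r | P i) F i p) (\sum_(i <- r | P i) x i).
Proof.
move=> cF; elim: r => [|i r ih].
  by rewrite big_nil; under eq_fun do rewrite big_nil; exact: ccvg_cst.
rewrite big_cons; under eq_fun do rewrite big_cons.
by case: (P i) => //; exact: ccvgD.
Qed.

Lemma ccvg_prod (I : Type) (r : seq I) (F : I -> nat -> R[i]) (x : I -> R[i]) :
  (forall i, ccvg \oo (F i) (x i)) ->
  ccvg \oo (fun p => \prod_(i <- r) F i p) (\prod_(i <- r) x i).
Proof.
move=> cF; elim: r => [|i r ih].
  by rewrite big_nil; under eq_fun do rewrite big_nil; exact: ccvg_cst.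
by rewrite big_cons; under eq_fun do rewrite big_cons; exact: ccvgM.
Qed.

Lemma ccvg_det n (M_ : nat -> 'M[R[i]]_n) (M : 'M[R[i]]_n) :
  (forall i j, ccvg \oo (fun p => M_ p i j) (M i j)) ->
  ccvg \oo (fun p => \det (M_ p)) (\det M).
Proof.
move=> cM; apply: ccvg_sum => s; apply: ccvgM; first exact: ccvg_cst.
by apply: ccvg_prod => i.
Qed.

Lemma ccvg_mulmx p q r (M_ : nat -> 'M[R[i]]_(p, q)) (M : 'M[R[i]]_(p, q))
    (L_ : nat -> 'M[R[i]]_(q, r)) (L : 'M[R[i]]_(q, r)) i j :
  (forall i j, ccvg \oo (fun p => M_ p i j) (M i j)) ->
  (forall i j, ccvg \oo (fun p => L_ p i j) (L i j)) ->
  ccvg \oo (fun p => (M_ p *m L_ p) i j) ((M *m L) i j).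
Proof.
move=> cM cL; rewrite mxE; under eq_fun do rewrite mxE.
by apply: ccvg_sum => k; exact: ccvgM.
Qed.

(** Both sides are multiplied by det A(z): the identity det A (B A^-1) A = det A B holds even where
    A(z) is singular, so it passes to the limit along the radius without discussing the zeros of det
    A. The limit determinant is nonzero and cancels. *)
Lemma radlim_mulmx_inv m n (B : R[i] -> 'M[R[i]]_(m, n)) (A : R[i] -> 'M[R[i]]_n) t
    (Bt Pt : 'M[R[i]]_(m, n)) (At : 'M[R[i]]_n) :
  (forall i j, radlim (fun z => B z i j) t (Bt i j)) ->
  (forall i j, radlim (fun z => A z i j) t (At i j)) ->
  (forall i j, radlim (fun z => (B z *m invmx (A z)) i j) t (Pt i j)) ->
  At \in unitmx -> Pt *m At = Bt.
Proof.
move=> cB cA cP uA; pose z p := Complex (rad p) 0 * cexpi t.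
have dA0 : \det At != 0 by rewrite -unitfE -unitmxE.
apply/matrixP => i j; apply: (mulfI dA0).
have cl (f : R[i] -> R[i]) l : radlim f t l -> ccvg \oo (fun p => f (z p)) l.
  exact: radlim_cvg.
have cA' i' j' := cl _ _ (cA i' j'); have cP' i' j' := cl _ _ (cP i' j').
have cdet : ccvg \oo (fun p => \det (A (z p))) (\det At) by exact: ccvg_det.
apply: (ccvg_unique (ccvgM cdet (ccvg_mulmx i j cP' cA'))).
have -> : (fun p => \det (A (z p)) * (B (z p) *m invmx (A (z p)) *m A (z p)) i j) =
    (fun p => \det (A (z p)) * B (z p) i j).
  apply/funext => p; have [->|d0] := eqVneq (\det (A (z p))) 0; first by rewrite !mul0r.
  by rewrite mulmxKV// unitmxE unitfE.
exact: ccvgM cdet (cl _ _ (cB i j)).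
Qed.

End MatrixLimits.

(* (1 - b' b)^-1 = 1 + b' b / (1 - b b'), with b' the adjoint of b. *)
Lemma isometry_unitmx {R : realType} n (b : 'M[R[i]]_(1, n)) (a : 'M[R[i]]_n) :
  adjmx b *m b + adjmx a *m a = 1%:M -> 0 < 1 - cre ((b *m adjmx b) 0 0) -> a \in unitmx.
Proof.
move=> e b1; set be := (b *m adjmx b) 0 0 in b1.
have d0 : 1 - be != 0.
  by apply/eqP => /(congr1 cre); rewrite !creE => h; move: b1; rewrite h ltxx.
have bb : b *m adjmx b = be%:M.
  by apply/matrixP => i j; rewrite (ord1 i) (ord1 j) [RHS]mxE eqxx mulr1n.
have aa : adjmx a *m a = 1%:M - adjmx b *m b by rewrite -e addrC addKr.
pose s := (1 - be)^-1.
suff /mulmx1_unit[] : ((1%:M + s *: (adjmx b *m b)) *m adjmx a) *m a = 1%:M by [].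
have PP : (adjmx b *m b) *m (adjmx b *m b) = be *: (adjmx b *m b).
  by rewrite -mulmxA (mulmxA b) bb mul_scalar_mx -scalemxAr.
rewrite -mulmxA aa; set P := adjmx b *m b in PP *.
rewrite mulmxBr mulmx1 mulmxDl mul1mx -scalemxAl PP scalerA.
have -> : s * be = s - 1 by rewrite /s; field.
by rewrite scalerBl scale1r; apply/matrixP => i j; rewrite !mxE; ring.
Qed.

Lemma Hinf_entry_le {R : realType} p q (M : 'M[R[i]]_(p, q)) (c : R) :
  (forall v : 'cV[R[i]]_q, msq (M *m v) <= c * msq v) -> forall i j, csq (M i j) <= c.
Proof.
move=> h i j; have := h (delta_mx j 0).
have -> : msq (delta_mx j 0 : 'cV[R[i]]_q) = 1.
  rewrite msqE (bigD1 j)//= big1 ?addr0 => [|k kj]; rewrite mxE ?eqxx ?csq1//.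
  by rewrite (negbTE kj) csq0.
rewrite mulr1; apply: le_trans; apply: le_trans (csq_le_msq _ i).
by rewrite -colE mxE.
Qed.

(** * From identities almost everywhere to identities everywhere *)

Section NullModification.
Context {R : realType}.
Local Notation mu := (@lebesgue_measure R).
Local Notation T := (@Tset R).
Local Notation mT := (@measurable_Tset R).

Lemma aeT_and (P Q : R -> Prop) : aeT P -> aeT Q -> aeT (fun t => P t /\ Q t).
Proof.
move=> aP aQ; apply: negligibleS (negligibleU aP aQ) => t [Tt /= h].
have [p|p] := pselect (P t); [right|left]; split=> //= q; exact: h.
Qed.

Lemma aeTP (P : R -> Prop) : aeT P -> exists N, [/\ measurable N, mu N = 0%E &
  forall t, T t -> ~ N t -> P t].
Proof.
move=> [N [mN N0 sN]]; exists N; split=> // t Tt Nt.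
by apply: contrapT => nP; apply: Nt; exact: sN.
Qed.

Variable N : set R.
Hypothesis mN : measurable N.
Hypothesis N0 : mu N = 0%E.

Lemma cint_eq_off (f g : R -> R[i]) : (forall t, T t -> ~ N t -> f t = g t) -> cint f = cint g.
Proof.
move=> fg; rewrite /cint; congr (Complex (_ / _) (_ / _));
  apply: (@Rintegral_eq_off_null _ _ _ mu T N _ _ mN N0) => t Tt Nt; by rewrite fg.
Qed.

Lemma fourier_eq_off k (F G : R -> 'cV[R[i]]_k) m :
  (forall t, T t -> ~ N t -> F t = G t) -> fourier F m = fourier G m.
Proof.
move=> FG; apply/matrixP => i j; rewrite !mxE; apply: cint_eq_off => t Tt Nt.
by rewrite FG.
Qed.

Lemma inner_eq_off k (F F' G : R -> 'cV[R[i]]_k) :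
  (forall t, T t -> ~ N t -> F t = F' t) -> inner F G = inner F' G.
Proof. by move=> FF'; apply: cint_eq_off => t Tt Nt; rewrite FF'. Qed.

Lemma L2norm2_eq_off k (F G : R -> 'cV[R[i]]_k) :
  (forall t, T t -> ~ N t -> F t = G t) -> L2norm2 F = L2norm2 G.
Proof.
move=> FG; congr (_ / _).
by apply: (@Rintegral_eq_off_null _ _ _ mu T N _ _ mN N0) => t Tt Nt; rewrite FG.
Qed.

(* Boundary functions are only constrained almost everywhere on T; overriding
   them elsewhere makes the pointwise identities hold at every real t. *)
Definition off (V : Type) (c : V) (F : R -> V) (t : R) : V := if t \in N `|` ~` T then c else F t.

Lemma off_in V (c : V) F t : T t -> ~ N t -> off c F t = F t.
Proof. by move=> Tt Nt; rewrite /off memNset// => -[]. Qed.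

Lemma measurable_off : measurable (N `|` ~` T).
Proof. by apply: measurableU => //; apply: measurableC; exact: mT. Qed.

Lemma L2_off k (F : R -> 'cV[R[i]]_k) : L2 F -> L2 (off 0 F).
Proof.
move=> /L2P F2; apply/L2P => i; have [mF iF] := F2 i.
have -> : (fun t => off 0 F t i 0) = (fun t => if t \in N `|` ~` T then 0 else F t i 0).
  by apply/funext => t; rewrite /off; case: ifP; rewrite ?mxE.
apply: (sqi_dom _ iF).
  apply: cmeasurable_if; [exact: mT|exact: measurable_off|exact: cmeasurable_cst|exact: mF].
by move=> t Tt; case: ifP => _; rewrite ?csq0 ?csq_ge0.
Qed.

Lemma H2_off k (F : R -> 'cV[R[i]]_k) : H2 F -> H2 (off 0 F).
Proof.
move=> [F2 F0]; split=> [|m m0]; first exact: L2_off.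
by rewrite (@fourier_eq_off _ _ F) ?F0// => t Tt Nt; rewrite off_in.
Qed.

Lemma bdry_Hi f (g : R -> R[i]) (c : R[i]) K : holo f -> (forall z, inD z -> csq (f z) <= K) ->
  (forall t, T t -> ~ N t -> radlim f t (g t)) -> (forall t, csq (off c g t) <= 1) ->
  Hi (off c g).
Proof.
move=> hf fK fg g1; have mg : cmeasurable T (off c g).
  apply: (bdry_measurable hf measurable_off (c := c)) => t Tt.
    by rewrite /off mem_set.
  move=> Nt; have Nt' : ~ N t by move=> ?; apply: Nt; left.
  by rewrite off_in//; exact: fg.
split=> //; first by exists 1.
move=> m m0; apply: (boundary_neg_fourier hf fK mg mN N0) => // t Tt Nt.
by rewrite off_in//; exact: fg.
Qed.

Section Operators.
Variables (m k : nat) (psi : R -> 'M[R[i]]_(m, k)).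
Let psi' := off 0 psi.

Lemma off_mulmx X t : psi t *m off (0 : 'cV[R[i]]_k) X t =
  off 0 (fun t => psi t *m X t) t.
Proof. by rewrite /off; case: ifP; rewrite ?mulmx0. Qed.

Lemma mulmx_off (X : R -> 'cV[R[i]]_k) : (fun t => psi' t *m X t) = off 0 (fun t => psi t *m X t).
Proof. by apply/funext => t; rewrite /psi' /off; case: ifP; rewrite ?mul0mx. Qed.

(** On the exceptional set [psi] is arbitrary and may spoil the measurability of psi X. Setting X to
    0 there makes the product vanish there as well. *)
Lemma Tdom_off X : Tdom psi' X -> Tdom psi (off 0 X).
Proof.
move=> [hX]; rewrite mulmx_off => pX; split; first exact: H2_off.
by under eq_fun do rewrite off_mulmx.
Qed.

Lemma densely_defined_off : densely_defined psi' -> densely_defined psi.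
Proof.
move=> dd G hG e e0; have [X [dX lX]] := dd G hG e e0.
exists (off 0 X); split; first exact: Tdom_off.
by rewrite (L2norm2_eq_off (G := fun t => G t - X t))// => t Tt Nt; rewrite off_in.
Qed.

Lemma adj_rel_off F h : adj_rel psi' F h <-> adj_rel psi F h.
Proof.
split=> -[hF [hh adj]]; (split; [exact: hF|split; [exact: hh|]]) => X Y [dX [hY PY]].
  apply: adj; split; last first.
    split=> [|l l0]; [exact: hY|]; rewrite (PY l l0); apply: fourier_eq_off => t Tt Nt.
    by rewrite /psi' off_in.
  by case: dX => hX pX; split; [exact: hX|rewrite mulmx_off; exact: L2_off].
rewrite (adj (off 0 X) Y).
  by apply: inner_eq_off => t Tt Nt; rewrite off_in.
split; first exact: Tdom_off.
split=> [|l l0]; [exact: hY|]; rewrite (PY l l0); apply: fourier_eq_off => t Tt Nt.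
by rewrite /psi' !off_in.
Qed.

End Operators.
End NullModification.

Theorem theorem2p1 (R : realType) (n : nat)
  (B : R[i] -> 'M[R[i]]_(1, n)) (A : R[i] -> 'M[R[i]]_n)
  (Bb : R -> 'M[R[i]]_(1, n)) (Ab : R -> 'M[R[i]]_n)
  (psi : R -> 'M[R[i]]_(1, n)) :
  schur B ->
  bdry B Bb ->
  log_integrable Bb ->
  outer A Ab ->
  aeT (fun t => adjmx (Bb t) *m Bb t + adjmx (Ab t) *m Ab t = 1%:M) ->
  (* psi = boundary function of phi = B A^{-1} *)
  bdry (fun z => B z *m invmx (A z)) psi ->
  (* T_phi is densely defined in H^2_{C^n} *)
  densely_defined psi /\
  (* dom(T_phi^* ) = H(B) *)
  (forall F : R -> 'cV[R[i]]_1, H2 F ->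
     ((exists h, adj_rel psi F h) <-> inHB B (ext F))) /\
  (forall f : R[i] -> R[i], inHB B f ->
     exists F : R -> 'cV[R[i]]_1, H2 F /\ forall z, inD z -> ext F z = f z) /\
  (* T_phi^* f = - f^+, where f^+ in H^2_{C^n} solves T_B^* f + T_A^* f^+ = 0 *)
  (forall F : R -> 'cV[R[i]]_1, H2 F -> inHB B (ext F) ->
     forall G : R -> 'cV[R[i]]_n, H2 G ->
       isP (fun t => adjmx (Bb t) *m F t + adjmx (Ab t) *m G t) (fun _ => 0) ->
       adj_rel psi F (fun t => - G t)) /\
  (* ||f||_{H(B)}^2 = ||f||_{H^2}^2 + ||T_phi^* f||^2 *)
  (forall F : R -> 'cV[R[i]]_1, H2 F -> inHB B (ext F) ->
     forall h : R -> 'cV[R[i]]_n, adj_rel psi F h ->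
       HBnorm2 B (ext F) (L2norm2 F + L2norm2 h)).
Proof.
move=> [hoB B1] cB [pos _] [[hoA [K AK]] [cA outA]] iso cP.
have [N [mN N0 hN]] := aeTP (aeT_and cB (aeT_and cA (aeT_and cP (aeT_and iso pos)))).
(* With B = 0, A = 1 and psi = 0 on the exceptional set, both B^* B + A^* A = I and psi A = B hold
   there too, hence at every real t. *)
pose Bb' := off N 0 Bb; pose Ab' := off N 1%:M Ab; pose psi' := off N 0 psi.
have offP t : (Tset t /\ ~ N t) \/ [/\ Bb' t = 0, Ab' t = 1%:M & psi' t = 0].
  rewrite /Bb' /Ab' /psi' /off; have [|/negP h] := boolP (t \in _); [by right|left].
  by split; apply: contrapT => h'; apply: h; apply/mem_set; [right|left; apply: contrapT].
have Bb_in t : Tset t -> ~ N t -> Bb' t = Bb t by exact: off_in.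
have Ab_in t : Tset t -> ~ N t -> Ab' t = Ab t by exact: off_in.
have psi_in t : Tset t -> ~ N t -> psi' t = psi t by exact: off_in.
have iso' t : adjmx (Bb' t) *m Bb' t + adjmx (Ab' t) *m Ab' t = 1%:M.
  have [[Tt Nt]|[-> -> _]] := offP t.
    by rewrite Bb_in// Ab_in//; have [_ [_ [_ []]]] := hN t Tt Nt.
  by rewrite mulmx0 add0r mulmx1 /adjmx map_mx1 trmx1.
have psiA t : psi' t *m Ab' t = Bb' t.
  have [[Tt Nt]|[-> -> ->]] := offP t; last by rewrite mul0mx.
  rewrite Bb_in// Ab_in// psi_in//; have [h1 [h2 [h3 [h4 h5]]]] := hN t Tt Nt.
  (* Positivity of 1 - B B^* at t, recorded in [h5], makes [Ab t] invertible, so that the relation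
     phi A = B survives in the radial limit. *)
  exact: radlim_mulmx_inv h1 h2 h3 (isometry_unitmx h4 h5).
have Bbnd z : inD z -> forall i j, csq (B z i j) <= 1.
  by move=> z1; apply: Hinf_entry_le => v; rewrite mul1r; exact: B1.
have HB i j : Hi (fun t => Bb' t i j).
  have E : (fun t => Bb' t i j) = off N 0 (fun t => Bb t i j).
    by apply/funext => t; rewrite /Bb' /off; case: ifP; rewrite ?mxE.
  rewrite E; apply: (bdry_Hi mN N0 (hoB i j) (K := 1)) => [z z1|t Tt Nt|t].
  - exact: Bbnd.
  - by have [h _] := hN t Tt Nt; exact: h.
  - by rewrite -E; exact: isometry_entry_le (iso' t) i j.
have HA i j : Hi (fun t => Ab' t i j).
  have E : (fun t => Ab' t i j) = off N (1%:M i j) (fun t => Ab t i j).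
    by apply/funext => t; rewrite /Ab' /off; case: ifP.
  rewrite E; apply: (bdry_Hi mN N0 (hoA i j) (K := K)) => [z z1|t Tt Nt|t].
  - by apply: Hinf_entry_le => v; exact: AK.
  - by have [_ [h _]] := hN t Tt Nt; exact: h.
  - rewrite -E; have := iso' t; rewrite addrC => e.
    exact: isometry_entry_le e i j.
have cauchyB la : inD la -> forall j, cint (fun t => Bb' t 0 j * kern la t) = B la 0 j.
  move=> l1 j; have [mB _ _] := HB 0 j.
  apply: (cauchy_boundary (hoB 0 j) (K := 1) _ l1 mB mN N0) => [z z1|t Tt Nt].
    exact: Bbnd.
  by rewrite Bb_in//; have [h _] := hN t Tt Nt; exact: h.
have outA' G : H2 G -> forall e : R, 0 < e ->
    exists X, H2 X /\ L2norm2 (fun t => G t - Ab' t *m X t) < e.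
  move=> hG e e0; have [X [hX lX]] := outA G hG e e0; exists X; split; first exact: hX.
  rewrite (L2norm2_eq_off mN N0 (G := fun t => G t - Ab t *m X t)); first exact: lX.
  by move=> t Tt Nt; rewrite Ab_in.
split; first by apply: (densely_defined_off mN N0); exact: adjoint_densely_defined HB HA outA' psiA.
split=> [F hF|].
  rewrite -(adjoint_domain HB HA iso' outA' cauchyB psiA hF).
  by split=> -[h ah]; exists h; apply/(adj_rel_off mN N0).
split=> [f|]; first exact: HB_boundary HB HA iso' cauchyB f.
split=> [F hF _ G hG [_ P0]|F hF _ h aFh].
  apply/(adj_rel_off mN N0); apply: (adjoint_fplus HB HA iso' outA' psiA hF hG).
  split=> [|m m0]; first exact: H2_0.
  rewrite (P0 m m0); apply: (fourier_eq_off mN N0) => t Tt Nt.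
  by rewrite (Bb_in _ Tt Nt) (Ab_in _ Tt Nt).
by apply: (adjoint_norm HB HA iso' outA' cauchyB psiA hF); apply/(adj_rel_off mN N0).
Qed.
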